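(* Let $k$ be an algebraically closed field of characteristic zero and let $E$ be an elliptic curve over $k$. Then the group $\mathrm{Bir}(E\times\mathbb{P}^1)$ of birational $k$-automorphisms of $E\times\mathbb{P}^1$ is not a Jordan group.
   Context: Here $\mathbb{P}^1$ is the projective line over $k$. For an irreducible algebraic variety $U$ over $k$, $\mathrm{Bir}(U)$ denotes the group of birational $k$-automorphisms of $U$. Definition (Jordan group): a group $B$ is called a Jordan group if there exists a positive integer $J_B$ such that every finite subgroup $B_1$ of $B$ contains a (normal) commutative subgroup whose index in $B_1$ is at most $J_B$. (Requiring or not requiring the commutative subgroup to be normal in $B_1$ defines the same class of groups, with possibly different constants $J_B$.) *)

(* Defs.v *)
From HB Require Import structures.
From mathcomp Require Import all_boot all_order all_algebra.
From mathcomp Require Import mpoly.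
From mathcomp Require Import boolp classical_sets functions cardinality filter.
From mathcomp Require Import topology.

Set Implicit Arguments.
Unset Strict Implicit.
Unset Printing Implicit Defensive.

Import GRing.Theory.
Local Open Scope classical_set_scope.
Local Open Scope ring_scope.

(* [G] may be infinite, so its subgroups are sets and the index of [A] in [B] *)
(* is the cardinal of the set of the cosets [x A], for [x] in [B].            *)
(* Normality of [A] in [B] is not required.                                   *)
Definition jordan_group (G : groupType) : Prop :=
  exists2 J : nat, (0 < J)%N &
    forall B : set G, finite_set B -> group_closed (mem B) ->
    exists A : set G,
      [/\ A `<=` B, group_closed (mem A),
          {in A &, forall x y, commute x y} &
          ([set [set (x * a)%g | a in A] | x in B] #<= `I_J)%card].

(* Varieties over k are spaces with functions: a topological space together   *)
(* with a sheaf of k-valued functions, closed under the ring operations, such *)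
(* that the non-vanishing locus of a regular f is open and 1/f is regular on  *)
(* it.  The sheaf is given by its stalks: [regular_at f x] means that f is    *)
(* regular on some neighborhood of x.  The functions are total, and their     *)
(* values far from x are irrelevant.                                          *)
HB.mixin Record hasRegularFunctions (k : fieldType) X of Topological X := {
  regular_at : (X -> k) -> X -> Prop;
  regular_at_near : forall f x,
    regular_at f x -> \forall y \near x, regular_at f y;
  eq_near_regular_at : forall f g x,
    (\forall y \near x, f y = g y) -> regular_at f x -> regular_at g x;
  regular_at_cst : forall c x, regular_at (fun=> c) x;
  regular_atD : forall f g x,
    regular_at f x -> regular_at g x -> regular_at (fun y => f y + g y) x;
  regular_atM : forall f g x,
    regular_at f x -> regular_at g x -> regular_at (fun y => f y * g y) x;
  regular_at_neq0 : forall f x,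
    regular_at f x -> f x != 0 -> \forall y \near x, f y != 0;
  regular_atV : forall f x,
    regular_at f x -> f x != 0 -> regular_at (fun y => (f y)^-1) x
}.

#[short(type="funSpaceType")]
HB.structure Definition FunSpace (k : fieldType) :=
  {X of Topological X & hasRegularFunctions k X}.

(* [f] restricts to a morphism [U -> Y] on the open set [U]. *)
Definition morphism_on (k : fieldType) (X Y : funSpaceType k) (U : set X)
    (f : X -> Y) : Prop :=
  forall x, U x ->
    {for x, continuous f} /\
    forall h : Y -> k, regular_at h (f x) -> regular_at (h \o f) x.

Section BirationalAutomorphisms.
Variables (k : fieldType) (X : funSpaceType k).

(* A birational automorphism is represented by an isomorphism [f : U -> V]    *)
(* between dense open subsets of [X] (for an irreducible [X]: between         *)
(* nonempty open subsets), with inverse [g].  Only the restrictions of [f] to *)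
(* [U] and of [g] to [V] are meaningful.                                      *)
Record birational_rep := BirationalRep {
  bdom : set X;
  bcod : set X;
  bfun : X -> X;
  binv : X -> X;
  bdom_open : open bdom;
  bdom_dense : dense bdom;
  bcod_open : open bcod;
  bcod_dense : dense bcod;
  bfun_morph : morphism_on bdom bfun;
  binv_morph : morphism_on bcod binv;
  bfun_dom : forall x, bdom x -> bcod (bfun x);
  binv_cod : forall x, bcod x -> bdom (binv x);
  bfunK : forall x, bdom x -> binv (bfun x) = x;
  binvK : forall x, bcod x -> bfun (binv x) = x
}.

HB.instance Definition _ := gen_eqMixin birational_rep.
HB.instance Definition _ := gen_choiceMixin birational_rep.

Lemma open_denseI (U V : set X) :
  open U -> dense U -> dense V -> dense (U `&` V).
Proof.
move=> oU dU dV O O0 oO; rewrite setIA.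
by apply: dV; [exact: dU | exact: openI].
Qed.

Definition same_rational_map (f g : birational_rep) : Prop :=
  exists W : set X,
    [/\ open W, dense W, W `<=` bdom f `&` bdom g &
        {in W, bfun f =1 bfun g}].

Lemma same_rational_map_refl f : same_rational_map f f.
Proof.
by exists (bdom f); split=> //; [exact: bdom_open | exact: bdom_dense].
Qed.

Lemma same_rational_map_sym f g :
  same_rational_map f g -> same_rational_map g f.
Proof.
move=> [W [oW dW sW e]]; exists W; split=> //; first by rewrite setIC.
by move=> x /e.
Qed.

Lemma same_rational_map_trans f g h :
  same_rational_map f g -> same_rational_map g h -> same_rational_map f h.
Proof.
move=> [W [oW dW sW e]] [W' [oW' dW' sW' e']].
exists (W `&` W'); split; [exact: openI | exact: open_denseI | |].
- by move=> x [/sW[? _] /sW'[_ ?]].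
- by move=> x /set_mem[Wx W'x]; rewrite (e _ (mem_set Wx)) (e' _ (mem_set W'x)).
Qed.

Lemma morphism_on_comp (f g : X -> X) (U V : set X) :
  morphism_on U f -> morphism_on V g ->
  morphism_on (U `&` f @^-1` V) (g \o f).
Proof.
move=> mf mg x [/mf[cf rf] /mg[cg rg]]; split=> [|h /rg /rf //].
exact: continuous_comp.
Qed.

Lemma open_morphism_preimage (f : X -> X) (U V : set X) :
  open U -> morphism_on U f -> open V -> open (U `&` f @^-1` V).
Proof.
move=> oU mf oV; rewrite openE => x [Ux Vfx].
apply: filterI; first exact: open_nbhs_nbhs.
by have [cf _] := mf x Ux; apply: cf; exact: open_nbhs_nbhs.
Qed.

Lemma dense_bdom_preimage (f : birational_rep) (V : set X) :
  dense V -> dense (bdom f `&` bfun f @^-1` V).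
Proof.
move=> dV O O0 oO.
have [x [Ox Ux]] := bdom_dense f O0 oO.
pose O' := bcod f `&` binv f @^-1` (O `&` bdom f).
have oO' : open O'.
  apply: open_morphism_preimage; [exact: bcod_open | exact: binv_morph |].
  exact/openI/bdom_open.
have O'0 : O' !=set0.
  exists (bfun f x); split; first exact: bfun_dom.
  by rewrite /= bfunK.
have [y [[Cy [Ogy Ugy]] Vy]] := dV _ O'0 oO'.
by exists (binv f y); split=> //; split=> //=; rewrite binvK.
Qed.

Lemma denseT : dense [set: X].
Proof. by move=> O O0 _; rewrite setIT. Qed.

Lemma morphism_on_id (U : set X) : morphism_on U id.
Proof. by move=> x _; split=> //; exact: cvg_id. Qed.

Definition birational_rep1 : birational_rep :=
  BirationalRep openT denseT openT denseT (@morphism_on_id setT)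
    (@morphism_on_id setT) (fun _ => id) (fun _ => id)
    (fun _ _ => erefl) (fun _ _ => erefl).

Definition birational_repV (f : birational_rep) : birational_rep :=
  BirationalRep (@bcod_open f) (@bcod_dense f) (@bdom_open f) (@bdom_dense f)
    (@binv_morph f) (@bfun_morph f) (@binv_cod f) (@bfun_dom f)
    (@binvK f) (@bfunK f).

#[local] Obligation Tactic := idtac.

Program Definition birational_repM (f g : birational_rep) : birational_rep :=
  @BirationalRep (bdom g `&` bfun g @^-1` bdom f)
    (bcod f `&` binv f @^-1` bcod g)
    (bfun f \o bfun g) (binv g \o binv f) _ _ _ _ _ _ _ _ _ _.
Next Obligation.
move=> f g; apply: open_morphism_preimage;
  [exact: bdom_open | exact: bfun_morph | exact: bdom_open].
Qed.
Next Obligation.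
by move=> f g; apply: dense_bdom_preimage; exact: bdom_dense.
Qed.
Next Obligation.
move=> f g; apply: open_morphism_preimage;
  [exact: bcod_open | exact: binv_morph | exact: bcod_open].
Qed.
Next Obligation.
move=> f g; apply: (@dense_bdom_preimage (birational_repV f)).
exact: bcod_dense.
Qed.
Next Obligation.
by move=> f g; apply: morphism_on_comp; exact: bfun_morph.
Qed.
Next Obligation.
by move=> f g; apply: morphism_on_comp; exact: binv_morph.
Qed.
Next Obligation.
move=> f g x [Ux Vx]; split; first exact: bfun_dom.
by rewrite /= bfunK //; exact: bfun_dom.
Qed.
Next Obligation.
move=> f g x [Ux Vx]; split; first exact: binv_cod.
by rewrite /= binvK //; exact: binv_cod.
Qed.
Next Obligation. by move=> f g x [Ux Vx] /=; rewrite !bfunK. Qed.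
Next Obligation. by move=> f g x [Ux Vx] /=; rewrite !binvK. Qed.

Definition same_rational_mapb (f g : birational_rep) : bool :=
  `[< same_rational_map f g >].

Lemma same_rational_mapb_equiv : equiv_class_of same_rational_mapb.
Proof.
split=> [f|f g|g f h].
- exact/asboolP/same_rational_map_refl.
- by apply/asboolP/asboolP; exact: same_rational_map_sym.
- move=> /asboolP fg /asboolP gh; apply/asboolP.
  exact: same_rational_map_trans fg gh.
Qed.

Canonical same_rational_map_equiv := EquivRelPack same_rational_mapb_equiv.

Lemma same_rational_mapM f f' g g' :
  same_rational_map f f' -> same_rational_map g g' ->
  same_rational_map (birational_repM f g) (birational_repM f' g').
Proof.
move=> [W [oW dW sW e]] [W' [oW' dW' sW' e']].
have oP : open (bdom g `&` bfun g @^-1` W).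
  by apply: open_morphism_preimage; [exact: bdom_open | exact: bfun_morph |].
exists (W' `&` (bdom g `&` bfun g @^-1` W)); split; first exact: openI.
- by apply: open_denseI => //; exact: dense_bdom_preimage.
- move=> x [W'x [gx /[dup] Wgx /sW[fx f'x]]]; have [_ g'x] := sW' _ W'x.
  by split; split=> //=; rewrite -(e' _ (mem_set W'x)).
- move=> x /set_mem[W'x [gx Wgx]] /=.
  by rewrite -(e' _ (mem_set W'x)) (e _ (mem_set Wgx)).
Qed.

Lemma same_rational_mapV f g :
  same_rational_map f g ->
  same_rational_map (birational_repV f) (birational_repV g).
Proof.
move=> [W [oW dW sW e]].
pose V := bcod f `&` binv f @^-1` W.
have oV : open V.
  by apply: open_morphism_preimage; [exact: bcod_open | exact: binv_morph |].
have fV x : V x -> bcod g x /\ binv f x = binv g x.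
  move=> [fx Wx]; have [_ gx] := sW _ Wx.
  have -> : x = bfun g (binv f x) by rewrite -(e _ (mem_set Wx)) binvK.
  split; first exact: bfun_dom.
  by rewrite (bfunK gx) -(e _ (mem_set Wx)) binvK.
exists V; split=> //.
- exact: (@dense_bdom_preimage (birational_repV f)).
- by move=> x /[dup] /fV[gx _] [fx _].
- by move=> x /set_mem /fV[].
Qed.

Lemma same_rational_map_id (f : birational_rep) :
  {in bdom f, bfun f =1 id} -> same_rational_map f birational_rep1.
Proof.
move=> e; exists (bdom f); split=> //; [exact: bdom_open | exact: bdom_dense].
Qed.

Definition Bir : Type := {eq_quot same_rational_map_equiv}%qT.
HB.instance Definition _ := Choice.on Bir.
HB.instance Definition _ := EqQuotient.on Bir.

Definition Bir_one : Bir := \pi_Bir%qT birational_rep1.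
Definition Bir_inv (f : Bir) : Bir := \pi_Bir%qT (birational_repV (repr f)).
Definition Bir_mul (f g : Bir) : Bir :=
  \pi_Bir%qT (birational_repM (repr f) (repr g)).

Lemma Bir_piP (f g : birational_rep) :
  \pi_Bir%qT f = \pi_Bir%qT g <-> same_rational_map f g.
Proof.
split=> [/eqP|fg]; first by rewrite pi_eq_quot => /asboolP.
by apply/eqP; rewrite pi_eq_quot; apply/asboolP.
Qed.

Lemma Bir_repr_pi (f : birational_rep) :
  same_rational_map (repr (\pi_Bir%qT f)) f.
Proof. by apply/Bir_piP; rewrite reprK. Qed.

Lemma Bir_mulE (f g : birational_rep) :
  Bir_mul (\pi_Bir%qT f) (\pi_Bir%qT g) = \pi_Bir%qT (birational_repM f g).
Proof. by apply/Bir_piP; apply: same_rational_mapM; exact: Bir_repr_pi. Qed.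

Lemma Bir_invE (f : birational_rep) :
  Bir_inv (\pi_Bir%qT f) = \pi_Bir%qT (birational_repV f).
Proof. by apply/Bir_piP; apply: same_rational_mapV; exact: Bir_repr_pi. Qed.

Lemma Bir_mulA : associative Bir_mul.
Proof.
elim/quotW=> f; elim/quotW=> g; elim/quotW=> h.
rewrite (Bir_mulE g h) (Bir_mulE f g) (Bir_mulE f) (Bir_mulE _ h).
apply/Bir_piP; set l := birational_repM _ _; exists (bdom l).
split=> [||x|x _]; [exact: bdom_open | exact: bdom_dense | |by []].
by move=> [[hx ghx] fx].
Qed.

Lemma Bir_mul1g : left_id Bir_one Bir_mul.
Proof.
elim/quotW=> f; rewrite Bir_mulE; apply/Bir_piP.
exists (bdom f); split=> //; [exact: bdom_open | exact: bdom_dense].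
Qed.

Lemma Bir_mulg1 : right_id Bir_one Bir_mul.
Proof.
elim/quotW=> f; rewrite Bir_mulE; apply/Bir_piP.
exists (bdom f); split=> //; [exact: bdom_open | exact: bdom_dense].
Qed.

Lemma Bir_mulVg : left_inverse Bir_one Bir_inv Bir_mul.
Proof.
elim/quotW=> f; rewrite Bir_invE Bir_mulE; apply/Bir_piP.
by apply: same_rational_map_id => x /set_mem[fx _] /=; exact: bfunK.
Qed.

Lemma Bir_mulgV : right_inverse Bir_one Bir_inv Bir_mul.
Proof.
elim/quotW=> f; rewrite Bir_invE Bir_mulE; apply/Bir_piP.
by apply: same_rational_map_id => x /set_mem[fx _] /=; exact: binvK.
Qed.

HB.instance Definition _ :=
  isGroup.Build Bir Bir_mulA Bir_mul1g Bir_mulg1 Bir_mulVg Bir_mulgV.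

End BirationalAutomorphisms.

(* A locally closed subvariety [A] of [X] carries the induced topology, and   *)
(* its regular functions are locally restrictions of regular functions on X.  *)
Section Subvariety.
Variables (k : fieldType) (X : funSpaceType k) (A : set X).

Definition sub_regular_at (f : A -> k) (x : A) : Prop :=
  exists2 F : X -> k, regular_at F (set_val x) &
    \forall y \near x, f y = F (set_val y).

Lemma near_set_val (P : X -> Prop) (x : A) :
  (\forall y \near set_val x, P y) -> \forall y \near x, P (set_val y).
Proof. exact: (@initial_continuous A X set_val x). Qed.

Lemma sub_regular_at_near f x :
  sub_regular_at f x -> \forall y \near x, sub_regular_at f y.
Proof.
move=> [F /regular_at_near/near_set_val rF /near_join fF].
by apply: filterS2 rF fF => y rFy fFy; exists F.
Qed.

Lemma eq_near_sub_regular_at f g x :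
  (\forall y \near x, f y = g y) -> sub_regular_at f x -> sub_regular_at g x.
Proof.
move=> fg [F rF fF]; exists F => //.
by apply: filterS2 fg fF => y <-.
Qed.

Lemma sub_regular_at_cst c x : sub_regular_at (fun=> c) x.
Proof.
by exists (fun=> c); [exact: regular_at_cst | exact: (@nearW _ (nbhs x))].
Qed.

Lemma sub_regular_atD f g x :
  sub_regular_at f x -> sub_regular_at g x ->
  sub_regular_at (fun y => f y + g y) x.
Proof.
move=> [F rF fF] [G rG gG]; exists (fun y => F y + G y).
  exact: regular_atD.
by apply: filterS2 fF gG => y -> ->.
Qed.

Lemma sub_regular_atM f g x :
  sub_regular_at f x -> sub_regular_at g x ->
  sub_regular_at (fun y => f y * g y) x.
Proof.
move=> [F rF fF] [G rG gG]; exists (fun y => F y * G y).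
  exact: regular_atM.
by apply: filterS2 fF gG => y -> ->.
Qed.

Lemma sub_regular_at_neq0 f x :
  sub_regular_at f x -> f x != 0 -> \forall y \near x, f y != 0.
Proof.
move=> [F rF fF]; rewrite (nbhs_singleton fF).
move=> /(regular_at_neq0 _ _ rF)/near_set_val.
by apply: filterS2 fF => y ->.
Qed.

Lemma sub_regular_atV f x :
  sub_regular_at f x -> f x != 0 -> sub_regular_at (fun y => (f y)^-1) x.
Proof.
move=> [F rF fF]; rewrite (nbhs_singleton fF) => Fx.
exists (fun y => (F y)^-1); first exact: regular_atV.
by apply: filterS fF => y ->.
Qed.

HB.instance Definition _ := hasRegularFunctions.Build k A
  sub_regular_at_near eq_near_sub_regular_at sub_regular_at_cst
  sub_regular_atD sub_regular_atM sub_regular_at_neq0 sub_regular_atV.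

End Subvariety.

(* The product of varieties: the functions sum_i f_i(x) g_i(y), with f_i      *)
(* regular on U and g_i regular on V, are regular on U x V, and their         *)
(* non-vanishing loci form a base of the topology, which is finer than the    *)
(* product topology; the regular functions are locally the quotients of such  *)
(* sums.                                                                      *)
Definition prod_variety (k : fieldType) (X Y : funSpaceType k) : Type :=
  (X * Y)%type.

Section ProductVariety.
Variables (k : fieldType) (X Y : funSpaceType k).
Local Notation XY := (prod_variety X Y).
Implicit Types (z : XY) (s t : seq ((X -> k) * (Y -> k))).

Definition tensor s z : k := \sum_(p <- s) p.1 z.1 * p.2 z.2.

Definition tensor_regular s z : Prop :=
  forall p, p \in s -> regular_at p.1 z.1 /\ regular_at p.2 z.2.

Definition tensor_cst (c : k) : seq ((X -> k) * (Y -> k)) :=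
  [:: (fun=> c, fun=> 1)].

Definition tensor_mul s t : seq ((X -> k) * (Y -> k)) :=
  [seq ((fun x => p.1 x * q.1 x), (fun y => p.2 y * q.2 y)) | p <- s, q <- t].

Lemma tensor_cstE c z : tensor (tensor_cst c) z = c.
Proof. by rewrite /tensor big_seq1 mulr1. Qed.

Lemma tensor_cst_regular c z : tensor_regular (tensor_cst c) z.
Proof.
by move=> p; rewrite inE => /eqP -> /=; split; exact: regular_at_cst.
Qed.

Lemma tensor_catE s t z : tensor (s ++ t) z = tensor s z + tensor t z.
Proof. exact: big_cat. Qed.

Lemma tensor_cat_regular s t z :
  tensor_regular s z -> tensor_regular t z -> tensor_regular (s ++ t) z.
Proof. by move=> rs rt p; rewrite mem_cat => /orP[/rs|/rt]. Qed.

Lemma tensor_mulE s t z : tensor (tensor_mul s t) z = tensor s z * tensor t z.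
Proof.
rewrite /tensor /tensor_mul big_allpairs_dep mulr_suml; apply: eq_bigr => p _.
by rewrite mulr_sumr; apply: eq_bigr => q _ /=; rewrite mulrACA.
Qed.

Lemma tensor_mul_regular s t z :
  tensor_regular s z -> tensor_regular t z ->
  tensor_regular (tensor_mul s t) z.
Proof.
move=> rs rt _ /allpairsP[[p q] /= [/rs[p1 p2] /rt[q1 q2] ->]] /=.
by split; exact: regular_atM.
Qed.

Definition prod_variety_open : set_system XY := [set W |
  forall z, W z -> exists U V s,
    [/\ open U /\ U z.1, open V /\ V z.2, tensor s z != 0 &
        forall z', U z'.1 -> V z'.2 ->
          tensor_regular s z' /\ (tensor s z' != 0 -> W z')]].

Lemma prod_variety_openT : prod_variety_open setT.
Proof.
move=> z _; exists setT, setT, (tensor_cst 1).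
split; [by split; first exact: openT | by split; first exact: openT | |].
  by rewrite tensor_cstE oner_neq0.
by move=> z' _ _; split=> //; exact: tensor_cst_regular.
Qed.

Lemma prod_variety_openI : setI_closed prod_variety_open.
Proof.
move=> W W' oW oW' z [/oW[U [V [s [[oU Uz] [oV Vz] sz hs]]]]].
move=> /oW'[U' [V' [s' [[oU' Uz'] [oV' Vz'] sz' hs']]]].
exists (U `&` U'), (V `&` V'), (tensor_mul s s').
split; [by split=> //; exact: openI | by split=> //; exact: openI | |].
  by rewrite tensor_mulE mulf_neq0.
move=> y [/hs{}hs /hs'{}hs'] [/hs[rs sW] /hs'[rs' sW']].
split; first exact: tensor_mul_regular.
by rewrite tensor_mulE mulf_eq0 negb_or => /andP[/sW ? /sW' ?].
Qed.

Lemma prod_variety_open_bigU (I : Type) (W : I -> set XY) :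
  (forall i, prod_variety_open (W i)) -> prod_variety_open (\bigcup_i W i).
Proof.
move=> oW z [i _ /oW[U [V [s [Uz Vz sz hs]]]]]; exists U, V, s; split=> //.
move=> z' Uz' Vz'; have [rs sW] := hs z' Uz' Vz'.
by split=> // /sW; exists i.
Qed.

HB.instance Definition _ := Choice.copy XY (X * Y)%type.
HB.instance Definition _ := isOpenTopological.Build XY
  prod_variety_openT prod_variety_openI prod_variety_open_bigU.

Definition prod_regular_at (h : XY -> k) z : Prop :=
  exists s t, [/\ tensor_regular s z, tensor_regular t z, tensor t z != 0 &
                  \forall y \near z, h y = tensor s y / tensor t y].

Lemma tensor_regular_box s z : tensor_regular s z ->
  exists U V, [/\ open U /\ U z.1, open V /\ V z.2 &
    forall z' : XY, U z'.1 -> V z'.2 -> tensor_regular s z'].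
Proof.
elim: s => [_|p s IHs rs].
  by exists setT, setT; split=> //; split=> //; exact: openT.
have [|U [V [[oU Uz] [oV Vz] hs]]] := IHs.
  by move=> q qs; apply: rs; rewrite inE qs orbT.
have [/regular_at_near p1 /regular_at_near p2] := rs p (mem_head _ _).
exists (U `&` interior [set x | regular_at p.1 x]).
exists (V `&` interior [set y | regular_at p.2 y]).
split; [split=> // | split=> // |]; try exact/openI/open_interior.
move=> z' [Uz' /nbhs_singleton p1z'] [Vz' /nbhs_singleton p2z'] q.
by rewrite inE => /predU1P[-> //|]; exact: hs.
Qed.

Lemma tensor_near s z : tensor_regular s z -> tensor s z != 0 ->
  \forall y \near z, tensor_regular s y /\ tensor s y != 0.
Proof.
move=> /tensor_regular_box[U [V [[oU Uz] [oV Vz] rs]]] sz.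
exists [set y | [/\ U y.1, V y.2 & tensor s y != 0]]; split=> //.
  move=> y [Uy Vy sy]; exists U, V, s; split=> // z' Uz' Vz'.
  by split=> //; exact: rs.
by move=> y [Uy Vy sy]; split=> //; exact: rs.
Qed.

Lemma tensor_regular_near s z :
  tensor_regular s z -> \forall y \near z, tensor_regular s y.
Proof.
move=> /tensor_regular_box[U [V [[oU Uz] [oV Vz] rs]]].
exists [set y | U y.1 /\ V y.2]; split=> // [y [Uy Vy]|y [Uy Vy]].
  exists U, V, (tensor_cst 1); rewrite tensor_cstE oner_neq0; split=> //.
  by move=> z' Uz' Vz'; split=> //; exact: tensor_cst_regular.
exact: rs.
Qed.

Lemma prod_regular_at_near h z :
  prod_regular_at h z -> \forall y \near z, prod_regular_at h y.
Proof.
move=> [s [t [rs rt tz /near_join hst]]].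
apply: filterS3 (tensor_regular_near rs) (tensor_near rt tz) hst.
by move=> y rsy [rty ty] hy; exists s, t.
Qed.

Lemma eq_near_prod_regular_at g h z :
  (\forall y \near z, g y = h y) -> prod_regular_at g z -> prod_regular_at h z.
Proof.
move=> gh [s [t [rs rt tz hst]]]; exists s, t; split=> //.
by apply: filterS2 gh hst => y <-.
Qed.

Lemma prod_regular_at_cst c z : prod_regular_at (fun=> c) z.
Proof.
exists (tensor_cst c), (tensor_cst 1); split; try exact: tensor_cst_regular.
  by rewrite tensor_cstE oner_neq0.
by apply: (@nearW _ (nbhs z)) => y; rewrite !tensor_cstE divr1.
Qed.

Lemma prod_regular_atD g h z :
  prod_regular_at g z -> prod_regular_at h z ->
  prod_regular_at (fun y => g y + h y) z.
Proof.
move=> [s [t [rs rt tz gst]]] [s' [t' [rs' rt' tz' hst]]].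
exists (tensor_mul s t' ++ tensor_mul s' t), (tensor_mul t t').
split; try exact: tensor_mul_regular.
- by apply: tensor_cat_regular; exact: tensor_mul_regular.
- by rewrite tensor_mulE mulf_neq0.
have tt := filterI (tensor_near rt tz) (tensor_near rt' tz').
apply: filterS3 gst hst (tt _) => y -> -> [[_ ty] [_ ty']].
by rewrite addf_div // tensor_catE !tensor_mulE.
Qed.

Lemma prod_regular_atM g h z :
  prod_regular_at g z -> prod_regular_at h z ->
  prod_regular_at (fun y => g y * h y) z.
Proof.
move=> [s [t [rs rt tz gst]]] [s' [t' [rs' rt' tz' hst]]].
exists (tensor_mul s s'), (tensor_mul t t').
split; try exact: tensor_mul_regular.
  by rewrite tensor_mulE mulf_neq0.
by apply: filterS2 gst hst => y -> ->; rewrite mulf_div !tensor_mulE.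
Qed.

Lemma prod_regular_at_neq0 h z :
  prod_regular_at h z -> h z != 0 -> \forall y \near z, h y != 0.
Proof.
move=> [s [t [rs rt tz hst]]]; rewrite (nbhs_singleton hst).
rewrite mulf_eq0 negb_or invr_eq0 => /andP[sz _].
apply: filterS3 (tensor_near rs sz) (tensor_near rt tz) hst.
by move=> y [_ sy] [_ ty] ->; rewrite mulf_neq0 ?invr_eq0.
Qed.

Lemma prod_regular_atV h z :
  prod_regular_at h z -> h z != 0 -> prod_regular_at (fun y => (h y)^-1) z.
Proof.
move=> [s [t [rs rt tz hst]]]; rewrite (nbhs_singleton hst).
rewrite mulf_eq0 negb_or invr_eq0 => /andP[sz _]; exists t, s; split=> //.
by apply: filterS hst => y ->; rewrite invf_div.
Qed.

HB.instance Definition _ := hasRegularFunctions.Build k XY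
  prod_regular_at_near eq_near_prod_regular_at prod_regular_at_cst
  prod_regular_atD prod_regular_atM prod_regular_at_neq0 prod_regular_atV.

End ProductVariety.

(* The points of the projective space P^n are the lines of k^(n+1). *)
Section ProjectiveSpace.
Variables (k : fieldType) (n : nat).

Definition proj_space : Type := {L : {vspace 'rV[k]_n.+1} | \dim L == 1%N}.
HB.instance Definition _ := Choice.on proj_space.

(* The homogeneous coordinates of a point, given by some nonzero vector of    *)
(* the line; they only matter up to a common scalar.                          *)
Definition hcoord (x : proj_space) (i : 'I_n.+1) : k := vpick (val x) 0 i.

Definition proj_zeros (S : set {mpoly k[n.+1]}) : set proj_space :=
  [set x | forall p, S p -> p.@[hcoord x] = 0].

Definition proj_open : set_system proj_space := [set U |
  exists2 S : set {mpoly k[n.+1]},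
    (forall p, S p -> exists d, p \is d.-homog) & U = ~` proj_zeros S].

Lemma proj_openT : proj_open setT.
Proof.
exists [set 1]; first by move=> _ ->; exists 0%N; exact: dhomog1.
apply/seteqP; split=> // x _ /(_ 1 erefl)/eqP.
by rewrite meval1 oner_eq0.
Qed.

Lemma proj_openI : setI_closed proj_open.
Proof.
move=> _ _ [S hS ->] [S' hS' ->].
exists [set r | exists p q, [/\ S p, S' q & r = p * q]].
  move=> _ [p [q [/hS[d hp] /hS'[e hq] ->]]].
  by exists (d + e)%N; exact: dhomogM.
rewrite -setCU; congr (~` _); apply/seteqP; split=> x.
  by case=> h _ [p [q [Sp Sq ->]]]; rewrite mevalM;
    [rewrite (h p Sp) mul0r | rewrite (h q Sq) mulr0].
move=> h; have [?|/existsNP[p /not_implyP[Sp px]]] := pselect (proj_zeros S x).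
  by left.
right=> q Sq; have /eqP : (p * q).@[hcoord x] = 0 by apply: h; exists p, q.
by rewrite mevalM mulf_eq0 => /orP[/eqP/px|/eqP].
Qed.

Lemma proj_open_bigU (I : Type) (U : I -> set proj_space) :
  (forall i, proj_open (U i)) -> proj_open (\bigcup_i U i).
Proof.
move=> oU; exists [set p | (exists d, p \is d.-homog) /\
                           forall x, p.@[hcoord x] != 0 -> exists i, U i x].
  by move=> p [].
apply/seteqP; split=> x.
  move=> [i _]; have [S hS eU] := oU i; rewrite [in X in X -> _]eU.
  move=> /existsNP[p /not_implyP[Sp px]] /(_ p) h; apply/px/h; split.
    exact: hS.
  move=> y py; exists i; rewrite eU => /(_ p Sp) /eqP.
  by rewrite (negbTE py).
move=> /existsNP[p /not_implyP[[_ hp] /eqP/hp[i Ux]]].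
by exists i.
Qed.

HB.instance Definition _ := isOpenTopological.Build proj_space
  proj_openT proj_openI proj_open_bigU.

(* The quotients of homogeneous polynomials of the same degree do not depend  *)
(* on the choice of the homogeneous coordinates.                              *)
Definition proj_regular_at (f : proj_space -> k) (x : proj_space) : Prop :=
  exists d (p q : {mpoly k[n.+1]}),
    [/\ p \is d.-homog, q \is d.-homog, q.@[hcoord x] != 0 &
        \forall y \near x, f y = p.@[hcoord y] / q.@[hcoord y]].

Lemma proj_near_neq0 d (p : {mpoly k[n.+1]}) x :
  p \is d.-homog -> p.@[hcoord x] != 0 ->
  \forall y \near x, p.@[hcoord y] != 0.
Proof.
move=> hp px; exists [set y | p.@[hcoord y] != 0]; split=> //.
exists [set p]; first by move=> _ ->; exists d.
apply/seteqP; split=> y /=; first by move=> py /(_ p erefl)/eqP; apply/negP.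
by move=> h; apply/eqP => py; apply: h => _ ->.
Qed.

Lemma proj_regular_at_near f x :
  proj_regular_at f x -> \forall y \near x, proj_regular_at f y.
Proof.
move=> [d [p [q [hp hq qx /near_join fpq]]]].
apply: filterS2 (proj_near_neq0 hq qx) fpq => y qy fy.
by exists d, p, q.
Qed.

Lemma eq_near_proj_regular_at f g x :
  (\forall y \near x, f y = g y) -> proj_regular_at f x -> proj_regular_at g x.
Proof.
move=> fg [d [p [q [hp hq qx fpq]]]]; exists d, p, q; split=> //.
by apply: filterS2 fg fpq => y <-.
Qed.

Lemma proj_regular_at_cst c x : proj_regular_at (fun=> c) x.
Proof.
exists 0%N, (c *: 1), 1; split; [exact/dhomogZ/dhomog1 | exact: dhomog1 | |].
  by rewrite meval1 oner_neq0.
by apply: (@nearW _ (nbhs x)) => y; rewrite mevalZ meval1 mulr1 divr1.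
Qed.

Lemma proj_regular_atD f g x :
  proj_regular_at f x -> proj_regular_at g x ->
  proj_regular_at (fun y => f y + g y) x.
Proof.
move=> [d [p [q [hp hq qx fpq]]]] [e [p' [q' [hp' hq' qx' gpq]]]].
exists (d + e)%N, (p * q' + p' * q), (q * q'); split; try exact: dhomogM.
- by apply: rpredD; [|rewrite addnC]; exact: dhomogM.
- by rewrite mevalM mulf_neq0.
have qq := filterI (proj_near_neq0 hq qx) (proj_near_neq0 hq' qx').
apply: filterS3 fpq gpq (qq _) => y -> -> [qy qy'].
by rewrite addf_div // mevalD !mevalM.
Qed.

Lemma proj_regular_atM f g x :
  proj_regular_at f x -> proj_regular_at g x ->
  proj_regular_at (fun y => f y * g y) x.
Proof.
move=> [d [p [q [hp hq qx fpq]]]] [e [p' [q' [hp' hq' qx' gpq]]]].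
exists (d + e)%N, (p * p'), (q * q'); split; try exact: dhomogM.
  by rewrite mevalM mulf_neq0.
by apply: filterS2 fpq gpq => y -> ->; rewrite mulf_div !mevalM.
Qed.

Lemma proj_regular_at_neq0 f x :
  proj_regular_at f x -> f x != 0 -> \forall y \near x, f y != 0.
Proof.
move=> [d [p [q [hp hq qx fpq]]]]; rewrite (nbhs_singleton fpq).
rewrite mulf_eq0 negb_or invr_eq0 => /andP[px _].
apply: filterS3 (proj_near_neq0 hp px) (proj_near_neq0 hq qx) fpq.
by move=> y py qy ->; rewrite mulf_neq0 ?invr_eq0.
Qed.

Lemma proj_regular_atV f x :
  proj_regular_at f x -> f x != 0 -> proj_regular_at (fun y => (f y)^-1) x.
Proof.
move=> [d [p [q [hp hq qx fpq]]]]; rewrite (nbhs_singleton fpq).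
rewrite mulf_eq0 negb_or invr_eq0 => /andP[px _]; exists d, q, p; split=> //.
by apply: filterS fpq => y ->; rewrite invf_div.
Qed.

HB.instance Definition _ := hasRegularFunctions.Build k proj_space
  proj_regular_at_near eq_near_proj_regular_at proj_regular_at_cst
  proj_regular_atD proj_regular_atM proj_regular_at_neq0 proj_regular_atV.

End ProjectiveSpace.

(* The homogeneous Weierstrass polynomial                                     *)
(*   Y^2 Z + a1 X Y Z + a3 Y Z^2 - (X^3 + a2 X^2 Z + a4 X Z^2 + a6 Z^3).      *)
Definition weierstrass (k : fieldType) (a1 a2 a3 a4 a6 : k) : {mpoly k[3]} :=
  let X := 'X_(0 : 'I_3) in let Y := 'X_(1 : 'I_3) in let Z := 'X_(2 : 'I_3) in
  Y ^+ 2 * Z + a1 *: (X * Y * Z) + a3 *: (Y * Z ^+ 2)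
  - (X ^+ 3 + a2 *: (X ^+ 2 * Z) + a4 *: (X * Z ^+ 2) + a6 *: Z ^+ 3).

(* An elliptic curve: a nonsingular plane projective cubic in Weierstrass     *)
(* form, whose origin is the point [0 : 1 : 0].                               *)
Record elliptic_curve (k : fieldType) := EllipticCurve {
  ell_a1 : k; ell_a2 : k; ell_a3 : k; ell_a4 : k; ell_a6 : k;
  ell_poly := weierstrass ell_a1 ell_a2 ell_a3 ell_a4 ell_a6;
  ell_nonsingular : forall x : proj_space k 2,
    ell_poly.@[hcoord x] = 0 -> exists i, (ell_poly^`M(i)).@[hcoord x] != 0
}.

Definition ell_points (k : fieldType) (E : elliptic_curve k) :
    set (proj_space k 2) :=
  [set x | (ell_poly E).@[hcoord x] = 0].

(* Main.v *)
From HB Require Import structures.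
Require Import Defs.
From mathcomp Require Import all_boot all_order all_algebra.
From mathcomp Require Import ring zify.
From mathcomp Require Import mpoly boolp classical_sets functions cardinality.
From mathcomp Require Import filter topology.
Set Implicit Arguments.
Unset Strict Implicit.
Unset Printing Implicit Defensive.
Import GRing.Theory.
Local Open Scope ring_scope.

(** Let K be the function field of E.  An automorphism phi of K over k and a
    nonzero function g define a birational automorphism
    (p, t) |-> (phi^#(p), g(p) t) of E x P^1, where phi^# is the self-map of E
    whose action on functions is phi; call it monomial.  Monomial maps are
    multiplied by composing the automorphisms and by a twisted product of the
    functions, and they are determined by phi and g ([monomialM],
    [monomial_eq]).

    For every n = 2^(N + 2) there are monomial maps A = (phi, g) and
    B = (psi, h) such that A^n = B^n = 1 and B A = Z A B, where Z is the scaling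
    t |-> c t by a root of unity c of order n exactly.  Together with Z, which
    is central, they generate a finite Heisenberg group.  In it A^a and B^b
    commute only if n divides a b.  A commutative subgroup of index at most J
    contains such powers with 0 < a, b <= J, hence n <= J^2; as n is unbounded,
    no J works for all these groups ([heisenberg_not_jordan]).  This group is
    contained in the theta group of a line bundle of degree n on E: phi and psi
    are translations by points of order n, and c is, up to inversion, the Weil
    pairing of these points.

    Neither divisors nor the group law of E are used to find phi, psi, g, h
    ([heisenberg_operators]).  Their role is taken by the derivation D of K with
    D x = 2 y and D y = 3 x^2 + a, for the equation y^2 = x^3 + a x + b of E.
    Its kernel is k ([fD_kernel]).  The endomorphisms over k that commute with D
    are exactly the translations, given by the chord formulas
    ([flow_translation]); negation inverts each of them by conjugation
    ([flow_neg]), so that they commute.  A translation has a square root because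
    points of E can be halved ([halving]), and thus there are translations phi
    and psi of order n whose powers of exponent n / 2 are the translations by
    two distinct points (e1, 0) and (e2, 0) of order two.

    For g and h take the Miller functions ([miller]), products of iterates of
    x - X, where X is the abscissa of the point by which one translates.  Their
    logarithmic derivatives show that their norms are constant, which can be
    normalized to 1, and that g phi(h) = c h psi(g) for a constant c
    ([commutator_cst]).  It remains to see that c^(n/2) = -1.  The product of
    the iterates psi^j(h) for j < n / 2 is a constant times q^(-n/2), where
    q = x - e2 ([half_norm]).  On the other hand phi(q) / q is the square of a
    function w, and c^(n/2) turns out to be the inverse of the norm of w.  This
    norm is -1, as is seen by passing from phi to its iterated squares, down to
    the translation by (e1, 0) ([sqrt_norm]).

    The geometric part compares functions with their values.  An identity in K
    holds for the values at all the points outside the zeros of some nonzero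
    element of the coordinate ring ([generic]), and a nonempty open subset of E
    always meets the complement of such zeros ([open_generic]); hence the
    monomial maps are isomorphisms between dense open subsets
    ([acts_as_exists]) and multiply as their data do ([acts_as_mul]). *)

(** * Fields of fractions *)

(** The function field of the curve enters through this interface only, so
    that its elements never unfold to classes of pairs: what is needed is
    that morphisms and derivations of [R] extend. *)
Record fraction_field (R : idomainType) := FractionField {
  ff_field :> fieldType;
  ff_emb : {rmorphism R -> ff_field};
  ff_inj : injective ff_emb;
  ff_repr : forall z : ff_field, exists u : R * R,
    u.2 != 0 /\ z = ff_emb u.1 / ff_emb u.2
}.

Lemma fraction_field_exists (R : idomainType) : inhabited (fraction_field R).
Proof.
have inj : injective (@FracField.tofrac R).
  by move=> u v /eqP; rewrite tofrac_eq => /eqP.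
suff repr (z : {fraction R}) : exists u : R * R, u.2 != 0 /\
    z = FracField.tofrac u.1 / FracField.tofrac u.2.
  exact: (inhabits (@FractionField R {fraction R} (@FracField.tofrac R) inj repr)).
have d0 := denom_ratioP (repr z).
exists (frac (repr z)); split=> //; rewrite -[LHS]reprK.
move: (repr z) d0 => u d0; have d0' : FracField.tofrac (frac u).2 != 0.
  by rewrite tofrac_eq0.
apply: (mulIf d0'); rewrite divfK //; unlock FracField.tofrac.
rewrite -[LHS]FracField.pi_mul; apply/eqmodP; rewrite /= FracField.equivfE.
rewrite /FracField.mulf !numden_Ratio ?mulf_neq0 ?oner_neq0 //.
by rewrite !mulr1 mulrC.
Qed.

Section Fractions.
Variables (R : idomainType) (K : fraction_field R).
Local Notation "x %:F" := (ff_emb K x).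

Lemma ff_eq u v : (u%:F == v%:F) = (u == v).
Proof. exact: inj_eq (@ff_inj _ K) u v. Qed.

Lemma ff_eq0 u : (u%:F == 0) = (u == 0).
Proof. by rewrite -(rmorph0 (ff_emb K)) ff_eq. Qed.

Definition num (z : K) : R := (sval (cid (ff_repr z))).1.
Definition den (z : K) : R := (sval (cid (ff_repr z))).2.

Lemma den_neq0 z : den z != 0.
Proof. by rewrite /den; case: cid => u []. Qed.

Lemma den_frac_neq0 z : (den z)%:F != 0.
Proof. by rewrite ff_eq0 den_neq0. Qed.

Lemma num_den z : z = (num z)%:F / (den z)%:F.
Proof. by rewrite /num /den; case: cid => u []. Qed.

Lemma frac_eq n d n' d' : d != 0 -> d' != 0 ->
  (n%:F / d%:F = n'%:F / d'%:F :> K) -> n * d' = n' * d.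
Proof.
move=> d0 d'0 /eqP; rewrite eqr_div ?ff_eq0 // -!rmorphM ff_eq.
by move/eqP.
Qed.

Section Lift.
Variables (L : fieldType) (h : {rmorphism R -> L}).
Hypothesis h_inj : forall u, u != 0 -> h u != 0.

Definition frac_lift z := h (num z) / h (den z).

Lemma frac_liftE n d : d != 0 -> frac_lift (n%:F / d%:F) = h n / h d.
Proof.
move=> d0; rewrite /frac_lift; set z := _ / _.
apply/eqP; rewrite eqr_div ?h_inj ?den_neq0 // -!rmorphM; apply/eqP; congr (h _).
by apply: frac_eq; rewrite ?den_neq0 // -num_den.
Qed.

Lemma frac_lift_emb u : frac_lift u%:F = h u.
Proof.
by rewrite -[u%:F]divr1 -(rmorph1 (ff_emb K)) frac_liftE ?oner_neq0 // rmorph1 divr1.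
Qed.

Lemma frac_lift_exists : exists phi : {rmorphism K -> L},
  forall u, phi u%:F = h u.
Proof.
have fB : zmod_morphism frac_lift.
  move=> u v; rewrite (num_den u) (num_den v).
  move: (num u) (den u) (num v) (den v) (den_neq0 u) (den_neq0 v).
  move=> n d n' d' d0 d'0.
  rewrite -mulNr -rmorphN addf_div ?ff_eq0 // -!rmorphM -rmorphD.
  rewrite !frac_liftE ?mulf_neq0 // rmorphD !rmorphM rmorphN.
  by rewrite -addf_div ?h_inj // mulNr.
have fM : monoid_morphism frac_lift.
  split; first by rewrite -(rmorph1 (ff_emb K)) frac_lift_emb rmorph1.
  move=> u v; rewrite (num_den u) (num_den v) mulf_div -!rmorphM.
  by rewrite !frac_liftE ?mulf_neq0 ?den_neq0 // !rmorphM mulf_div.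
pose m1 := GRing.isZmodMorphism.Build _ _ frac_lift fB.
pose m2 := GRing.isMonoidMorphism.Build _ _ frac_lift fM.
pose phi : {rmorphism K -> L} := HB.pack frac_lift m1 m2.
by exists phi => u; apply: frac_lift_emb.
Qed.

End Lift.

Section Derivation.
Variable d : R -> R.
Hypothesis dD : forall u v, d (u + v) = d u + d v.
Hypothesis dM : forall u v, d (u * v) = d u * v + u * d v.

Definition frac_deriv (z : K) : K :=
  (d (num z) * den z - num z * d (den z))%:F / (den z ^+ 2)%:F.

(** The quotient rule gives the same value on all the representations of a
    fraction; the chosen representation in the definition is thus harmless. *)
Lemma frac_derivE n e : e != 0 ->
  frac_deriv (n%:F / e%:F) = (d n * e - n * d e)%:F / (e ^+ 2)%:F.
Proof.
move=> e0; rewrite /frac_deriv; set z := n%:F / e%:F.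
have en : n * den z = num z * e.
  by apply: frac_eq; rewrite ?den_neq0 // -num_den.
have z0 := den_neq0 z.
apply/eqP; rewrite eqr_div ?ff_eq0 ?expf_neq0 // -!rmorphM ff_eq.
move: (num z) (den z) en z0 => m f en f0.
have ed : d n * f + n * d f = d m * e + m * d e by rewrite -!dM en.
apply/eqP.
transitivity (f * e * (d m * e) - m * e * (e * d f)); first by ring.
have -> : d m * e = d n * f + n * d f - m * d e by rewrite ed; ring.
transitivity (f * e * (d n * f + n * d f) - f * (m * e) * d e -
              m * e * (e * d f)); first by ring.
by rewrite -en; ring.
Qed.

Lemma frac_deriv_emb u : frac_deriv u%:F = (d u)%:F.
Proof.
have d1 : d 1 = 0.
  by apply: (addrI (d 1)); have := dM 1 1; rewrite !mulr1 !mul1r addr0 => <-.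
rewrite -[u%:F in LHS]divr1 -(rmorph1 (ff_emb K)) frac_derivE ?oner_neq0 //.
by rewrite d1 mulr1 mulr0 subr0 expr1n rmorph1 divr1.
Qed.

Lemma frac_derivD u v : frac_deriv (u + v) = frac_deriv u + frac_deriv v.
Proof.
rewrite (num_den u) (num_den v).
move: (num u) (den u) (num v) (den v) (den_neq0 u) (den_neq0 v).
move=> n e n' e' e0 e'0.
rewrite addf_div ?ff_eq0 // -!rmorphM -rmorphD !frac_derivE ?mulf_neq0 //.
rewrite addf_div ?ff_eq0 ?expf_neq0 // -!rmorphM -rmorphD.
by rewrite dD !dM exprMn; congr (_%:F / _); ring.
Qed.

Lemma frac_derivM u v :
  frac_deriv (u * v) = frac_deriv u * v + u * frac_deriv v.
Proof.
rewrite (num_den u) (num_den v).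
move: (num u) (den u) (num v) (den v) (den_neq0 u) (den_neq0 v).
move=> n e n' e' e0 e'0.
rewrite mulf_div -!rmorphM !frac_derivE ?mulf_neq0 // !mulf_div -!rmorphM.
rewrite addf_div ?ff_eq0 ?mulf_neq0 ?expf_neq0 // -!rmorphM -rmorphD.
apply/eqP; rewrite eqr_div ?ff_eq0 ?mulf_neq0 ?expf_neq0 //.
by rewrite -!rmorphM !dM; apply/eqP; congr (_%:F); ring.
Qed.

End Derivation.
End Fractions.

(** * The coordinate ring of the affine curve y^2 = x^3 + a x + b *)

Section CoordinateRing.
Variables (k : closedFieldType) (a b : k).

Definition cubic : {poly k} := 'X^3 + a *: 'X + b%:P.

(** The pair (A, B) stands for A(x) + B(x) y: the coordinate ring is free of
    rank two over k[x].  The parameters of the curve are arguments of this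
    type, since its multiplication depends on them. *)
Definition coord_ring of k & k : Type := ({poly k} * {poly k})%type.
Local Notation R := (coord_ring a b).
HB.instance Definition _ := GRing.Zmodule.copy R ({poly k} * {poly k})%type.
Implicit Types u v w : R.

Definition coord_mul u v : R :=
  (u.1 * v.1 + cubic * (u.2 * v.2), u.1 * v.2 + u.2 * v.1).

Lemma coord_mulA : associative coord_mul.
Proof. by move=> u v w; congr (_, _) => /=; ring. Qed.

Lemma coord_mulC : commutative coord_mul.
Proof. by move=> u v; congr (_, _) => /=; ring. Qed.

Lemma coord_mul1 : left_id ((1, 0) : R) coord_mul.
Proof. by case=> A B; congr (_, _) => /=; ring. Qed.

Lemma coord_mulDl : left_distributive coord_mul +%R.
Proof. by move=> u v w; congr (_, _) => /=; ring. Qed.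

Lemma coord_one_neq0 : ((1, 0) : R) != 0.
Proof. by rewrite xpair_eqE oner_eq0. Qed.

HB.instance Definition _ := GRing.Zmodule_isComNzRing.Build R
  coord_mulA coord_mulC coord_mul1 coord_mulDl coord_one_neq0.

Lemma coord_mulE u v : u * v =
  (u.1 * v.1 + cubic * (u.2 * v.2), u.1 * v.2 + u.2 * v.1) :> R.
Proof. by []. Qed.

(** The norm to k[x]: the product of A + B y and its conjugate A - B y. *)
Definition coord_norm u := u.1 ^+ 2 - cubic * u.2 ^+ 2.

Lemma coord_normM u v : coord_norm (u * v) = coord_norm u * coord_norm v.
Proof. by rewrite /coord_norm /=; ring. Qed.

Lemma size_cubic : size cubic = 4%N.
Proof.
rewrite /cubic -addrA size_polyDl size_polyXn //.
apply: leq_ltn_trans (size_polyD _ _) _; rewrite gtn_max.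
rewrite (leq_ltn_trans (size_scale_leq _ _)) ?size_polyX //.
by rewrite (leq_ltn_trans (size_polyC_leq1 _)).
Qed.

Lemma cubic_neq0 : cubic != 0. Proof. by rewrite -size_poly_eq0 size_cubic. Qed.

Lemma size_cubic_sqr (B : {poly k}) : 
  size (cubic * B ^+ 2) = if B == 0 then 0%N else (size B).*2.+2.
Proof.
case: eqVneq => [->|B0]; first by rewrite expr0n mulr0 size_poly0.
rewrite size_mul ?cubic_neq0 ?expf_neq0 // size_cubic expr2 size_mul // addnn.
by rewrite -(ltn_predK (_ : 0 < size B)%N) ?size_poly_gt0.
Qed.

Lemma size_poly_sqr (A : {poly k}) : size (A ^+ 2) = (size A).*2.-1.
Proof.
have [->|A0] := eqVneq A 0; first by rewrite expr0n size_poly0.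
by rewrite expr2 size_mul // addnn.
Qed.

(** The degree of A^2 is even and that of (x^3 + a x + b) B^2 is odd, so that
    the leading terms cannot cancel.  Hence only 0 has norm 0, the ring is
    a domain, and the degree of the norm, which is the order of the pole at
    infinity, is governed by the larger of the two terms. *)
Lemma size_coord_norm u : size (coord_norm u) =
  maxn (size (u.1 ^+ 2)) (size (cubic * u.2 ^+ 2)).
Proof.
rewrite /coord_norm; set A := u.1; set B := u.2.
have [->|B0] := eqVneq B 0; first by rewrite expr0n mulr0 subr0 size_poly0 maxn0.
have [->|A0] := eqVneq A 0; first by rewrite expr0n sub0r size_polyN size_poly0 max0n.
have : size (A ^+ 2) != size (cubic * B ^+ 2).
  rewrite size_cubic_sqr (negbTE B0) size_poly_sqr.
  rewrite -(ltn_predK (_ : 0 < size A)%N) ?size_poly_gt0 // doubleS /=.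
  by apply/eqP => /(congr1 odd); rewrite /= !odd_double.
rewrite neq_ltn => /orP[] h.
  by rewrite addrC size_polyDl ?size_polyN // (maxn_idPr (ltnW h)).
by rewrite size_polyDl ?size_polyN // (maxn_idPl (ltnW h)).
Qed.

Lemma coord_norm_eq0 u : (coord_norm u == 0) = (u == 0).
Proof.
rewrite -size_poly_eq0 size_coord_norm -leqn0 geq_max !leqn0 !size_poly_eq0.
by rewrite sqrf_eq0 mulf_eq0 (negbTE cubic_neq0) sqrf_eq0; case: u.
Qed.

Definition coord_unit u : bool := `[< exists v, v * u = 1 >].
Definition coord_inv u : R :=
  if pselect (exists v, v * u = 1) is left h then projT1 (cid h) else u.

Lemma coord_mulV : {in coord_unit, left_inverse 1 coord_inv *%R}.
Proof.
move=> u /asboolP h; rewrite /coord_inv; case: pselect => // h'.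
exact: (projT2 (cid h')).
Qed.

Lemma coord_unitP u v : v * u = 1 -> coord_unit u.
Proof. by move=> h; apply/asboolP; exists v. Qed.

Lemma coord_inv_out : {in [predC coord_unit], coord_inv =1 id}.
Proof.
move=> u /asboolP h; rewrite /coord_inv; case: pselect => // h'.
Qed.

HB.instance Definition _ := GRing.ComNzRing_hasMulInverse.Build R
  coord_mulV coord_unitP coord_inv_out.

Lemma coord_integral u v : u * v = 0 -> (u == 0) || (v == 0).
Proof.
by move/eqP; rewrite -!coord_norm_eq0 coord_normM mulf_eq0.
Qed.

HB.instance Definition _ := GRing.ComUnitRing_isIntegral.Build R coord_integral.

Definition on_curve (p : k * k) := p.2 ^+ 2 = p.1 ^+ 3 + a * p.1 + b.

Lemma cubicE t : cubic.[t] = t ^+ 3 + a * t + b.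
Proof. by rewrite /cubic !hornerE. Qed.

Definition ev (p : k * k) u : k := u.1.[p.1] + u.2.[p.1] * p.2.

Lemma evB p u v : ev p (u - v) = ev p u - ev p v.
Proof.
rewrite /ev -[(u - v).1]/(u.1 - v.1) -[(u - v).2]/(u.2 - v.2) !(hornerD, hornerN); ring.
Qed.

Lemma evD p u v : ev p (u + v) = ev p u + ev p v.
Proof.
rewrite /ev -[(u + v).1]/(u.1 + v.1) -[(u + v).2]/(u.2 + v.2) !hornerD; ring.
Qed.

Lemma ev1 p : ev p 1 = 1.
Proof. by rewrite /ev -[_.1]/(1 : {poly k}) -[_.2]/(0 : {poly k}) !hornerE. Qed.

Lemma evM p u v : on_curve p -> ev p (u * v) = ev p u * ev p v.
Proof.
move=> op; rewrite coord_mulE /ev /=; have := cubicE p.1; rewrite -op.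
by move: cubic => c ec; rewrite !(hornerD, hornerM) ec; ring.
Qed.

Lemma norm_ev p u : on_curve p ->
  (coord_norm u).[p.1] = ev p u * (u.1.[p.1] - u.2.[p.1] * p.2).
Proof.
move=> op; rewrite /ev /coord_norm; have := cubicE p.1; rewrite -op.
by move: cubic => c ec; rewrite !(hornerD, hornerN, hornerM, horner_exp) ec; ring.
Qed.

End CoordinateRing.

(** * Polynomials with vanishing Wronskian *)

Section Wronskian.
Variable k : fieldType.
Hypothesis hk : [pchar k] =i pred0.
Implicit Types A M N : {poly k}.

Lemma pchar0_natr_inj : injective (fun n => n%:R : k).
Proof.
have wlog_le (m n : nat) : (m <= n)%N -> (m%:R : k) = n%:R -> m = n.
  move=> le_mn e; apply/eqP; rewrite eqn_leq le_mn -subn_eq0 /=.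
  by have /pcharf0P <- := hk; rewrite natrB // e subrr.
by move=> m n e; case/orP: (leq_total m n) => h; [|symmetry]; apply: wlog_le.
Qed.

Lemma size_lead_deriv M n : size M = n.+2 ->
  size M^`() = n.+1 /\ lead_coef M^`() = n.+1%:R * lead_coef M.
Proof.
move=> sM; have cM : M^`()`_n = n.+1%:R * lead_coef M.
  by rewrite coef_deriv lead_coefE sM mulr_natl.
have nM : M^`()`_n != 0.
  rewrite cM mulf_neq0 ?lead_coef_eq0 -?size_poly_eq0 ?sM //.
  by have /pcharf0P -> := hk.
suff sM' : size M^`() = n.+1 by rewrite [lead_coef M^`()]lead_coefE sM'.
apply/eqP; rewrite eqn_leq -ltnS -[X in (_ < X)%N]sM lt_size_deriv ?gt_size //.
  by rewrite ltnNge; apply: contra nM => /leq_sizeP/(_ n (leqnn _)) ->.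
by rewrite -size_poly_eq0 sM.
Qed.

(** The leading coefficients of M' N and M N' are those of M N times the
    degrees of M and N. *)
Lemma wronskian_size M N : M != 0 -> N != 0 -> M^`() * N = M * N^`() ->
  size M = size N.
Proof.
move=> M0 N0; case eM : (size M) => [|[|i]].
- by move/eqP: eM; rewrite size_poly_eq0 (negbTE M0).
- case eN : (size N) => [|[|j]] //.
    by move/eqP: eN; rewrite size_poly_eq0 (negbTE N0).
  have -> : M^`() = 0 by apply/eqP; rewrite -size_poly_eq0 -leqn0 -ltnS -eM lt_size_deriv.
  move=> /esym/eqP; rewrite mul0r mulf_eq0 (negbTE M0) -size_poly_eq0.
  by rewrite (size_lead_deriv eN).1.
case eN : (size N) => [|[|j]].
- by move/eqP: eN; rewrite size_poly_eq0 (negbTE N0).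
- have -> : N^`() = 0 by apply/eqP; rewrite -size_poly_eq0 -leqn0 -ltnS -eN lt_size_deriv.
  move=> /eqP; rewrite mulr0 mulf_eq0 (negbTE N0) orbF -size_poly_eq0.
  by rewrite (size_lead_deriv eM).1.
move=> /(congr1 lead_coef); rewrite !lead_coefM.
rewrite (size_lead_deriv eM).2 (size_lead_deriv eN).2.
have l0 : lead_coef M * lead_coef N != 0 by rewrite mulf_neq0 ?lead_coef_eq0.
by rewrite mulrCA -mulrA => /(mulIf l0)/pchar0_natr_inj[->].
Qed.

(** Subtract from A the multiple of N with the same leading coefficient: the
    difference still has zero Wronskian with N but a smaller size. *)
Lemma wronskian A N : N != 0 -> A^`() * N = A * N^`() ->
  exists c, A = c *: N.
Proof.
move=> N0 e; pose c := lead_coef A / lead_coef N; exists c.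
have lN0 : lead_coef N != 0 by rewrite lead_coef_eq0.
apply/eqP; rewrite -subr_eq0; apply/negPn/negP => M0.
have A0 : A != 0.
  by apply: contra M0 => /eqP A0; rewrite /c A0 lead_coef0 mul0r scale0r subrr.
have sAN := wronskian_size A0 N0 e.
have : size (A - c *: N) = size N.
  apply: wronskian_size => //.
  by rewrite derivB derivZ mulrBl mulrBl e -!scalerAl [N^`() * N]mulrC.
move=> sM; have /eqP : lead_coef (A - c *: N) = 0.
  rewrite lead_coefE sM coefB coefZ -{1}sAN -!lead_coefE /c divfK //.
  by rewrite subrr.
by rewrite lead_coef_eq0 (negbTE M0).
Qed.

End Wronskian.

(** * The function field and its invariant derivation *)

Section FunctionField.
Variables (k : closedFieldType) (a b : k).
Hypothesis hk : [pchar k] =i pred0.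
Local Notation R := (coord_ring a b).
Variable K : fraction_field R.
Local Notation "x %:F" := (ff_emb K x).

Definition emb (A : {poly k}) : R := (A, 0).
Definition coord_x : R := emb 'X.
Definition coord_y : R := (0, 1).

Lemma emb_is_zmod_morphism : zmod_morphism emb.
Proof. by move=> A B; congr (_, _); rewrite subr0. Qed.

Lemma emb_is_monoid_morphism : monoid_morphism emb.
Proof. by split=> // A B; congr (_, _) => /=; ring. Qed.

HB.instance Definition _ :=
  GRing.isZmodMorphism.Build {poly k} R emb emb_is_zmod_morphism.
HB.instance Definition _ :=
  GRing.isMonoidMorphism.Build {poly k} R emb emb_is_monoid_morphism.

Definition fcst : {rmorphism k -> K} :=
  (ff_emb K \o emb \o polyC)%FUN.
Local Notation "c %:K" := (fcst c) (at level 2, left associativity, format "c %:K").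
Definition fx : K := coord_x%:F.
Definition fy : K := coord_y%:F.

Lemma coord_ring_split (u : R) : u = emb u.1 + emb u.2 * coord_y.
Proof.
case: u => A B; rewrite coord_mulE /=; congr (_, _) => /=.
  by rewrite mulr0 !mul0r mulr0 !addr0.
by rewrite mulr1 mul0r addr0 add0r.
Qed.

Lemma coord_yy : coord_y ^+ 2 = emb (cubic a b).
Proof. by rewrite expr2 coord_mulE; congr (_, _) => /=; ring. Qed.

Lemma fxy : fy ^+ 2 = fx ^+ 3 + a%:K * fx + b%:K.
Proof.
rewrite -rmorphXn coord_yy /cubic -mul_polyC.
by rewrite !(rmorphD emb, rmorphXn emb, rmorphM emb) !(rmorphD, rmorphXn, rmorphM).
Qed.

Lemma emb_eq0 A : (emb A == 0) = (A == 0).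
Proof. by rewrite xpair_eqE eqxx andbT. Qed.

Lemma fx_nconst c : fx != c%:K.
Proof.
rewrite -subr_eq0; have <- : (emb ('X - c%:P))%:F = fx - c%:K by rewrite rmorphB rmorphB.
by rewrite ff_eq0 emb_eq0 polyXsubC_eq0.
Qed.

Lemma pchar0_natr n : (n.+1%:R : k) != 0.
Proof. by have /pcharf0P -> := hk. Qed.

(** A point (X, Y) of the curve over its own function field, with X not a
    constant, is a dominant rational map from the curve to itself; it acts on
    functions by an endomorphism of [K] that maps x to X and y to Y. *)
Section HomFromPoint.
Variables X Y : K.
Hypothesis onXY : Y ^+ 2 = X ^+ 3 + a%:K * X + b%:K.
Hypothesis X_nconst : forall c, X != c%:K.

Definition pev (A : {poly k}) : K := (map_poly fcst A).[X].

Lemma pevB A B : pev (A - B) = pev A - pev B.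
Proof. by rewrite /pev rmorphB hornerD hornerN. Qed.
Lemma pevD A B : pev (A + B) = pev A + pev B.
Proof. by rewrite /pev rmorphD hornerD. Qed.
Lemma pevM A B : pev (A * B) = pev A * pev B.
Proof. by rewrite /pev rmorphM hornerM. Qed.
Lemma pevC c : pev c%:P = c%:K.
Proof. by rewrite /pev map_polyC hornerC. Qed.
Lemma pevX : pev 'X = X.
Proof. by rewrite /pev map_polyX hornerX. Qed.

Lemma pev_cubic : pev (cubic a b) = Y ^+ 2.
Proof.
rewrite onXY /cubic !pevD -mul_polyC pevM !pevC pevX /pev.
by rewrite rmorphXn /= map_polyX hornerXn.
Qed.

Definition chom (u : R) : K := pev u.1 + pev u.2 * Y.

Lemma chom_zmod : zmod_morphism chom.
Proof. by move=> u v; rewrite /chom !pevB; ring. Qed.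

Lemma chom_monoid : monoid_morphism chom.
Proof.
split.
  rewrite /chom -[(1 : R).1]/(1%:P) -[(1 : R).2]/(0%:P) !pevC.
  by rewrite rmorph0 rmorph1 mul0r addr0.
move=> u v; rewrite /chom coord_mulE /=; have := pev_cubic.
by move: (cubic a b) => c ec; rewrite !(pevD, pevM) ec; ring.
Qed.

HB.instance Definition _ := GRing.isZmodMorphism.Build R K chom chom_zmod.
HB.instance Definition _ := GRing.isMonoidMorphism.Build R K chom chom_monoid.

Lemma pev_neq0 A : A != 0 -> pev A != 0.
Proof.
have [r ->] := closed_field_poly_normal A => A0.
have lA0 : lead_coef A != 0.
  by rewrite lead_coef_eq0; apply: contra A0 => /eqP ->; rewrite lead_coef0 scale0r.
rewrite /pev map_polyZ rmorph_prod hornerZ mulf_neq0 //.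
  by rewrite fmorph_eq0.
rewrite horner_prod prodf_seq_neq0; apply/allP => i _ /=.
rewrite rmorphB /= map_polyX map_polyC hornerXsubC subr_eq0.
exact: X_nconst.
Qed.

(** The norm of u is a nonzero polynomial in x, and a polynomial does not
    vanish at the transcendental element X. *)
Lemma chom_neq0 u : u != 0 -> chom u != 0.
Proof.
rewrite -coord_norm_eq0 => /pev_neq0; apply: contra => /eqP h.
have -> : pev (coord_norm u) = chom u * (pev u.1 - pev u.2 * Y).
  rewrite /coord_norm /chom !expr2; have := pev_cubic.
  by move: (cubic a b) => c ec; rewrite pevB !pevM ec; ring.
by rewrite h mul0r.
Qed.

(** The derivation dual to the invariant differential dx / 2y: it sends x to
    2y, and y to the derivative of the cubic. *)
Definition cderiv (u : R) : R :=
  (2 * (u.2^`() * cubic a b) + u.2 * (cubic a b)^`(), 2 * u.1^`()).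

Lemma cderivD u v : cderiv (u + v) = cderiv u + cderiv v.
Proof.
rewrite /cderiv -[(u + v).1]/(u.1 + v.1) -[(u + v).2]/(u.2 + v.2) !derivD.
by congr (_, _) => /=; ring.
Qed.

Lemma cderivM u v : cderiv (u * v) = cderiv u * v + u * cderiv v.
Proof.
rewrite !coord_mulE /cderiv /=.
by move: (cubic a b) => c; rewrite !(derivD, derivM); congr (_, _) => /=; ring.
Qed.

Definition fD : K -> K := frac_deriv cderiv.

Lemma fDD u v : fD (u + v) = fD u + fD v.
Proof. exact: frac_derivD cderivD cderivM u v. Qed.

Lemma fDM u v : fD (u * v) = fD u * v + u * fD v.
Proof. exact: frac_derivM cderivM u v. Qed.

Lemma fD_emb u : fD u%:F = (cderiv u)%:F.
Proof. exact: frac_deriv_emb cderivM u. Qed.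

Lemma fD_cst c : fD c%:K = 0.
Proof.
rewrite /= fD_emb /cderiv /= derivC deriv0.
by rewrite -[RHS](rmorph0 (ff_emb K)); congr (_%:F); congr (_, _); ring.
Qed.

Lemma deriv_cubic : (cubic a b)^`() = 3%:P * 'X^2 + a%:P.
Proof.
rewrite /cubic !derivD derivXn derivZ derivX derivC addr0.
by rewrite -mulr_natl polyC_natr alg_polyC.
Qed.

Lemma fD_x : fD fx = 2 * fy.
Proof.
rewrite fD_emb /cderiv /= derivX deriv0.
have -> : 2 * fy = (2 * coord_y)%:F by rewrite rmorphM rmorph_nat.
congr (_%:F); rewrite coord_mulE.
have -> : (2 : R) = emb 2 by rewrite rmorph_nat.
by congr (_, _) => /=; ring.
Qed.

Lemma fD_y : fD fy = 3 * fx ^+ 2 + a%:K.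
Proof.
rewrite fD_emb /cderiv /=.
have -> : 3 * fx ^+ 2 + a%:K = (emb ((cubic a b)^`()))%:F.
  rewrite deriv_cubic polyC_natr rmorphD rmorphM rmorphXn rmorph_nat.
  by rewrite rmorphD rmorphM rmorphXn rmorph_nat.
by congr (_%:F); congr (_, _); rewrite -[1]/(1%:P : {poly k}) ?derivC; ring.
Qed.

Lemma fcstE c : c%:K = (emb c%:P)%:F. Proof. by []. Qed.

Lemma chom_emb A : chom (emb A) = pev A.
Proof. by rewrite /chom -[(emb A).1]/A -[(emb A).2]/(0%:P) pevC rmorph0 mul0r addr0. Qed.

Lemma chom_y : chom coord_y = Y.
Proof.
rewrite /chom -[coord_y.1]/(0%:P) -[coord_y.2]/(1%:P) !pevC rmorph0 rmorph1.
by rewrite mul1r add0r.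
Qed.

(** The endomorphism pulls the invariant differential back to a multiple of
    it, and the factor [e] can be read off from X and Y. *)
Section DerivativeOfHom.
Variable e : K.
Hypothesis eX : fD X = e * (2 * Y).
Hypothesis eY : fD Y = e * (3 * X ^+ 2 + a%:K).

Lemma fD_pev A : fD (pev A) = e * (2 * Y) * pev A^`().
Proof.
elim/poly_ind: A => [|A c IHA].
  by rewrite deriv0 -[0]/(0%:P) pevC fD_cst rmorph0 mulr0.
rewrite pevD pevM pevC pevX fDD fDM IHA eX fD_cst derivD derivM derivX derivC.
rewrite !addr0 mulr1 pevD pevM pevX [RHS]mulrDr [in RHS]mulrA.
by congr (_ + _); exact: mulrC.
Qed.

Lemma pev_natr n : pev n%:R = n%:R.
Proof. by rewrite -polyC_natr pevC rmorph_nat. Qed.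

Lemma fD_chom v : fD (chom v) = e * chom (cderiv v).
Proof.
rewrite /chom /cderiv fDD fDM !fD_pev eY.
rewrite -[(_, 2 * v.1^`()).1]/(2 * (v.2^`() * cubic a b) + v.2 * (cubic a b)^`()).
rewrite -[(_, 2 * v.1^`()).2]/(2 * v.1^`()) deriv_cubic.
have := pev_cubic; move: (cubic a b) => c ec; rewrite !pevD !pevM ec.
rewrite pev_natr pevD pevM !pevC (rmorph_nat fcst).
have -> : pev 'X^2 = X ^+ 2 by rewrite expr2 pevM pevX.
have key (L : comNzRingType) (e' y' p q r s : L) :
    e' * (2 * y') * p + (e' * (2 * y') * q * y' + r * (e' * s)) =
    e' * (2 * (q * y' ^+ 2) + r * s + 2 * p * y') by ring.
exact: key.
Qed.

End DerivativeOfHom.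

Lemma hom_of_point : exists phi : {rmorphism K -> K},
  [/\ forall c, phi c%:K = c%:K, phi fx = X, phi fy = Y &
    forall e, fD X = e * (2 * Y) -> fD Y = e * (3 * X ^+ 2 + a%:K) ->
    forall u, fD (phi u) = e * phi (fD u)].
Proof.
have [phi ephi] := frac_lift_exists K chom_neq0.
have {}ephi v : phi v%:F = chom v by exact: ephi.
exists phi; split.
- by move=> c; rewrite {1}fcstE ephi chom_emb pevC.
- by rewrite /fx ephi chom_emb pevX.
- by rewrite /fy ephi chom_y.
move=> e eX eY u.
have DR v : fD (phi v%:F) = e * phi (fD v%:F).
  by rewrite fD_emb !ephi; apply: fD_chom.
rewrite (num_den u); move: (num u)%:F (den u)%:F (den_frac_neq0 u)
  (DR (num u)) (DR (den u)) => n d d0 Dn Dd.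
have pd0 : phi d != 0 by rewrite fmorph_eq0.
have en : n = (n / d) * d by rewrite divfK.
move: (n / d) en => z en; rewrite en (fDM z) (rmorphM phi z) fDM rmorphD (rmorphM phi z)
  (rmorphM phi (fD z)) Dd in Dn.
apply: (mulIf pd0); apply: (addIr (phi z * (e * phi (fD d)))).
by rewrite Dn; ring.
Qed.

End HomFromPoint.

Lemma hom_ext (phi psi : {rmorphism K -> K}) :
  (forall c, phi c%:K = c%:K) -> (forall c, psi c%:K = c%:K) ->
  phi fx = psi fx -> phi fy = psi fy -> phi =1 psi.
Proof.
move=> pC qC ex ey.
have eP A : phi (emb A)%:F = psi (emb A)%:F.
  elim/poly_ind: A => [|A c IHA]; first by rewrite !rmorph0.
  rewrite !(rmorphD emb, rmorphM emb, rmorphD, rmorphM, rmorphD, rmorphM) /=.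
  by rewrite IHA ex -fcstE pC qC.
have eR v : phi v%:F = psi v%:F.
  by rewrite (coord_ring_split v) rmorphD rmorphM !rmorphD !rmorphM !eP ey.
by move=> u; rewrite (num_den u) !fmorph_div !eR.
Qed.

(** In characteristic zero the constants of the derivation are those of the
    curve.  Write u = (A + B y) / N with polynomials A, B, N.  Vanishing of the
    derivative says that A and N have zero Wronskian, and so have
    (x^3 + a x + b) B^2 and N^2.  The former are thus proportional, and so are
    the latter, which forces B = 0 because of the parity of the degrees. *)
Lemma fD_kernel u : fD u = 0 -> exists c, u = c%:K.
Proof.
have [A [B [N [N0 ->]]]] : exists A B N,
    N != 0 /\ u = ((A, B) : R)%:F / (emb N)%:F.
  pose e : R := ((den u).1, - (den u).2).
  have e0 : e != 0.
    apply: contra (den_neq0 u) => /eqP[d1 /eqP]; rewrite oppr_eq0 => /eqP d2.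
    by rewrite [den u]surjective_pairing d1 d2.
  have ne : den u * e = emb (coord_norm (den u)).
    by rewrite coord_mulE /coord_norm; congr (_, _) => /=; ring.
  exists (num u * e).1, (num u * e).2, (coord_norm (den u)).
  rewrite coord_norm_eq0 den_neq0 -surjective_pairing -ne; split=> //.
  rewrite !rmorphM -mulf_div divff ?mulr1 ?ff_eq0 //.
  exact: num_den.
have eN0 : emb N != 0 by rewrite emb_eq0.
rewrite /fD (frac_derivE K cderivM) // => /eqP.
rewrite mulf_eq0 invr_eq0 !ff_eq0 expf_eq0 (negbTE eN0) andbF orbF.
rewrite !coord_mulE /cderiv /= deriv0 => /eqP[].
have := size_cubic_sqr a b; move: (cubic a b) => c sc e1 e2.
have t0 : 2 != 0 :> {poly k} by rewrite -polyC_natr polyC_eq0 pchar0_natr.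
have eA : A^`() * N = A * N^`().
  apply: (mulfI t0); apply/eqP; rewrite -subr_eq0; apply/eqP; rewrite -[RHS]e2.
  by ring.
have eB : (c * B ^+ 2)^`() * N ^+ 2 = c * B ^+ 2 * (N ^+ 2)^`().
  have := congr1 ( *%R (B * N)) e1; rewrite [in RHS]mulr0 => e1'.
  apply/eqP; rewrite -subr_eq0; apply/eqP; rewrite -[RHS]e1' !expr2 !derivM.
  by ring.
have [al eal] := wronskian hk N0 eA.
have [be ebe] := wronskian hk (expf_neq0 2 N0) eB.
have B0 : B = 0.
  apply/eqP/negPn/negP => B0; have := sc B; rewrite ebe (negbTE B0).
  have be0 : be != 0.
    apply/eqP => be0; have := sc B.
    by rewrite ebe be0 scale0r size_poly0 (negbTE B0).
  rewrite size_scale // size_poly_sqr.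
  move: N0; rewrite -size_poly_gt0; case: (size N) => // j _.
  rewrite doubleS /= => /(congr1 odd); rewrite /= odd_double.
  by rewrite odd_double.
exists al; rewrite eal B0.
have -> : ((al *: N, 0) : R) = emb al%:P * emb N.
  by rewrite -rmorphM mul_polyC.
by rewrite rmorphM mulfK // ff_eq0.
Qed.

End FunctionField.

(** * Translations of the curve *)

Lemma closed_nth_root (k : closedFieldType) (c : k) n : (0 < n)%N ->
  exists s, s ^+ n = c.
Proof.
move=> n0; have /closed_rootP[s /rootP] : size ('X^n - c%:P) != 1%N.
  by rewrite size_XnsubC // eqSS -lt0n.
by rewrite !hornerE => /eqP; rewrite subr_eq0 => /eqP; exists s.
Qed.

(** Chord construction: the line of slope m through two points of the curve
    with distinct abscissas meets it again at the abscissa m^2 - x1 - x2,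
    because m^2 is the sum of the three roots of the resulting cubic. *)
Lemma cubic_chord (F : fieldType) (a b x1 y1 x2 m : F) : x2 - x1 != 0 ->
  y1 ^+ 2 = x1 ^+ 3 + a * x1 + b ->
  (y1 + m * (x2 - x1)) ^+ 2 = x2 ^+ 3 + a * x2 + b ->
  let x3 := m ^+ 2 - x1 - x2 in
  (y1 + m * (x3 - x1)) ^+ 2 = x3 ^+ 3 + a * x3 + b.
Proof.
move=> n0 h1 h2 /=.
have : (x2 - x1) * (m ^+ 2 * (x2 - x1) + 2 * y1 * m -
                    (x2 ^+ 2 + x2 * x1 + x1 ^+ 2 + a)) = 0.
  transitivity ((y1 + m * (x2 - x1)) ^+ 2 - y1 ^+ 2 -
                (x2 ^+ 3 + a * x2 + b) + (x1 ^+ 3 + a * x1 + b)); first by ring.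
  by rewrite h1 h2; ring.
move=> /eqP; rewrite mulf_eq0 (negbTE n0) /= => /eqP h.
apply/eqP; rewrite -subr_eq0; apply/eqP.
transitivity ((m ^+ 2 - x1 - x2 - x1) * (m ^+ 2 * (x2 - x1) +
    2 * y1 * m - (x2 ^+ 2 + x2 * x1 + x1 ^+ 2 + a)) +
    (y1 ^+ 2 - (x1 ^+ 3 + a * x1 + b))); first by ring.
by rewrite h h1; ring.
Qed.

(** The identity behind [double_translate], with abscissas measured from the
    point T that is added twice: u and u1 are those of the generic point p and
    of p + T, v is the ordinate of T, l the slope of the chord from T to p, m
    the slope of the tangent at T, d the abscissa of the double of T, and be is
    three times the abscissa of T.  The left side computes p + T + T in two
    steps, the right side in one, both up to the same shift. *)
Lemma chord_tangent (F : fieldType) (u l m v be : F) :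
  let u1 := 2 * v * (m - l) / u in let d := m ^+ 2 - be in
  u != 0 -> m - l != 0 -> 2 * v != 0 -> u - d != 0 -> be = l ^+ 2 - u - u1 ->
  (l + 2 * v / u1) ^+ 2 - u1 =
  ((2 * v + l * u + m * d) / (u - d)) ^+ 2 - u - d.
Proof.
move=> /= u0 ml0 v0 d0 ebe; rewrite ebe in d0 *.
have d0' : u * (u - m ^+ 2 + l ^+ 2 - u) - 2 * v * (m - l) != 0.
  apply: contra d0 => /eqP h; apply/eqP/(mulfI u0); rewrite mulr0 -h.
  by field.
have v0' : v != 0 by apply: contra v0 => /eqP ->; rewrite mulr0.
have t0 : 2 != 0 :> F by apply: contra v0 => /eqP ->; rewrite mul0r.
field; rewrite ?u0 ?ml0 ?v0' ?t0 /= ?andbT.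
by apply: contra d0' => /eqP h; apply/eqP; rewrite -[RHS]h; ring.
Qed.

(** The function field is seen here abstractly: a field [K] over [k], generated
    by a point (x, y) of the curve, with a derivation [D].  Translations are
    studied through their action on [K]; the group law of the curve is not
    constructed. *)
Section Translations.
Variables (k : closedFieldType) (K : fieldType) (iota : {rmorphism k -> K}).
Variables (x y : K) (a b : k) (D : K -> K).
Local Notation "c %:K" := (iota c) (at level 2, left associativity, format "c %:K").
Local Notation on X Y := (Y ^+ 2 = X ^+ 3 + a * X + b).
Local Notation onK X Y := (Y ^+ 2 = X ^+ 3 + a%:K * X + b%:K).

Hypothesis nonsing : forall X, X ^+ 3 + a * X + b = 0 -> 3 * X ^+ 2 + a != 0.
Hypothesis two0 : 2 != 0 :> K.
Hypothesis xy : onK x y.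
Hypothesis x_tr : forall c, x != c%:K.
Hypothesis DD : forall u v, D (u + v) = D u + D v.
Hypothesis DM : forall u v, D (u * v) = D u * v + u * D v.
Hypothesis DC : forall c, D c%:K = 0.
Hypothesis Dx : D x = 2 * y.
Hypothesis Dy : D y = 3 * x ^+ 2 + a%:K.
Hypothesis D0 : forall u, D u = 0 -> exists c, u = c%:K.
Hypothesis hom_of_point : forall X Y : K, onK X Y -> (forall c, X != c%:K) ->
  exists phi : {rmorphism K -> K}, [/\ forall c, phi c%:K = c%:K, phi x = X,
    phi y = Y & forall e, D X = e * (2 * Y) -> D Y = e * (3 * X ^+ 2 + a%:K) ->
    forall u, D (phi u) = e * phi (D u)].
Hypothesis hom_ext : forall phi psi : {rmorphism K -> K},
  (forall c, phi c%:K = c%:K) -> (forall c, psi c%:K = c%:K) ->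
  phi x = psi x -> phi y = psi y -> phi =1 psi.

(** Preserving the derivation means preserving the invariant differential,
    which singles out the translations among the endomorphisms. *)
Definition flow (phi : K -> K) :=
  (forall c, phi c%:K = c%:K) /\ (forall u, D (phi u) = phi (D u)).

Lemma DN u : D (- u) = - D u.
Proof.
have h0 : D 0 = 0 by have := DC 0; rewrite rmorph0.
by apply/eqP; rewrite -subr_eq0 opprK -DD addNr h0.
Qed.

Lemma DB u v : D (u - v) = D u - D v. Proof. by rewrite DD DN. Qed.

Lemma D1 : D 1 = 0. Proof. by have := DC 1; rewrite rmorph1. Qed.

Lemma DV u : u != 0 -> D (u^-1) = - D u / u ^+ 2.
Proof.
move=> u0; apply: (mulfI u0).
have : D (u / u) = 0 by rewrite divff // D1.
rewrite DM => /eqP; rewrite addrC addr_eq0 => /eqP ->.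
by field.
Qed.

Lemma x_sub_neq0 c : x - c%:K != 0. Proof. by rewrite subr_eq0 x_tr. Qed.

Lemma y_neq0 : y != 0.
Proof.
apply/eqP => y0; have /D0[c xc] : D x = 0 by rewrite Dx y0 mulr0.
by move: (x_tr c); rewrite xc eqxx.
Qed.

(** Chord formulas for the sum of the generic point and (X, Y). *)
Definition slope X Y := (y - Y%:K) / (x - X%:K).
Definition addx X Y := slope X Y ^+ 2 - x - X%:K.
Definition addy X Y := - (Y%:K + slope X Y * (addx X Y - X%:K)).

Lemma onKC X Y : on X Y -> onK X%:K Y%:K.
Proof. by move=> h; rewrite -!rmorphXn h !rmorphD !rmorphM. Qed.

(** The basic identity.  With the Weierstrass functions, x plays the role of
    minus the derivative of zeta, and the slope is zeta(p + P) - zeta(p) up to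
    a constant. *)
Lemma slope_deriv X Y : on X Y -> D (slope X Y) = x - addx X Y.
Proof.
move=> /onKC; have n0 := x_sub_neq0 X; rewrite /addx /slope => oP.
rewrite DM DV // !DB !DC !subr0 Dx Dy.
apply: (mulIf (expf_neq0 2 n0)).
have e1 : ((3 * x ^+ 2 + a%:K) / (x - X%:K) +
   (y - Y%:K) * (- (2 * y) / (x - X%:K) ^+ 2)) * (x - X%:K) ^+ 2 =
   (3 * x ^+ 2 + a%:K) * (x - X%:K) - (y - Y%:K) * (2 * y) by field.
have e2 : (x - (((y - Y%:K) / (x - X%:K)) ^+ 2 - x - X%:K)) * (x - X%:K) ^+ 2 =
   (2 * x + X%:K) * (x - X%:K) ^+ 2 - (y - Y%:K) ^+ 2 by field.
rewrite e1 e2; ring: xy oP.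
Qed.

Lemma slopeE X Y : y = Y%:K + slope X Y * (x - X%:K).
Proof. by rewrite divfK ?x_sub_neq0 // addrC subrK. Qed.

Lemma onK_add X Y : on X Y -> onK (addx X Y) (addy X Y).
Proof.
move=> /onKC oP; rewrite /addy sqrrN /addx [_ - x - _]addrAC.
by apply: cubic_chord; rewrite ?x_sub_neq0 -?slopeE.
Qed.

Lemma addx_deriv X Y : on X Y -> D (addx X Y) = 2 * addy X Y.
Proof.
move=> oP; have n0 := x_sub_neq0 X.
have ey := slopeE X Y.
rewrite {1}/addx expr2 !DB DM (slope_deriv oP) DC Dx /addy {1}ey.
set l := slope X Y; ring.
Qed.

(** If the abscissa of the sum were constant, so would be its ordinate, with
    value 0, hence also the slope, unless the abscissa is X: then Y = 0, and the
    curve has a singular point at (X, 0).  But the derivative of the slope is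
    not 0. *)
Lemma addx_nconst X Y : on X Y -> forall c, addx X Y != c%:K.
Proof.
move=> oP c; apply/eqP => e; have n0 := x_sub_neq0 X.
have y0 : addy X Y = 0.
  have := addx_deriv oP; rewrite e DC => /esym/eqP.
  by rewrite mulf_eq0 (negbTE two0) => /eqP.
have [h|sX] := eqVneq (addx X Y) X%:K.
  move: y0; rewrite /addy h subrr mulr0 addr0 => /eqP.
  rewrite oppr_eq0 fmorph_eq0 => /eqP Y0.
  have eyy : y ^+ 2 = (x - X%:K) ^+ 2 * (2 * X%:K + x).
    move: h; rewrite /addx /slope Y0 rmorph0 subr0 expr_div_n => h.
    have -> : y ^+ 2 = (y ^+ 2 / (x - X%:K) ^+ 2 - x - X%:K + x + X%:K) *
                       (x - X%:K) ^+ 2 by field.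
    by rewrite h; ring.
  have oX : X ^+ 3 + a * X + b = 0 by rewrite -oP Y0 expr0n.
  have /negP[] := nonsing oX; rewrite -(fmorph_eq0 iota).
  have oX' : X%:K ^+ 3 + a%:K * X%:K + b%:K = 0.
    by rewrite -(onKC oP) Y0 rmorph0 expr0n.
  rewrite rmorphD rmorphM rmorph_nat rmorphXn /=.
  rewrite -[_ == 0]/(false || _) -(negbTE n0) -mulf_eq0; apply/eqP.
  transitivity (x ^+ 3 + a%:K * x + b%:K - (X%:K ^+ 3 + a%:K * X%:K + b%:K) -
    (x - X%:K) ^+ 2 * (2 * X%:K + x)); first by ring.
  by rewrite oX' -xy eyy; ring.
have sl : slope X Y = - Y%:K / (c - X)%:K.
  move: y0; rewrite /addy e => /eqP; rewrite oppr_eq0 addrC addr_eq0 => /eqP h.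
  apply: (canRL (mulfK _)); first by rewrite rmorphB -e subr_eq0.
  by rewrite rmorphB.
have := slope_deriv oP; rewrite sl -rmorphN -fmorph_div DC e => /esym/eqP.
by rewrite (negbTE (x_sub_neq0 c)).
Qed.

(** The sum of the generic point and a constant point has the same
    derivatives as the generic point: the derivative of its ordinate follows
    from the one of its abscissa by differentiating the equation. *)
Lemma translationP X Y : on X Y ->
  exists phi : {rmorphism K -> K},
    [/\ flow phi, phi x = addx X Y & phi y = addy X Y].
Proof.
move=> oP; have [phi [pC px py h]] := hom_of_point (onK_add oP) (addx_nconst oP).
exists phi; split=> //; split=> // u; rewrite [LHS](h 1) ?mul1r //.
  exact: addx_deriv.
have := onK_add oP; set X1 := addx X Y; set Y1 := addy X Y => e.
have Y10 : Y1 != 0.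
  apply/eqP => Y10; have := addx_deriv oP; rewrite -/Y1 Y10 mulr0 => /D0[c].
  by apply/eqP/addx_nconst.
apply: (mulfI (mulf_neq0 two0 Y10)).
have : D (Y1 ^+ 2) = D (X1 ^+ 3 + a%:K * X1 + b%:K) by rewrite e.
rewrite expr2 !exprSr expr0 mul1r !DD !DM !DC addx_deriv // -/Y1 => h'.
transitivity (D Y1 * Y1 + Y1 * D Y1); first by ring.
by rewrite h'; ring.
Qed.

(** The three points of a chord are collinear: after translation the line
    joining the generic point to -P is the original chord, reflected. *)
Lemma slope_translate (phi : {rmorphism K -> K}) X Y : on X Y ->
  (forall c, phi c%:K = c%:K) -> phi x = addx X Y -> phi y = addy X Y ->
  phi ((y + Y%:K) / (x - X%:K)) = - slope X Y.
Proof.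
move=> oP pC px py; rewrite fmorph_div rmorphD rmorphB px py !pC.
have n0 : addx X Y - X%:K != 0 by rewrite subr_eq0 addx_nconst.
by rewrite /addy; field.
Qed.

Lemma flow_eq (phi psi : {rmorphism K -> K}) : flow phi -> flow psi ->
  phi x = psi x -> phi =1 psi.
Proof.
move=> [fC fD] [gC gD] e; apply: hom_ext => //.
have := fD x; rewrite e gD Dx !rmorphM !rmorph_nat => /(mulfI two0) /esym.
by [].
Qed.

(** The converse of [translationP]: subtract the generic point from its image
    by the chord through (X1, Y1) and (x, -y).  The slope [mu] of this chord
    has derivative X1 - x, so that the abscissa of the third point is killed
    by [D], hence is constant, and so is the ordinate since [k] is
    algebraically closed. *)
Lemma flow_translation (phi : {rmorphism K -> K}) : flow phi -> phi x != x ->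
  exists X Y, [/\ on X Y, phi x = addx X Y & phi y = addy X Y].
Proof.
move=> [fC fD] n0; set X1 := phi x; set Y1 := phi y.
have d0 : X1 - x != 0 by rewrite subr_eq0.
have o1 : onK X1 Y1 by have := congr1 phi xy; rewrite !rmorphD rmorphM !rmorphXn /= !fC.
have DX1 : D X1 = 2 * Y1 by rewrite fD Dx rmorphM rmorph_nat.
have DY1 : D Y1 = 3 * X1 ^+ 2 + a%:K.
  by rewrite fD Dy rmorphD rmorphM rmorphXn rmorph_nat fC.
clearbody X1 Y1.
set mu := (Y1 + y) / (X1 - x).
have emu : Y1 + y = mu * (X1 - x) by rewrite /mu divfK.
have Dmu : D mu = X1 - x.
  rewrite /mu DM DV // DD DB DX1 DY1 Dx Dy.
  apply: (mulIf (expf_neq0 2 d0)).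
  transitivity ((3 * X1 ^+ 2 + a%:K + (3 * x ^+ 2 + a%:K)) * (X1 - x) -
     2 * (Y1 ^+ 2 - y ^+ 2)); first by field.
  by rewrite xy o1; ring.
have /D0[X eX] : D (mu ^+ 2 - X1 - x) = 0.
  rewrite expr2 !DB DM Dmu DX1 Dx.
  transitivity (2 * (mu * (X1 - x)) - 2 * (Y1 + y)); first by ring.
  by rewrite emu subrr.
pose Y' := y - mu * (X%:K - x).
have oY : Y' ^+ 2 = X%:K ^+ 3 + a%:K * X%:K + b%:K.
  rewrite -eX [_ - X1 - x]addrAC -sqrrN.
  have -> : - Y' = - y + mu * (mu ^+ 2 - x - X1 - x) by rewrite /Y' -eX; ring.
  apply: cubic_chord; rewrite ?sqrrN // -o1; congr (_ ^+ 2).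
  by rewrite -emu; ring.
have [Y eY] : exists Y, Y' = Y%:K.
  have [s es] := closed_nth_root (X ^+ 3 + a * X + b) (isT : 0 < 2)%N.
  have /eqP : Y' ^+ 2 = s%:K ^+ 2.
    by rewrite -rmorphXn es oY !rmorphD rmorphM !rmorphXn.
  rewrite eqf_sqr => /orP[] /eqP ->; first by exists s.
  by exists (- s); rewrite rmorphN.
have oP : on X Y.
  by apply: (fmorph_inj iota); rewrite rmorphXn -eY oY 2!rmorphD (rmorphXn _ 3) rmorphM.
have sl : slope X Y = - mu.
  by rewrite /slope -eY /Y'; field; rewrite x_sub_neq0.
have ax : X1 = addx X Y by rewrite /addx sl sqrrN -eX; ring.
exists X, Y; split=> //.
rewrite /addy sl -ax -eY /Y'.
have -> : Y1 = mu * (X1 - x) - y by rewrite -emu; ring.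
by ring.
Qed.

Variable neg : {rmorphism K -> K}.
Hypothesis negC : forall c, neg c%:K = c%:K.
Hypothesis neg_x : neg x = x.
Hypothesis neg_y : neg y = - y.

Lemma negK u : neg (neg u) = u.
Proof.
apply: (@hom_ext (neg \o neg) idfun) => //= [c||]; rewrite ?negC ?neg_x //.
by rewrite neg_y rmorphN neg_y opprK.
Qed.

Lemma neg_slope X Y : neg (slope X Y) = - ((y + Y%:K) / (x - X%:K)).
Proof.
by rewrite /slope fmorph_div !rmorphB neg_x neg_y !negC -opprD mulNr.
Qed.

(** Conjugating a translation by the negation inverts it.  As this holds for
    every flow, in particular for the composite of two, flows commute: this
    replaces the associativity of the group law. *)
Lemma flow_neg (phi : {rmorphism K -> K}) : flow phi ->
  forall u, phi (neg (phi (neg u))) = u.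
Proof.
move=> fphi; have [fC fD] := fphi.
have [e|/(flow_translation fphi)[X [Y [oP px py]]]] := eqVneq (phi x) x.
  have pid : phi =1 idfun by apply: flow_eq.
  by move=> u; rewrite !pid /= negK.
have el : phi (neg (slope X Y)) = slope X Y.
  by rewrite neg_slope rmorphN (slope_translate oP) ?opprK.
have ex : phi (neg (addx X Y)) = x.
  rewrite {1}/addx !rmorphB !rmorphXn /= el neg_x negC fC px.
  by rewrite /addx; ring.
apply: (@hom_ext (phi \o neg \o phi \o neg) idfun) => //= [c||].
- by rewrite !(negC, fC).
- by rewrite neg_x px.
rewrite neg_y rmorphN py /addy opprK [in RHS](slopeE X Y).
move: (slope X Y) (addx X Y) el ex => l A el ex.
by rewrite !(rmorphD, rmorphM, rmorphN) /= el ex !(negC, fC).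
Qed.

Lemma flow_comp (phi psi : {rmorphism K -> K}) :
  flow phi -> flow psi -> flow (phi \o psi).
Proof.
by move=> [fC fD] [gC gD]; split=> [c|u] /=; rewrite ?gC ?fC // fD gD.
Qed.

Lemma flow_commute (phi psi : {rmorphism K -> K}) :
  flow phi -> flow psi -> phi \o psi =1 psi \o phi.
Proof.
move=> fphi fpsi u /=.
have h1 := flow_neg fphi; have h2 := flow_neg fpsi.
have h3 := flow_neg (flow_comp fphi fpsi).
have h1' v : phi (neg (phi v)) = neg v by rewrite -{1}[v]negK h1.
have h2' v : psi (neg (psi v)) = neg v by rewrite -{1}[v]negK h2.
by have := h3 (psi (phi u)); rewrite /= h2' h1' negK.
Qed.

(** Clear the denominators of the duplication formula: the abscissa T of half
    a point is a root of a monic quartic.  Nonsingularity ensures that T is not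
    the abscissa of a point of order two, which has no tangent of finite
    slope, and the sign of the ordinate is adjusted in the end. *)
Lemma halving X Y : on X Y -> exists X' Y',
  [/\ on X' Y', Y' != 0 & let m := (3 * X' ^+ 2 + a) / (2 * Y') in
      X = m ^+ 2 - 2 * X' /\ Y = - (Y' + m * (X - X'))].
Proof.
move=> oP; have t0 : 2 != 0 :> k by rewrite -(fmorph_eq0 iota) rmorph_nat.
pose c i := nth 0 [:: 4 * b * X - a ^+ 2; 4 * a * X + 8 * b; 2 * a; 4 * X] i.
have [T] := @solve_monicpoly k 4%N c isT.
rewrite !big_ord_recl big_ord0 /= /bump /= /c /= => eT.
have {eT} eT : (3 * T ^+ 2 + a) ^+ 2 = 4 * (T ^+ 3 + a * T + b) * (2 * T + X).
  transitivity (T ^+ 4 + (8 * T ^+ 4 + 6 * a * T ^+ 2 + a ^+ 2)); first by ring.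
  by rewrite {1}eT; ring.
have [V eV] := closed_nth_root (T ^+ 3 + a * T + b) (isT : 0 < 2)%N.
have V0 : V != 0.
  apply/eqP => V0; move: eV; rewrite V0 expr0n /= => /esym eV0.
  move: eT; rewrite eV0 mulr0 mul0r => /eqP; rewrite sqrf_eq0.
  by rewrite (negbTE (nonsing eV0)).
pose m := (3 * T ^+ 2 + a) / (2 * V).
have em : 3 * T ^+ 2 + a = 2 * V * m.
  by rewrite /m [RHS]mulrCA divff ?mulr1 ?mulf_neq0.
have eX : X = m ^+ 2 - 2 * T.
  apply: (mulfI (mulf_neq0 (mulf_neq0 t0 V0) (mulf_neq0 t0 V0))).
  transitivity (4 * V ^+ 2 * (2 * T + X) - 4 * V ^+ 2 * (2 * T)); first by ring.
  by rewrite [in X in X - _ = _]eV -eT em; ring.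
have oP' : (V + m * (X - T)) ^+ 2 = Y ^+ 2.
  have ea : a = 2 * V * m - 3 * T ^+ 2 by rewrite -em; ring.
  have eb : b = V ^+ 2 - T ^+ 3 - a * T by rewrite eV; ring.
  by rewrite oP eb ea eX; ring.
move/eqP: oP'; rewrite eqf_sqr => /orP[] /eqP eY.
- exists T, (- V); rewrite oppr_eq0 sqrrN /= mulrN invrN mulrN.
  by split; rewrite // sqrrN; split=> //; rewrite -eY -/m; ring.
- by exists T, V; split=> //=; split=> //; rewrite -/m eY opprK.
Qed.

(** Two flows that agree at x are equal, so that it suffices to compare the
    abscissas, which is [chord_tangent]. *)
Lemma double_translate (phi chi : {rmorphism K -> K}) X Y X' Y' :
  on X Y -> on X' Y' -> Y' != 0 ->
  (let m := (3 * X' ^+ 2 + a) / (2 * Y') in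
    X = m ^+ 2 - 2 * X' /\ Y = - (Y' + m * (X - X'))) ->
  flow phi -> phi x = addx X Y -> flow chi -> chi x = addx X' Y' ->
  chi y = addy X' Y' -> chi \o chi =1 phi.
Proof.
move=> oP oP' Y'0 [eX eY] fphi px fchi cx cy.
apply: (@flow_eq (chi \o chi)) => //; first exact: flow_comp.
have t0 : 2 != 0 :> k by rewrite -(fmorph_eq0 iota) rmorph_nat.
have cC := fchi.1; rewrite /= cx px.
set m := (_ / _) in eX eY.
have em : 3 * X' ^+ 2 + a = 2 * Y' * m.
  by rewrite /m [RHS]mulrCA divff ?mulr1 ?mulf_neq0.
have n0 := x_sub_neq0 X'.
set l := slope X' Y'.
have ey : y = Y'%:K + l * (x - X'%:K) by exact: slopeE.
pose u1 := addx X' Y' - X'%:K.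
have u10 : u1 != 0 by rewrite subr_eq0 addx_nconst.
have emK : 2 * Y'%:K * m%:K = 3 * X'%:K ^+ 2 + a%:K.
  have := congr1 iota em; rewrite rmorphD (rmorphM _ 3) (rmorphXn _ 2).
  by rewrite (rmorphM _ _ m) (rmorphM _ 2) !rmorph_nat.
have eXK : X%:K = m%:K ^+ 2 - 2 * X'%:K.
  by rewrite eX rmorphB (rmorphXn _ 2) (rmorphM _ 2) rmorph_nat.
have eYK : Y%:K = - (Y'%:K + m%:K * (X%:K - X'%:K)).
  by rewrite eY rmorphN rmorphD rmorphM rmorphB.
have eu1 : (x - X'%:K) * u1 = 2 * Y'%:K * (m%:K - l).
  apply: (mulfI n0).
  transitivity ((Y'%:K + l * (x - X'%:K)) ^+ 2 - Y'%:K ^+ 2 -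
     2 * Y'%:K * l * (x - X'%:K) - (x - X'%:K) ^+ 2 * (x + 2 * X'%:K)).
    by rewrite /u1 /addx -/l; ring.
  rewrite -ey xy (onKC oP').
  transitivity ((x - X'%:K) * (2 * Y'%:K * m%:K - 2 * Y'%:K * l)); last by ring.
  by rewrite emK; ring.
have ml0 : m%:K - l != 0.
  apply: contraNneq (mulf_neq0 n0 u10) => h.
  by rewrite eu1 h mulr0.
have d0 : (x - X'%:K) - (m%:K ^+ 2 - 3 * X'%:K) != 0.
  have -> : x - X'%:K - (m%:K ^+ 2 - 3 * X'%:K) = x - X%:K by rewrite eXK; ring.
  exact: x_sub_neq0.
have cl : chi l = - (l + 2 * Y'%:K / u1).
  rewrite [in LHS]/l /slope fmorph_div !rmorphB !cC cx cy -/u1 /addy -/u1 -/l.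
  by field.
have eu1' : 2 * Y'%:K * (m%:K - l) / (x - X'%:K) = u1.
  by rewrite -eu1 mulrC mulKf.
have Y'K : 2 * Y'%:K != 0 by rewrite mulf_neq0 ?fmorph_eq0.
have h := chord_tangent n0 ml0 Y'K d0; rewrite eu1' in h.
rewrite [addx X Y]/addx [addx X' Y']/addx !rmorphB rmorphXn -/l cl sqrrN cx cC.
have -> : slope X Y = (2 * Y'%:K + l * (x - X'%:K) + m%:K * (m%:K ^+ 2 - 3 * X'%:K)) /
   (x - X'%:K - (m%:K ^+ 2 - 3 * X'%:K)).
  by rewrite /slope ey eYK eXK; congr (_ / _); ring.
move: h; set w := (_ / (x - _ - _)) ^+ 2 => h.
transitivity ((l + 2 * Y'%:K / u1) ^+ 2 - u1 - 2 * X'%:K); first by rewrite /u1; ring.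
rewrite h ?eXK; first by ring.
by rewrite /u1 /addx -/l; ring.
Qed.

(** * Iterates, norms and logarithmic derivatives *)

Implicit Types phi psi : {rmorphism K -> K}.
Fixpoint hpow (phi : {rmorphism K -> K}) n : {rmorphism K -> K} :=
  if n is m.+1 then phi \o hpow phi m else idfun.

Lemma hpowD phi m n u : hpow phi (m + n) u = hpow phi m (hpow phi n u).
Proof. by elim: m => //= m ->. Qed.

Lemma hpowSr phi n u : hpow phi n.+1 u = hpow phi n (phi u).
Proof. by rewrite -addn1 hpowD. Qed.

Lemma eq_hpow (phi psi : {rmorphism K -> K}) n :
  phi =1 psi -> hpow phi n =1 hpow psi n.
Proof. by move=> e u; elim: n => //= n ->. Qed.

Lemma hpow_comp2 (phi : {rmorphism K -> K}) n :
  hpow (phi \o phi) n =1 hpow phi n.*2.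
Proof. by move=> u; elim: n => //= n ->. Qed.

Lemma hpow_flow phi n : flow phi -> flow (hpow phi n).
Proof. by move=> fphi; elim: n => //= n; apply: flow_comp. Qed.

(** When phi has order n, this is the norm from [K] to the fixed field of phi.
    It is the multiplier of the n-th power of the monomial automorphism
    defined by phi and u. *)
Definition nrm (phi : {rmorphism K -> K}) n u := \prod_(i < n) hpow phi i u.

Lemma nrm_neq0 phi n u : u != 0 -> nrm phi n u != 0.
Proof. by move=> u0; apply/prodf_neq0 => i _; rewrite fmorph_eq0. Qed.

Lemma nrmM phi n u v : nrm phi n (u * v) = nrm phi n u * nrm phi n v.
Proof. by rewrite -big_split /=; apply: eq_bigr => i _; rewrite rmorphM. Qed.

Lemma nrm_cst phi n c : flow phi -> nrm phi n c%:K = c%:K ^+ n.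
Proof.
move=> fphi; rewrite -[in RHS](card_ord n) -prodr_const.
by apply: eq_bigr => i _; have [-> _] := hpow_flow i fphi.
Qed.

Lemma nrm_telescope phi n u : u != 0 ->
  nrm phi n (phi u / u) = hpow phi n u / u.
Proof.
move=> u0; rewrite /nrm; elim: n => [|n IHn]; first by rewrite big_ord0 divff.
rewrite big_ord_recr /= IHn fmorph_div -hpowSr /= mulrC.
by rewrite mulrA divfK ?fmorph_eq0.
Qed.

Lemma sum_telescope phi n u :
  \sum_(i < n) hpow phi i (phi u - u) = hpow phi n u - u.
Proof.
elim: n => [|n IHn]; first by rewrite big_ord0 subrr.
by rewrite big_ord_recr /= IHn rmorphB -hpowSr /= addrC addrA subrK.
Qed.

Lemma nrm_comp2 phi n u : nrm (phi \o phi) n (u * phi u) = nrm phi n.*2 u.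
Proof.
rewrite /nrm; elim: n => [|n IHn]; first by rewrite !big_ord0.
rewrite doubleS !big_ord_recr /= IHn hpow_comp2 rmorphM /= -hpowSr /=.
by rewrite mulrA.
Qed.

(** Identities up to a constant factor are proved by comparing logarithmic
    derivatives, which turns them into sums and telescopes. *)
Definition dlog u := D u / u.

Lemma dlogM u v : u != 0 -> v != 0 -> dlog (u * v) = dlog u + dlog v.
Proof. by move=> u0 v0; rewrite /dlog DM; field; apply/andP. Qed.

Lemma dlogV u : u != 0 -> dlog u^-1 = - dlog u.
Proof. by move=> u0; rewrite /dlog DV // invrK !mulNr expr2 invfM mulrA mulfVK. Qed.

Lemma dlogX u n : u != 0 -> dlog (u ^+ n) = dlog u *+ n.
Proof.
move=> u0; elim: n => [|n IHn]; first by rewrite /dlog D1 mul0r.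
by rewrite exprS dlogM ?expf_neq0 // IHn mulrS.
Qed.

Lemma dlog_prod n (F : nat -> K) : (forall i, F i != 0) ->
  dlog (\prod_(i < n) F i) = \sum_(i < n) dlog (F i).
Proof.
move=> F0; elim: n => [|n IHn]; first by rewrite !big_ord0 /dlog D1 mul0r.
rewrite !big_ord_recr /= dlogM ?IHn //.
by apply/prodf_neq0 => i _.
Qed.

Lemma dlog_flow (phi : {rmorphism K -> K}) u : flow phi ->
  dlog (phi u) = phi (dlog u).
Proof. by move=> [_ fD]; rewrite /dlog fmorph_div fD. Qed.

Lemma dlog_nrm phi n u : flow phi -> u != 0 ->
  dlog (nrm phi n u) = \sum_(i < n) hpow phi i (dlog u).
Proof.
move=> fphi u0; rewrite /nrm (dlog_prod _ (F := fun i => hpow phi i u)).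
  by apply: eq_bigr => i _; rewrite dlog_flow //; apply: hpow_flow.
by move=> i; rewrite fmorph_eq0.
Qed.

Lemma dlog0 u : u != 0 -> dlog u = 0 -> exists2 c, c != 0 & u = c%:K.
Proof.
move=> u0 /eqP; rewrite mulf_eq0 invr_eq0 (negbTE u0) orbF => /eqP/D0[c e].
by exists c => //; rewrite -(fmorph_eq0 iota) -e.
Qed.

Lemma dlog_eq u v : u != 0 -> v != 0 -> dlog u = dlog v ->
  exists2 c, c != 0 & u = c%:K * v.
Proof.
move=> u0 v0 e; have uv0 : u / v != 0 by rewrite mulf_neq0 ?invr_eq0.
have [|c c0 ec] := dlog0 uv0; last by exists c => //; rewrite -ec divfK.
by rewrite dlogM ?invr_eq0 // dlogV // e subrr.
Qed.

Lemma D_sum n (F : nat -> K) : D (\sum_(i < n) F i) = \sum_(i < n) D (F i).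
Proof.
elim: n => [|n IHn]; last by rewrite !big_ord_recr /= DD IHn.
by rewrite !big_ord0 -(rmorph0 iota) DC rmorph0.
Qed.

Lemma flow_negr (phi : {rmorphism K -> K}) u : flow phi ->
  phi (neg (phi u)) = neg u.
Proof. by move=> fphi; rewrite -{1}[u]negK flow_neg. Qed.

(** This pins down constants of integration: a constant is fixed by every
    endomorphism over [k], and cannot change sign unless it is 0. *)
Lemma antisym_cst W : D W = 0 -> forall phi : {rmorphism K -> K},
  (forall c, phi c%:K = c%:K) -> phi W = - W -> W = 0.
Proof.
move=> /D0[w ->] phi pC; rewrite pC => /eqP.
rewrite -addr_eq0 -mulr2n -mulr_natl mulf_eq0 (negbTE two0) /=.
by move/eqP.
Qed.

(** * Miller functions and their commutator *)

Definition translation (phi : {rmorphism K -> K}) X Y :=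
  [/\ on X Y, flow phi, phi x = addx X Y & phi y = addy X Y].

Section OneTranslation.
Variables (phi : {rmorphism K -> K}) (X Y : k).
Hypothesis tphi : translation phi X Y.
Let S := slope X Y.

Lemma translation_slope : phi ((y + Y%:K) / (x - X%:K)) = - S.
Proof. by case: tphi => oP [fC _] px py; apply: slope_translate. Qed.

Lemma translation_neg_slope : phi (neg S) = S.
Proof. by rewrite neg_slope rmorphN translation_slope opprK. Qed.

Lemma D_translation_slope : D S = x - phi x.
Proof. by case: tphi => oP _ -> _; rewrite slope_deriv. Qed.

(** The constant term in the logarithmic derivative of the Miller function: its
    derivative telescopes, and vanishes when phi has order n. *)
Definition trace n := \sum_(i < n) hpow phi i S.

Lemma trace_cst n : hpow phi n =1 id -> exists c, trace n = c%:K.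
Proof.
move=> pn; apply: D0; have [_ fphi _ _] := tphi.
rewrite (D_sum _ (fun i => hpow phi i S)).
under eq_bigr => i _ do rewrite (hpow_flow i fphi).2 D_translation_slope
  -opprB rmorphN.
by rewrite sumrN sum_telescope pn subrr oppr0.
Qed.

(** For a translation phi by a point P of order n, this function has divisor
    n(O) - n(-P): it is the rational function that trivializes the multiple n
    of (O) - (-P), and its logarithmic derivative is, up to a constant,
    n (zeta(p) - zeta(p + P)). *)
Definition miller n :=
  \prod_(i < n) \prod_(j < i) hpow phi j.+1 (x - X%:K).

Lemma miller_neq0 n : miller n != 0.
Proof.
by apply/prodf_neq0 => i _; apply/prodf_neq0 => j _; rewrite fmorph_eq0 x_sub_neq0.
Qed.

Lemma dlog_translate : dlog (phi (x - X%:K)) = phi S - S.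
Proof.
have [_ fphi _ _] := tphi.
rewrite dlog_flow // /dlog DB DC subr0 Dx -translation_slope -rmorphD.
congr (phi _); rewrite /S /slope -mulrDl; congr (_ / _); ring.
Qed.

Lemma dlog_miller n : dlog (miller n) = trace n - S *+ n.
Proof.
have [_ fphi _ _] := tphi.
rewrite /miller (dlog_prod _
  (F := fun i => \prod_(j < i) hpow phi j.+1 (x - X%:K))); last first.
  by move=> i; apply/prodf_neq0 => j _; rewrite fmorph_eq0 x_sub_neq0.
under eq_bigr => i _.
  rewrite (dlog_prod _ (F := fun j => hpow phi j.+1 (x - X%:K))); last first.
    by move=> j; rewrite fmorph_eq0 x_sub_neq0.
  under eq_bigr => j _ do
    rewrite hpowSr (dlog_flow _ (hpow_flow _ fphi)) dlog_translate.
  rewrite sum_telescope; over.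
by rewrite sumrB sumr_const card_ord.
Qed.

Lemma nrm_miller n : hpow phi n =1 id ->
  exists2 c, c != 0 & nrm phi n (miller n) = c%:K.
Proof.
have [_ fphi _ _] := tphi.
move=> pn; apply: dlog0; first exact/nrm_neq0/miller_neq0.
rewrite dlog_nrm ?miller_neq0 // dlog_miller.
have [c ec] := trace_cst pn.
under eq_bigr => i _ do rewrite rmorphB rmorphMn ec (hpow_flow i fphi).1 -ec.
by rewrite sumrB sumr_const card_ord sumrMnl subrr.
Qed.

End OneTranslation.

(** In terms of zeta both sides are zeta(p + P + Q) - zeta(p) up to a constant;
    the constant is fixed by the reflection of p about -(P + Q)/2. *)
Lemma slope_symmetric phi psi X Y X' Y' :
  translation phi X Y -> translation psi X' Y' ->
  slope X Y + phi (slope X' Y') = slope X' Y' + psi (slope X Y).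
Proof.
move=> tphi tpsi; have [_ fphi _ _] := tphi; have [_ fpsi _ _] := tpsi.
have cm u : phi (psi u) = psi (phi u) by exact: (flow_commute fphi fpsi u).
apply/eqP; rewrite -subr_eq0; apply/eqP.
apply: (@antisym_cst _ _ (phi \o psi \o neg)) => [|c|] /=.
- rewrite DB !DD fphi.2 fpsi.2 (D_translation_slope tphi) (D_translation_slope tpsi).
  by rewrite !rmorphB cm; ring.
- by rewrite negC fpsi.1 fphi.1.
rewrite !(rmorphB, rmorphD) /= (flow_negr _ fpsi) (translation_neg_slope tphi).
rewrite (translation_neg_slope tpsi) !cm (flow_negr _ fphi).
rewrite (translation_neg_slope tphi) (translation_neg_slope tpsi).
by ring.
Qed.

(** The logarithmic derivatives of both sides agree by [slope_symmetric].  The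
    constant is the Weil pairing of the two points, up to inversion. *)
Lemma commutator_cst phi psi X Y X' Y' n :
  translation phi X Y -> translation psi X' Y' ->
  hpow phi n =1 id -> hpow psi n =1 id ->
  let g := miller phi X n in let h := miller psi X' n in
  exists2 c, c != 0 & g * phi h = c%:K * (h * psi g).
Proof.
move=> tphi tpsi pn qn g h.
have [_ fphi _ _] := tphi; have [_ fpsi _ _] := tpsi.
have g0 : g != 0 by exact: miller_neq0.
have h0 : h != 0 by exact: miller_neq0.
have pg0 : psi g != 0 by rewrite fmorph_eq0.
have ph0 : phi h != 0 by rewrite fmorph_eq0.
apply: dlog_eq; rewrite ?mulf_neq0 // !dlogM //.
rewrite !dlog_flow // !(dlog_miller tphi, dlog_miller tpsi).
have [t ->] := trace_cst tphi pn; have [t' ->] := trace_cst tpsi qn.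
rewrite !rmorphB !rmorphMn fphi.1 fpsi.1.
have := slope_symmetric tphi tpsi => /(canRL (addKr _)) ->.
by ring.
Qed.

Lemma translation_order2 phi e : translation phi e 0 ->
  phi (slope e 0) = - slope e 0 /\ (forall u, phi (phi u) = u).
Proof.
move=> tphi; have [_ fphi px _] := tphi.
have es : phi (slope e 0) = - slope e 0.
  by rewrite -(translation_slope tphi) /slope rmorph0 addr0 subr0.
split=> // u; apply: (@flow_eq (phi \o phi) idfun) => //=.
  exact: flow_comp.
rewrite px {1}/addx !rmorphB rmorphXn /= es px fphi.1 /addx; ring.
Qed.

Lemma translation_order2_neq_id phi e : translation phi e 0 -> phi x != x.
Proof.
move=> tphi; have [_ fphi _ _] := tphi; apply/eqP => px.
have y0 : slope e 0 = 0.
  apply: (@antisym_cst _ _ phi); [|exact: fphi.1|].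
    by rewrite (D_translation_slope tphi) px subrr.
  by have [] := translation_order2 tphi.
by have := slopeE e 0; rewrite y0 mul0r addr0 rmorph0 => /eqP; rewrite (negbTE y_neq0).
Qed.

Lemma on_root e : on e 0 -> e ^+ 3 + a * e + b = 0.
Proof. by move=> <-; rewrite expr0n. Qed.

(** Subtracting the square of the equation of a line from the cubic leaves the
    product of the differences to the three intersection points; evaluate this
    at the root e of the cubic. *)
Lemma translate_sub_root phi X Y e : translation phi X Y -> on e 0 ->
  phi (x - e%:K) * (x - e%:K) * (X%:K - e%:K) =
  (Y%:K + slope X Y * (e%:K - X%:K)) ^+ 2.
Proof.
case=> oP [fC _] px _ /onKC; rewrite rmorph0 expr0n /= => oe.
move/onKC in oP; have n0 := x_sub_neq0 X.
rewrite rmorphB px fC /addx /slope; apply: (mulIf (expf_neq0 2 n0)).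
have eb : b%:K = - (e%:K ^+ 3 + a%:K * e%:K).
  by apply/eqP; rewrite -addr_eq0 addrC -oe.
transitivity (((y ^+ 2 + Y%:K ^+ 2 - 2 * y * Y%:K) -
   (x + X%:K + e%:K) * (x - X%:K) ^+ 2) * (x - e%:K) * (X%:K - e%:K)).
  by field.
transitivity (Y%:K ^+ 2 * (x - e%:K) ^+ 2 + y ^+ 2 * (e%:K - X%:K) ^+ 2 +
   2 * y * Y%:K * (x - e%:K) * (e%:K - X%:K)); last by field.
by rewrite xy oP eb; ring.
Qed.

(** Both sides have the same divisor.  The last product is that of x - e
    translated by P and by -P. *)
Lemma translate_sub_root_neg phi tau X Y e : translation phi X Y ->
  translation tau e 0 -> 
  tau (x - X%:K) ^+ 2 * (x - e%:K) ^+ 2 = 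
  (x - X%:K) ^+ 2 * (phi (x - e%:K) * neg (phi (x - e%:K))).
Proof.
case=> oP [fC _] px _ [/onKC oe [tC _] tx _].
rewrite rmorph0 expr0n /= in oe.
move/onKC in oP; have n0 := x_sub_neq0 X; have n0' := x_sub_neq0 e.
have eb : b%:K = - (e%:K ^+ 3 + a%:K * e%:K).
  by apply/eqP; rewrite -addr_eq0 addrC -oe.
rewrite !rmorphB px tx fC tC !negC {1 2}/addx !rmorphB rmorphXn /=.
rewrite neg_slope neg_x negC sqrrN /slope rmorph0 subr0.
apply: (mulIf (expf_neq0 2 n0)).
transitivity ((y ^+ 2 - (x + e%:K + X%:K) * (x - e%:K) ^+ 2) ^+ 2 /
              (x - e%:K) ^+ 2 * (x - X%:K) ^+ 2).
  by field.
transitivity ((y ^+ 2 - Y%:K ^+ 2) ^+ 2 -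
    2 * (y ^+ 2 + Y%:K ^+ 2) * (x + X%:K + e%:K) * (x - X%:K) ^+ 2 +
    (x + X%:K + e%:K) ^+ 2 * (x - X%:K) ^+ 4);
  last by field.
by rewrite xy oP eb; field.
Qed.

Lemma translation_halving phi X Y : translation phi X Y ->
  exists psi X' Y', translation psi X' Y' /\ psi \o psi =1 phi.
Proof.
move=> [oP fphi px _]; have [X' [Y' [oP' Y'0 h]]] := halving oP.
have [psi [fpsi qx qy]] := translationP oP'.
exists psi, X', Y'; split=> //.
exact: (double_translate oP oP' Y'0 h fphi px fpsi qx qy).
Qed.

(** * The pairing has full order *)

Lemma torsion_above e m : on e 0 -> exists phi X Y tau,
  [/\ translation phi X Y, translation tau e 0 & hpow phi (2 ^ m) =1 tau].
Proof.
move=> oe; have [tau [ft tx ty]] := translationP oe.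
have tt : translation tau e 0 by [].
suff [phi [X [Y [tphi h]]]] : exists phi X Y, translation phi X Y /\
    hpow phi (2 ^ m) =1 tau by exists phi, X, Y, tau.
elim: m => [|m [phi [X [Y [/translation_halving[psi [X' [Y' [tpsi e2]]]] h]]]]].
  by exists tau, e, 0.
exists psi, X', Y'; split=> // u.
by rewrite expnS mul2n -hpow_comp2 -h; apply: eq_hpow.
Qed.

(** The pairing of two distinct points of order two is -1, and this is what
    survives in the power c^(n/2) of the pairing of points of order n. *)
Section TwoTorsion.
Variables e1 e2 : k.
Hypothesis oe1 : on e1 0.
Hypothesis oe2 : on e2 0.
Hypothesis e12 : e1 != e2.
Let q := x - e2%:K.

(** A sign is produced here.  The function phi q / q is a square w^2, and the
    norm of w^2 telescopes to 1, so that the norm of w is a sign.  Replacing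
    (phi, w) by (phi phi, w phi(w)) halves the order and keeps the norm, which
    reduces to the translation tau of order two.  There w q is a constant
    multiple of the slope, which tau changes to its opposite, and
    w tau(w) = -1 follows. *)
Lemma sqrt_norm m phi tau w : flow phi -> translation tau e1 0 ->
  hpow phi (2 ^ m) =1 tau -> w ^+ 2 = phi q / q -> nrm phi (2 ^ m.+1) w = -1.
Proof.
have q0 : q != 0 by exact: x_sub_neq0.
move=> + tt; elim: m phi w => [|m IHm] phi w fphi h ew; last first.
  rewrite expnS mul2n -nrm_comp2; apply: IHm; first exact: flow_comp.
    by move=> u; rewrite hpow_comp2 -mul2n -expnS h.
  rewrite exprMn -rmorphXn ew fmorph_div /=; field.
  by rewrite q0 fmorph_eq0 q0.
have w0 : w != 0 by rewrite -sqrf_eq0 ew mulf_neq0 ?invr_eq0 ?fmorph_eq0.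
have {}h u : phi u = tau u by exact: h.
have [es _] := translation_order2 tt.
have [s es2] := closed_nth_root (e1 - e2) (isT : 0 < 2)%N.
have s0 : s%:K != 0.
  by rewrite fmorph_eq0 -sqrf_eq0 es2 subr_eq0.
have : (w * q) ^+ 2 = (slope e1 0 * s%:K) ^+ 2.
  rewrite exprMn ew h; apply: (mulIf (expf_neq0 2 s0)).
  have := translate_sub_root tt oe2; rewrite -/q -rmorphB -es2 rmorphXn.
  rewrite rmorph0 add0r -opprB -rmorphB -es2 rmorphXn => eq.
  transitivity (tau q * q * s%:K ^+ 2); first by field.
  by rewrite eq; ring.
move=> /eqP; rewrite eqf_sqr => ewq.
have {}ewq : tau (w * q) = - (w * q).
  have [_ [tC _] _ _] := tt.
  by case/orP: ewq => /eqP ->; rewrite ?rmorphN rmorphM es tC ?mulNr ?opprK.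
rewrite /nrm !big_ord_recl big_ord0 /= mulr1 h.
have etq : tau q = w ^+ 2 * q by rewrite ew h divfK.
move: ewq; rewrite rmorphM etq => ewq.
apply: (mulfI (mulf_neq0 w0 q0)).
by rewrite mulrN1 -ewq; ring.
Qed.

Lemma hpow_comm phi psi n : flow phi -> flow psi ->
  forall u, psi (hpow phi n u) = hpow phi n (psi u).
Proof.
by move=> fphi fpsi u; apply: (flow_commute fpsi); apply: hpow_flow.
Qed.

Lemma nrm_comm phi psi n u : flow phi -> flow psi ->
  nrm phi n (psi u) = psi (nrm phi n u).
Proof.
move=> fphi fpsi; rewrite rmorph_prod; apply: eq_bigr => i _.
by rewrite hpow_comm.
Qed.

(** The divisor of the product telescopes to N times the divisor of 1 / q.
    On logarithmic derivatives this reads tau(T) - T = - 2 y / q for the half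
    trace T, where both sides have the same derivative and are odd. *)
Lemma half_norm psi X' Y' N tau : translation psi X' Y' ->
  translation tau e2 0 -> hpow psi N =1 tau ->
  exists2 c, c != 0 & nrm psi N (miller psi X' N.*2) = c%:K * q^-1 ^+ N.
Proof.
move=> tpsi tt h; have [_ fpsi _ _] := tpsi; have [_ ft tx _] := tt.
have q0 : q != 0 by exact: x_sub_neq0.
have [ts tK] := translation_order2 tt.
apply: dlog_eq; rewrite ?expf_neq0 ?invr_eq0 ?nrm_neq0 ?miller_neq0 //.
rewrite dlog_nrm ?miller_neq0 // (dlog_miller tpsi).
set S := slope X' Y'.
pose T := \sum_(i < N) hpow psi i S.
have eT : trace psi X' Y' N.*2 = T + tau T.
  rewrite /trace -addnn big_split_ord /=; congr (_ + _).
  by rewrite rmorph_sum; apply: eq_bigr => i _; rewrite hpowD h.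
have [|c ec] := @trace_cst _ _ _ tpsi N.*2.
  by move=> u; rewrite -addnn hpowD !h tK.
under eq_bigr => i _ do rewrite rmorphB rmorphMn ec (hpow_flow i fpsi).1 -ec.
rewrite sumrB sumr_const card_ord sumrMnl -/T eT.
have DT : D T = x - tau x.
  rewrite (D_sum _ (fun i => hpow psi i S)).
  under eq_bigr => i _ do rewrite (hpow_flow i fpsi).2
    (D_translation_slope tpsi) -opprB rmorphN.
  by rewrite sumrN sum_telescope h opprB.
have negT : neg T = tau T.
  rewrite -[neg T]tK; congr (tau _); rewrite /T !rmorph_sum /=.
  rewrite [RHS](reindex_inj rev_ord_inj) /=; apply: eq_bigr => i _.
  rewrite -h.
  transitivity (hpow psi (N - i.+1) (hpow psi i.+1 (neg (hpow psi i S)))).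
    by rewrite -hpowD subnK.
  by rewrite /= (flow_negr _ (hpow_flow i fpsi)) translation_neg_slope.
have : tau T - T = - (2 * y / q).
  apply/eqP; rewrite -addr_eq0; apply/eqP.
  apply: (@antisym_cst _ _ neg) => //.
    have -> : 2 * y / q = slope e2 0 + slope e2 0.
      by rewrite /slope rmorph0 subr0 -/q; ring.
    rewrite DD DB ft.2 DD (D_translation_slope tt) DT rmorphB tK; ring.
  rewrite rmorphD rmorphB -negT negK fmorph_div rmorphM rmorph_nat neg_y.
  by rewrite /q rmorphB neg_x negC; ring.
move=> eW; rewrite dlogX ?invr_eq0 // dlogV // /dlog DB DC subr0 Dx -eW.
by rewrite -addnn !mulrnDl mulrnDr mulNrn opprD; ring.
Qed.

(** Let n = 2N, and let g and h be the Miller functions of phi and psi, scaled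
    so that their norms are 1.  The commutator c is computed through its power
    c^N, by applying the half norm H of [half_norm] to the relation that
    defines c.  Half norms of psi(g) and g differ by the factor tau2(g) / g,
    and those of phi(h) and h by phi(H) / H.  With phi(q) = w^2 q the latter
    is w^(-n), by the explicit form of H.  The former is, by the definition of
    g, a product of factors phi^i(r) with r = tau2(x - X) / (x - X), which are
    quotients of iterates of w up to a sign, and amounts to N(w) w^(-n).  What
    remains of w is its norm N(w), equal to -1 by [sqrt_norm]. *)
Lemma heisenberg_operators m : exists (phi psi : {rmorphism K -> K}) g h c,
  let n := (2 ^ m.+2)%N in
  [/\ [/\ forall c, phi c%:K = c%:K, forall c, psi c%:K = c%:K,
          hpow phi n =1 id, hpow psi n =1 id & phi \o psi =1 psi \o phi],
      [/\ g != 0, h != 0, nrm phi n g = 1 & nrm psi n h = 1],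
      g * phi h = c%:K * (h * psi g) & c ^+ (2 ^ m.+1) = -1].
Proof.
set N := (2 ^ m.+1)%N.
have eN : (2 ^ m.+2 = N.*2)%N by rewrite -mul2n -expnS.
have [phi [X [Y [tau1 [tphi t1 h1]]]]] := torsion_above m.+1 oe1.
have [psi [X' [Y' [tau2 [tpsi t2 h2]]]]] := torsion_above m.+1 oe2.
rewrite -/N in h1 h2.
have [oP fphi _ _] := tphi; have [_ fpsi _ _] := tpsi.
have pn : hpow phi N.*2 =1 id.
  by move=> u; rewrite -addnn hpowD !h1 (translation_order2 t1).2.
have qn : hpow psi N.*2 =1 id.
  by move=> u; rewrite -addnn hpowD !h2 (translation_order2 t2).2.
have cm := flow_commute fphi fpsi.
set g := miller phi X N.*2; set h := miller psi X' N.*2.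
have g0 : g != 0 by exact: miller_neq0.
have h0 : h != 0 by exact: miller_neq0.
have [c c0 ec] := commutator_cst tphi tpsi pn qn.
have N2_gt0 : (0 < N.*2)%N by rewrite double_gt0 expn_gt0.
have [ga ga0 ega] := nrm_miller tphi pn.
have [gb gb0 egb] := nrm_miller tpsi qn.
have [al eal] := closed_nth_root ga^-1 N2_gt0.
have [be ebe] := closed_nth_root gb^-1 N2_gt0.
have al0 : al != 0.
  apply/eqP => h'; move/eqP: eal; rewrite h' expr0n eqn0Ngt N2_gt0 /=.
  by rewrite eq_sym invr_eq0 (negbTE ga0).
have be0 : be != 0.
  apply/eqP => h'; move/eqP: ebe; rewrite h' expr0n eqn0Ngt N2_gt0 /=.
  by rewrite eq_sym invr_eq0 (negbTE gb0).
exists phi, psi, (al%:K * g), (be%:K * h), c => /=; rewrite eN; split.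
- by split=> //; [case: fphi | case: fpsi].
- split; rewrite ?mulf_neq0 ?fmorph_eq0 // nrmM nrm_cst //.
    by rewrite -rmorphXn /= eal ega -rmorphM mulVf ?rmorph1.
  by rewrite -rmorphXn /= ebe egb -rmorphM mulVf ?rmorph1.
- rewrite !rmorphM fphi.1 fpsi.1.
  transitivity (al%:K * be%:K * (g * phi h)); first by ring.
  by rewrite ec -/g -/h; ring.
have q0 : q != 0 by exact: x_sub_neq0.
(* Otherwise phi is an involution, and its even power phi^N = tau1 is the
   identity. *)
have Xe2 : X - e2 != 0.
  rewrite subr_eq0; apply/eqP => Xe; move: (tphi); rewrite Xe => -[oe fe pxe pye].
  have /eqP Y0 : Y == 0.
    by rewrite -sqrf_eq0 oe -[X in _ == X](on_root oe2).
  have te : translation phi e2 0 by rewrite -Y0.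
  have := translation_order2_neq_id t1; rewrite -h1 /N expnS mul2n -hpow_comp2.
  rewrite (@eq_hpow _ idfun); last by move=> u; apply: (translation_order2 te).2.
  by move=> /negP[]; apply/eqP; elim: (2 ^ m)%N => //= j ->.
have [sg esg] := closed_nth_root (X - e2) (isT : 0 < 2)%N.
have sg0 : sg%:K != 0 by rewrite fmorph_eq0 -sqrf_eq0 esg.
pose w := (Y%:K + slope X Y * (e2%:K - X%:K)) / (q * sg%:K).
have ew : w ^+ 2 = phi q / q.
  rewrite expr_div_n -(translate_sub_root tphi oe2) -/q exprMn -rmorphXn esg.
  rewrite rmorphB expr2; field.
  by rewrite q0 -rmorphB fmorph_eq0.
clearbody w.
have w0 : w != 0 by rewrite -sqrf_eq0 ew mulf_neq0 ?invr_eq0 ?fmorph_eq0.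
have Nw : nrm phi N.*2 w = -1.
  by rewrite -mul2n -expnS (sqrt_norm fphi t1 h1).
pose p := x - X%:K; pose r := tau2 p / p.
have p0 : p != 0 by exact: x_sub_neq0.
have [_ ft2 _ _] := t2.
have er : phi r ^+ 2 = (phi w / w) ^+ 2.
  have nq : neg q = q by rewrite /q rmorphB neg_x negC.
  have e : phi (tau2 p) ^+ 2 * phi q ^+ 2 = phi p ^+ 2 * (phi (phi q) * q).
    have e0 : tau2 p ^+ 2 * q ^+ 2 = p ^+ 2 * (phi q * neg (phi q)).
      exact: (translate_sub_root_neg tphi t2).
    transitivity (phi (tau2 p ^+ 2 * q ^+ 2)).
      by rewrite rmorphM !rmorphXn.
    by rewrite e0 rmorphM rmorphXn (rmorphM _ (phi q)) (flow_negr q fphi) nq.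
  rewrite [phi r]fmorph_div !expr_div_n -[phi w ^+ 2]rmorphXn ew fmorph_div /=.
  apply: (mulIf (expf_neq0 2 (_ : phi q * phi p != 0))).
    by rewrite mulf_neq0 ?fmorph_eq0.
  transitivity (phi (tau2 p) ^+ 2 * phi q ^+ 2).
    by field; rewrite fmorph_eq0.
  by rewrite e; field; rewrite q0 !fmorph_eq0.
have [ka [eka ka2]] : exists ka, phi r = ka%:K * (phi w / w) /\ ka ^+ 2 = 1.
  move/eqP: er; rewrite eqf_sqr => /orP[] /eqP ->.
    by exists 1; rewrite rmorph1 mul1r expr1n.
  by exists (-1); rewrite rmorphN rmorph1 mulN1r sqrrN expr1n.
(* The sign ka occurs with the exponent 0 + 1 + ... + (n - 1), which is even
   because 4 divides n. *)
have etg : tau2 g / g = nrm phi N.*2 w / w ^+ N.*2.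
  rewrite /g /miller rmorph_prod -prodf_div.
  transitivity (\prod_(i < N.*2) (ka%:K ^+ i * (hpow phi i w / w))).
    apply: eq_bigr => i _; rewrite rmorph_prod -prodf_div.
    rewrite -(nrm_telescope _ _ w0) -(nrm_cst _ _ fphi) -nrmM -eka.
    apply: eq_bigr => j _.
    by rewrite -hpowSr (hpow_comm j.+1 fphi ft2) -fmorph_div.
  rewrite big_split /= prodrXr.
  have -> : (\sum_(i < N.*2) i = 2 * (2 ^ m * (N.*2).-1))%N.
    rewrite -(big_mkord xpredT id) bin2_sum bin2 -mul2n -mulnA mul2n doubleK.
    by rewrite /N expnS -mulnA.
  rewrite exprM -rmorphXn ka2 rmorph1 expr1n mul1r.
  by rewrite prodf_div prodr_const card_ord.
have [et eet eH] := half_norm tpsi t2 h2; rewrite -/h in eH.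
set H := nrm psi N h in eH.
have H0 : H != 0 by exact: nrm_neq0.
have epH : phi H / H = (w ^+ N.*2)^-1.
  rewrite eH rmorphM fphi.1 rmorphXn fmorphV -mul2n exprM ew !exprVn expr_div_n.
  by field; rewrite ?expf_neq0 ?fmorph_eq0.
have : nrm psi N (g * phi h) = nrm psi N (c%:K * (h * psi g)) by rewrite ec.
rewrite !nrmM nrm_cst // (nrm_comm _ _ fpsi fphi) -/H.
have -> : nrm psi N (psi g) = nrm psi N g * (tau2 g / g).
  rewrite -h2 -(nrm_telescope _ _ g0) -nrmM; congr (nrm _ _ _).
  by rewrite mulrC divfK.
rewrite etg Nw => e.
apply: (fmorph_inj iota); rewrite rmorphXn rmorphN rmorph1.
have Ng0 : nrm psi N g != 0 by exact: nrm_neq0.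
have wN0 : w ^+ N.*2 != 0 by exact: expf_neq0.
have ephi : phi H = H / w ^+ N.*2 by rewrite -epH mulrC divfK.
move: e; rewrite ephi => e.
have wN0' : (w ^+ N.*2)^-1 != 0 by rewrite invr_eq0.
apply: (mulfI (mulf_neq0 (mulf_neq0 H0 Ng0) wN0')).
apply: (@oppr_inj _); rewrite mulrN1 opprK.
transitivity (nrm psi N g * (H / w ^+ N.*2)); last by ring.
by rewrite e; ring.
Qed.

End TwoTorsion.
End Translations.

(** * The construction on the function field *)

Section Operators.
Variables (k : closedFieldType) (a b e1 e2 : k).
Hypothesis hk : [pchar k] =i pred0.
Variable K : fraction_field (coord_ring a b).
Hypothesis nonsing : forall X, X ^+ 3 + a * X + b = 0 -> 3 * X ^+ 2 + a != 0.
Hypothesis e1_root : e1 ^+ 3 + a * e1 + b = 0.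
Hypothesis e2_root : e2 ^+ 3 + a * e2 + b = 0.
Hypothesis e12 : e1 != e2.

Lemma negation_exists : exists neg : {rmorphism K -> K},
  [/\ forall c, neg (fcst K c) = fcst K c, neg (fx K) = fx K & neg (fy K) = - fy K].
Proof.
have [|neg [nC nx ny _]] := hom_of_point (Y := - fy K) _ (fx_nconst K).
  by rewrite sqrrN fxy.
by exists neg.
Qed.

Lemma heisenberg_exists m : exists (phi psi : {rmorphism K -> K}) g h c,
  let n := (2 ^ m.+2)%N in
  [/\ [/\ forall c, phi (fcst K c) = fcst K c, forall c, psi (fcst K c) = fcst K c,
          hpow phi n =1 id, hpow psi n =1 id & phi \o psi =1 psi \o phi],
      [/\ g != 0, h != 0, nrm phi n g = 1 & nrm psi n h = 1],
      g * phi h = fcst K c * (h * psi g) & c ^+ (2 ^ m.+1) = -1].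
Proof.
have [neg [nC nx ny]] := negation_exists.
have two0 : 2 != 0 :> K.
  by rewrite -(rmorph_nat (fcst K)) fmorph_eq0 (pchar0_natr hk 1).
apply: (@heisenberg_operators _ _ (fcst K) (fx K) (fy K) a b (@fD _ _ _ K)
   nonsing two0 (fxy K) (fx_nconst K) (@fDD _ _ _ K) (@fDM _ _ _ K)
   (@fD_cst _ _ _ K) (fD_x K) (fD_y K) (@fD_kernel _ _ _ hk K) _ _
   neg nC nx ny e1 e2 _ _ e12).
- by move=> X Y oXY Xn; apply: hom_of_point.
- exact: hom_ext.
- by rewrite expr0n e1_root.
- by rewrite expr0n e2_root.
Qed.

End Operators.

(** * Values of functions at generic points *)

Section GenericPoints.
Variables (k : closedFieldType) (a b : k).
Local Notation R := (coord_ring a b).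
Variable K : fraction_field R.
Local Notation "x %:F" := (ff_emb K x).
Implicit Types (p : k * k) (Q : k * k -> Prop) (z : K) (phi : {rmorphism K -> K}).

(** Truth on the complement of the zeros of one nonzero function.  All the
    computations with values of functions are carried out up to such finite
    exceptions, which makes them consequences of identities in [K]. *)
Definition generic Q := exists v : R, v != 0 /\
  forall p, on_curve a b p -> ev p v != 0 -> Q p.

Lemma generic_mono Q Q' : (forall p, on_curve a b p -> Q p -> Q' p) ->
  generic Q -> generic Q'.
Proof. by move=> h [v [v0 hv]]; exists v; split=> // p op /(hv p op); apply: h. Qed.

Lemma genericI Q Q' : generic Q -> generic Q' -> generic (fun p => Q p /\ Q' p).
Proof.
move=> [v [v0 hv]] [w [w0 hw]]; exists (v * w); rewrite mulf_neq0 //; split=> //.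
move=> p op; rewrite evM // mulf_eq0 negb_or => /andP[pv pw].
by split; [exact: hv | exact: hw].
Qed.

Lemma generic2 Q1 Q2 Q : (forall p, on_curve a b p -> Q1 p -> Q2 p -> Q p) ->
  generic Q1 -> generic Q2 -> generic Q.
Proof.
move=> h h1 h2; apply: generic_mono (genericI h1 h2) => p op [].
exact: h.
Qed.

Lemma generic_ev_neq0 (v : R) : v != 0 -> generic (fun p => ev p v != 0).
Proof. by move=> v0; exists v. Qed.

(** The value of a function at a point, computed from a chosen fraction; it is
    meaningful outside the zeros of the denominator. *)
Definition fev p z : k := ev p (num z) / ev p (den z).

Lemma fevE n d : d != 0 -> generic (fun p => fev p (n%:F / d%:F) = ev p n / ev p d).
Proof.
move=> d0; set z := _ / _; have dz0 : den z != 0 := den_neq0 z.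
apply: generic2 (generic_ev_neq0 d0) (generic_ev_neq0 dz0) => p op pd pz.
apply/eqP; rewrite /fev eqr_div // -!evM //; apply/eqP; congr (ev _ _).
by apply: (frac_eq (K := K)); rewrite // -num_den.
Qed.

Lemma fev_emb n : generic (fun p => fev p n%:F = ev p n).
Proof.
apply: generic_mono (fevE n (oner_neq0 _)) => p op.
by rewrite rmorph1 divr1 ev1 divr1.
Qed.

Lemma fev_cst c : generic (fun p => fev p (fcst K c) = c).
Proof.
apply: generic_mono (fev_emb (emb a b c%:P)) => p op; rewrite fcstE => ->.
by rewrite /ev /= hornerC horner0 mul0r addr0.
Qed.

Lemma fevD z z' : generic (fun p => fev p (z + z') = fev p z + fev p z').
Proof.
have d0 := den_neq0 z; have d'0 := den_neq0 z'.
have e : z + z' = (num z * den z' + num z' * den z)%:F / (den z * den z')%:F.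
  by rewrite {1}(num_den z) {1}(num_den z') addf_div ?den_frac_neq0 // rmorphD !rmorphM.
rewrite e; apply: generic2 (genericI (generic_ev_neq0 d0) (generic_ev_neq0 d'0))
  (fevE (num z * den z' + num z' * den z) (mulf_neq0 d0 d'0)) => p op [p1 p2] ->.
by rewrite /fev evD !evM // addf_div.
Qed.

Lemma fevM z z' : generic (fun p => fev p (z * z') = fev p z * fev p z').
Proof.
have d0 := den_neq0 z; have d'0 := den_neq0 z'.
have e : z * z' = (num z * num z')%:F / (den z * den z')%:F.
  by rewrite {1}(num_den z) {1}(num_den z') mulf_div !rmorphM.
rewrite e; apply: generic_mono (fevE (num z * num z') (mulf_neq0 d0 d'0)) => p op ->.
by rewrite /fev !evM // mulf_div.
Qed.

Lemma fev_neq0 z : z != 0 -> generic (fun p => fev p z != 0).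
Proof.
move=> z0; have n0 : num z != 0.
  by apply: contra z0 => /eqP n0; rewrite (num_den z) n0 rmorph0 mul0r.
apply: generic2 (generic_ev_neq0 n0) (generic_ev_neq0 (den_neq0 z)) => p _ p1 p2.
by rewrite /fev mulf_neq0 ?invr_eq0.
Qed.

(** The rational self-map of the curve whose action on functions is phi. *)
Definition rmap phi p : k * k := (fev p (phi (fx K)), fev p (phi (fy K))).

Section Hom.
Variable phi : {rmorphism K -> K}.
Hypothesis phiC : forall c, phi (fcst K c) = fcst K c.

Lemma fev_pev A : generic (fun p => fev p (phi (emb a b A)%:F) = A.[(rmap phi p).1]).
Proof.
elim/poly_ind: A => [|A c IHA].
  have -> : phi (emb a b 0)%:F = fcst K 0 by rewrite !rmorph0.
  by apply: generic_mono (fev_cst 0) => p op ->; rewrite horner0.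
have -> : phi (emb a b (A * 'X + c%:P))%:F = phi (emb a b A)%:F * phi (fx K) + fcst K c.
  by rewrite 2!rmorphD -phiC -fcstE [phi (_ + _)]rmorphD; congr (_ + _); rewrite !rmorphM.
have h := genericI (fev_cst c) (genericI IHA (fevM (phi (emb a b A)%:F) (phi (fx K)))).
apply: generic2 (fevD (phi (emb a b A)%:F * phi (fx K)) (fcst K c)) h => p op -> [-> [eA ->]].
by rewrite eA hornerMXaddC.
Qed.

Lemma fev_hom_emb n : generic (fun p => fev p (phi n%:F) = ev (rmap phi p) n).
Proof.
rewrite (coord_ring_split n) rmorphD rmorphM [phi (_ + _)]rmorphD [phi (_ * _)]rmorphM.
have h := genericI (fev_pev n.1) (genericI (fev_pev n.2)
   (fevM (phi (emb a b n.2)%:F) (phi (fy K)))).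
apply: generic2 (fevD (phi (emb a b n.1)%:F) (phi (emb a b n.2)%:F * phi (fy K))) h.
move=> p op -> [-> [e2 ->]]; rewrite e2 -coord_ring_split.
by [].
Qed.

Lemma rmap_on_curve : generic (fun p => on_curve a b (rmap phi p)).
Proof.
pose w : R := coord_y a b ^+ 2 - emb a b (cubic a b).
have w0 : w = 0 by rewrite /w coord_yy subrr.
have h := genericI (fev_hom_emb (coord_y a b)) (fev_pev (cubic a b)).
have eyy : phi (emb a b (cubic a b))%:F = phi (fy K) * phi (fy K).
  by rewrite -coord_yy expr2 !rmorphM.
apply: generic2 (fevM (phi (fy K)) (phi (fy K))) h => p op.
by rewrite -eyy => h2 [_ h3]; rewrite /on_curve expr2 -cubicE -h3 h2.
Qed.

(** Evaluation turns phi into composition with [rmap]: the identity holds for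
    x and y by definition, and for other functions since both sides are
    generically compatible with the field operations. *)
Lemma fev_hom z : generic (fun p => fev p (phi z) = fev (rmap phi p) z).
Proof.
have d0 : phi (den z)%:F != 0 by rewrite fmorph_eq0 den_frac_neq0.
have e : phi (num z)%:F = phi z * phi (den z)%:F.
  by rewrite -rmorphM {2}(num_den z) divfK ?den_frac_neq0.
have h := genericI (fev_hom_emb (num z)) (genericI (fev_hom_emb (den z))
   (genericI (fev_neq0 d0) (fevM (phi z) (phi (den z)%:F)))).
apply: generic_mono h => p op; rewrite -e => -[h1 [h2 [h3 h4]]].
by rewrite {2}/fev -h1 -h2 h4 mulfK.
Qed.

(** The preimage of a generic set is generic because phi, being injective,
    maps the nonzero function that describes it to a nonzero function. *)
Lemma generic_rmap Q : generic Q -> generic (fun p => Q (rmap phi p)).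
Proof.
move=> [v [v0 hv]].
have pv0 : phi v%:F != 0 by rewrite fmorph_eq0 ff_eq0.
have h := genericI (fev_hom_emb v) (genericI (fev_neq0 pv0) rmap_on_curve).
apply: generic_mono h => p op [h1 [h2 h3]]; apply: hv => //.
by rewrite -h1.
Qed.

End Hom.

Lemma rmap_comp (phi psi : {rmorphism K -> K}) :
  (forall c, phi (fcst K c) = fcst K c) ->
  (forall c, psi (fcst K c) = fcst K c) ->
  generic (fun p => rmap phi (rmap psi p) = rmap (psi \o phi) p).
Proof.
move=> pC qC; apply: generic2 (fev_hom qC (phi (fx K))) (fev_hom qC (phi (fy K))).
by move=> p op h1 h2; rewrite /rmap /= h1 h2.
Qed.

Lemma rmap_id (phi : {rmorphism K -> K}) : phi =1 id ->
  generic (fun p => rmap phi p = p).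
Proof.
move=> pid; apply: generic2 (fev_emb (coord_x a b)) (fev_emb (coord_y a b)) => p op h1 h2.
rewrite /rmap !pid [fev p (fx K)]h1 [fev p (fy K)]h2 /ev /=.
by rewrite hornerX !hornerC !mul0r addr0 add0r mul1r -surjective_pairing.
Qed.

End GenericPoints.

Local Open Scope classical_set_scope.

(** * Regular functions and morphisms *)

Section RegularFunctions.
Variables (k : fieldType) (X : funSpaceType k).
Implicit Type x : X.

Lemma regular_atN (f : X -> k) x :
  regular_at f x -> regular_at (fun y => - f y) x.
Proof.
move=> rf; have := regular_atM _ _ _ (regular_at_cst (-1) x) rf.
by under eq_fun do rewrite mulN1r.
Qed.

Lemma regular_at_sum (I : eqType) (r : seq I) (F : I -> X -> k) x :
  {in r, forall i, regular_at (F i) x} ->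
  regular_at (fun y => \sum_(i <- r) F i y) x.
Proof.
elim: r => [|i r IHr] h.
  under eq_fun do rewrite big_nil; exact: regular_at_cst.
under eq_fun do rewrite big_cons.
apply: (regular_atD (F i) (fun y => \sum_(j <- r) F j y)).
  by apply: h; rewrite mem_head.
by apply: IHr => j jr; apply: h; rewrite inE jr orbT.
Qed.

Lemma regular_atX (f : X -> k) n x :
  regular_at f x -> regular_at (fun y => f y ^+ n) x.
Proof.
move=> rf; elim: n => [|n IHn].
  under eq_fun do rewrite expr0; exact: regular_at_cst.
under eq_fun do rewrite exprS; exact: (regular_atM f).
Qed.

Lemma regular_at_prod (I : eqType) (r : seq I) (F : I -> X -> k) x :
  {in r, forall i, regular_at (F i) x} ->
  regular_at (fun y => \prod_(i <- r) F i y) x.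
Proof.
elim: r => [|i r IHr] h.
  under eq_fun do rewrite big_nil; exact: regular_at_cst.
under eq_fun do rewrite big_cons.
apply: (regular_atM (F i) (fun y => \prod_(j <- r) F j y)).
  by apply: h; rewrite mem_head.
by apply: IHr => j jr; apply: h; rewrite inE jr orbT.
Qed.

Lemma regular_at_div (f g : X -> k) x : regular_at f x -> regular_at g x ->
  g x != 0 -> regular_at (fun y => f y / g y) x.
Proof.
move=> rf rg gx; apply: (regular_atM f (fun y => (g y)^-1)) => //.
exact: regular_atV.
Qed.

Lemma regular_at_meval n (p : {mpoly k[n]}) (u : 'I_n -> X -> k) x :
  (forall i, regular_at (u i) x) ->
  regular_at (fun y => p.@[fun i => u i y]) x.
Proof.
move=> ru; under eq_fun do rewrite mevalE.
apply: regular_at_sum => m _.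
apply: (regular_atM (fun=> p@_m) (fun y => \prod_i u i y ^+ m i)).
  exact: regular_at_cst.
by apply: regular_at_prod => i _; apply: regular_atX.
Qed.

Lemma regular_at_horner (A : {poly k}) (f : X -> k) x :
  regular_at f x -> regular_at (fun y => A.[f y]) x.
Proof.
move=> rf; under eq_fun do rewrite horner_coef.
apply: regular_at_sum => i _.
apply: (regular_atM (fun=> A`_i) (fun y => f y ^+ i)); first exact: regular_at_cst.
exact: regular_atX.
Qed.

End RegularFunctions.

Section Morphisms.
Variable k : fieldType.

Definition morphism_at (X Y : funSpaceType k) (f : X -> Y) (x : X) : Prop :=
  {for x, continuous f} /\
  forall h : Y -> k, regular_at h (f x) -> regular_at (h \o f) x.

Variable X : funSpaceType k.
Implicit Type x : X.

Lemma dhomog_meval_scale n (d : nat) (p : {mpoly k[n]}) (c : k) (v : 'I_n -> k) :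
  p \is d.-homog -> p.@[fun i => c * v i] = c ^+ d * p.@[v].
Proof.
move=> /dhomogP hp; rewrite !mevalE mulr_sumr !big_seq; apply: eq_bigr => m mp.
rewrite mulrCA; congr (_ * _).
under eq_bigr => i _ do rewrite exprMn.
by rewrite big_split /= -expr_sum -(hp m mp) /= mdegE.
Qed.

(** Maps to a projective space are given by regular functions that are
    proportional to the homogeneous coordinates of the image: for forms, the
    unknown factor only contributes its power, which cancels in quotients. *)
Lemma proj_morphism_at n (f : X -> proj_space k n) (u : 'I_n.+1 -> X -> k) x :
  (forall i, regular_at (u i) x) ->
  (\forall y \near x, exists2 c, c != 0 & forall i, u i y = c * hcoord (f y) i) ->
  morphism_at f x.
Proof.
move=> ru fu.
have eu d (p : {mpoly k[n.+1]}) : p \is d.-homog ->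
    \forall y \near x, exists2 c, c != 0 & p.@[fun i => u i y] = c * p.@[hcoord (f y)].
  move=> hp; apply: filterS fu => y [c c0 e]; exists (c ^+ d); first exact: expf_neq0.
  by rewrite -dhomog_meval_scale //; apply: meval_eq.
have cont : {for x, continuous f}.
  move=> V; rewrite nbhsE /= => -[W [[S hS eW] Wx] WV].
  move: Wx; rewrite eW => /existsNP[p /not_implyP[Sp px]].
  have [d hp] := hS p Sp.
  have rp := regular_at_meval p ru.
  have pu : p.@[fun i => u i x] != 0.
    have [c c0 ->] := nbhs_singleton (eu d p hp).
    by rewrite mulf_neq0 //; apply/eqP.
  apply: filterS2 (regular_at_neq0 _ _ rp pu) (eu d p hp) => y py [c c0 e].
  apply: WV; rewrite eW => /(_ p Sp) h.
  by move: py; rewrite e h mulr0 eqxx.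
split=> // h [d [p [q [hp hq qx hpq]]]].
have {}hpq : \forall y \near x, h (f y) = p.@[hcoord (f y)] / q.@[hcoord (f y)].
  exact: (cont _ hpq).
apply: (@eq_near_regular_at _ _
  (fun y => p.@[fun i => u i y] / q.@[fun i => u i y])).
  apply: filterS2 hpq fu => y hy [c c0 e]; rewrite /= hy.
  have eq r : r \is d.-homog -> r.@[fun i => u i y] = c ^+ d * r.@[hcoord (f y)].
    by move=> hr; rewrite -dhomog_meval_scale //; apply: meval_eq.
  by rewrite !eq // -mulf_div divff ?mul1r // expf_neq0.
apply: regular_at_div; try exact: regular_at_meval.
have [c c0 ->] := nbhs_singleton (eu d q hq).
by rewrite mulf_neq0.
Qed.

Lemma sub_morphism_at (Y : funSpaceType k) (A : set Y) (f : X -> A) x :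
  morphism_at (set_val \o f : X -> Y) x -> morphism_at f x.
Proof.
move=> [cf rf]; have cont : {for x, continuous f}.
  move=> V; rewrite nbhsE /= => -[W [[B oB eW] Wx] WV].
  have Bx : B (set_val (f x)) by move: Wx; rewrite -eW.
  have := cf B (open_nbhs_nbhs (conj oB Bx)); rewrite nbhs_simpl /=.
  by apply: filterS => y By; apply: WV; rewrite -eW.
split=> // h [F /rf rF hF]; apply: eq_near_regular_at rF.
have {}hF : \forall y \near x, h (f y) = F (set_val (f y)) by exact: (cont _ hF).
by apply: filterS hF => y hy; rewrite /= hy.
Qed.

Lemma prod_morphism_at (Y Z : funSpaceType k) (f : X -> Y) (g : X -> Z) x :
  morphism_at f x -> morphism_at g x ->
  morphism_at (Y := prod_variety Y Z) (fun y => (f y, g y)) x.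
Proof.
move=> [cf rf] [cg rg]; pose fg : X -> prod_variety Y Z := fun y => (f y, g y).
rewrite -/fg.
have rt s : tensor_regular s (fg x) -> regular_at (tensor s \o fg) x.
  move=> rs; rewrite /tensor /comp /=.
  apply: (@regular_at_sum _ _ _ s (fun p y => p.1 (f y) * p.2 (g y))) => p ps.
  have [/rf r1 /rg r2] := rs p ps.
  exact: (regular_atM _ _ _ r1 r2).
have cont : {for x, continuous fg}.
  move=> V; rewrite nbhsE /= => -[W [oW Wx] WV].
  have [U1 [V1 [s [[oU Ux] [oV Vx] sx hs]]]] := (oW : prod_variety_open W) _ Wx.
  have /rt rs : tensor_regular s (fg x) by have [] := hs _ Ux Vx.
  have nU : \forall y \near x, U1 (f y) := cf _ (open_nbhs_nbhs (conj oU Ux)).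
  have nV : \forall y \near x, V1 (g y) := cg _ (open_nbhs_nbhs (conj oV Vx)).
  apply: filterS3 nU nV (regular_at_neq0 _ _ rs sx) => y Uy Vy sy.
  by apply: WV; have [_] := hs (fg y) Uy Vy; apply.
split=> // h [s [t [/rt rs /rt rt' tx hst]]].
have {}hst : \forall y \near x, h (fg y) = tensor s (fg y) / tensor t (fg y).
  exact: (cont _ hst).
apply: (eq_near_regular_at _ _ _ _ (regular_at_div rs rt' tx)).
by apply: filterS hst => y hy; rewrite /= hy.
Qed.

Lemma regular_at_fst (Y : funSpaceType k) (h : X -> k) (z : prod_variety X Y) :
  regular_at h z.1 -> regular_at (fun z' : prod_variety X Y => h z'.1) z.
Proof.
move=> rh; exists [:: (h, fun=> 1)], (tensor_cst X Y 1); split.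
- by move=> p; rewrite inE => /eqP ->; split=> //; exact: regular_at_cst.
- exact: tensor_cst_regular.
- by rewrite tensor_cstE oner_neq0.
- by apply: (@nearW _ (nbhs z)) => y; rewrite tensor_cstE /tensor big_seq1 mulr1 divr1.
Qed.

Lemma regular_at_snd (Y : funSpaceType k) (h : Y -> k) (z : prod_variety X Y) :
  regular_at h z.2 -> regular_at (fun z' : prod_variety X Y => h z'.2) z.
Proof.
move=> rh; exists [:: (fun=> 1, h)], (tensor_cst X Y 1); split.
- by move=> p; rewrite inE => /eqP ->; split=> //; exact: regular_at_cst.
- exact: tensor_cst_regular.
- by rewrite tensor_cstE oner_neq0.
- by apply: (@nearW _ (nbhs z)) => y; rewrite tensor_cstE /tensor big_seq1 mul1r divr1.
Qed.

Lemma regular_at_val (A : set X) (h : X -> k) (y : A) :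
  regular_at h (set_val y) -> regular_at (fun y' : A => h (set_val y')) y.
Proof. by move=> rh; exists h => //; apply: (@nearW _ (nbhs y)). Qed.

Lemma open_near (S : set X) :
  (forall x, S x -> \forall y \near x, S y) -> open S.
Proof. by move=> h; rewrite openE => x Sx; apply: h. Qed.

(** A basic open subset of the product is not a rectangle: it is the locus in
    a rectangle where a tensor does not vanish.  Freezing one coordinate at a
    time reduces to open subsets of the factors. *)
Lemma dense_prod (Y : funSpaceType k) (S : set X) (T : set Y) :
  dense S -> dense T -> dense [set z : prod_variety X Y | S z.1 /\ T z.2].
Proof.
move=> dS dT O [z Oz] oO.
have [U [V [s [[oU Uz] [oV Vz] sz hs]]]] := (oO : prod_variety_open O) z Oz.
have [rs _] := hs z Uz Vz.
have r1 : regular_at (fun x => tensor s ((x, z.2) : prod_variety X Y)) z.1.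
  apply: (@regular_at_sum _ _ _ s (fun p x => p.1 x * p.2 z.2)) => p ps.
  have [r1 _] := rs p ps.
  exact: (regular_atM _ _ _ r1 (regular_at_cst (p.2 z.2) _)).
have : nbhs z.1 (U `&` [set x | tensor s ((x, z.2) : prod_variety X Y) != 0]).
  apply: filterI; first exact: open_nbhs_nbhs.
  by apply: (regular_at_neq0 _ _ r1).
rewrite nbhsE => -[W [oW Wz] WU].
have [x [/WU[Ux sx] Sx]] := dS W (ex_intro _ _ Wz) oW.
have [rs' _] := hs (x, z.2) Ux Vz.
have r2 : regular_at (fun y => tensor s ((x, y) : prod_variety X Y)) z.2.
  apply: (@regular_at_sum _ _ _ s (fun p y => p.1 x * p.2 y)) => p ps.
  have [_ r2] := rs' p ps.
  exact: (regular_atM _ _ _ (regular_at_cst (p.1 x) _) r2).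
have : nbhs z.2 (V `&` [set y | tensor s ((x, y) : prod_variety X Y) != 0]).
  apply: filterI; first exact: open_nbhs_nbhs.
  by apply: (regular_at_neq0 _ _ r2).
rewrite nbhsE => -[W' [oW' Wz'] WV].
have [y [/WV[Vy sy] Ty]] := dT W' (ex_intro _ _ Wz') oW'.
by exists (x, y); split=> //; have [_] := hs (x, y) Ux Vy; apply.
Qed.

End Morphisms.

(** * Points of projective space *)

Section ProjectivePoints.
Variables (k : fieldType) (n : nat).
Implicit Types (x y : proj_space k n) (v : 'rV[k]_n.+1).

Lemma proj_line0_subproof : \dim <[delta_mx 0 0 : 'rV[k]_n.+1]> == 1%N.
Proof.
rewrite dim_vline eqb1; apply/eqP => /matrixP/(_ 0 0)/eqP.
by rewrite !mxE !eqxx /= oner_eq0.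
Qed.

(** As the zero vector spans no line, it is sent to an arbitrary point. *)
Definition proj_of v : proj_space k n :=
  insubd (exist (fun L : {vspace 'rV[k]_n.+1} => \dim L == 1%N) _
                proj_line0_subproof) <[v]>%VS.

Lemma proj_ofE v : v != 0 -> val (proj_of v) = <[v]>%VS.
Proof. by move=> v0; rewrite /proj_of insubdK // -topredE /= dim_vline v0. Qed.

Lemma proj_line x : val x = <[vpick (val x)]>%VS.
Proof.
apply/esym/eqP; rewrite eqEdim -memvE memv_pick dim_vline vpick0.
by case: x => L /= /eqP hL; rewrite hL -dimv_eq0 hL.
Qed.

Lemma hcoord_proj_of v : v != 0 ->
  exists2 c, c != 0 & forall i, hcoord (proj_of v) i = c * v 0 i.
Proof.
move=> v0; have : vpick (val (proj_of v)) \in <[v]>%VS.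
  by rewrite -(proj_ofE v0) memv_pick.
move=> /vlineP[c e]; exists c; last by move=> i; rewrite /hcoord e mxE.
apply/eqP => c0; move/eqP: e; rewrite c0 scale0r vpick0 proj_ofE //.
by rewrite -dimv_eq0 dim_vline v0.
Qed.

Lemma proj_eq x y c : c != 0 -> (forall i, hcoord x i = c * hcoord y i) -> x = y.
Proof.
move=> c0 h; apply: val_inj; rewrite (proj_line x) (proj_line y).
have -> : vpick (val x) = c *: vpick (val y).
  by apply/rowP => i; rewrite mxE; exact: h.
apply/eqP; rewrite eqEdim -memvE memvZ ?memv_line // !dim_vline scaler_eq0.
by rewrite (negbTE c0) leqnn.
Qed.

Definition hvec (s : seq k) : 'rV[k]_n.+1 := \row_i s`_i.

End ProjectivePoints.

Section AffineLine.
Variable k : closedFieldType.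

Definition aff1 (l : proj_space k 1) : k := hcoord l 0 / hcoord l 1.
Definition pt1 (t : k) : proj_space k 1 := proj_of (hvec 1 [:: t; 1]).

Lemma hvec1_neq0 t : hvec 1 [:: t; 1] != 0 :> 'rV[k]_2.
Proof. by apply/eqP => /matrixP/(_ 0 1)/eqP; rewrite !mxE /= oner_eq0. Qed.

Lemma pt1_hcoord t : hcoord (pt1 t) 1 != 0.
Proof.
have [c c0 e] := hcoord_proj_of (hvec1_neq0 t).
by rewrite e mxE /= mulr1.
Qed.

Lemma aff1K t : aff1 (pt1 t) = t.
Proof.
have [c c0 e] := hcoord_proj_of (hvec1_neq0 t).
by rewrite /aff1 !e !mxE /= mulr1 mulrAC divff ?mul1r.
Qed.

Lemma pt1K l : hcoord l 1 != 0 -> pt1 (aff1 l) = l.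
Proof.
move=> l1; have [c c0 e] := hcoord_proj_of (hvec1_neq0 (aff1 l)).
apply: (@proj_eq _ _ _ _ (c / hcoord l 1)); first by rewrite mulf_neq0 ?invr_eq0.
move=> i; rewrite e mxE.
have [->|->] : i = 0 \/ i = 1.
  by case: i => -[|[|//]] h; [left | right]; exact: val_inj.
- by rewrite /= /aff1 mulrA mulrAC.
- by rewrite /= mulr1 divfK.
Qed.

Lemma regular_at_hcoord_div n (x : proj_space k n) i j : hcoord x j != 0 ->
  regular_at (fun y : proj_space k n => hcoord y i / hcoord y j) x.
Proof.
move=> xj; exists 1%N, 'X_i, 'X_j; split.
- by rewrite dhomogX /= mdeg1.
- by rewrite dhomogX /= mdeg1.
- by rewrite mevalXU.
by apply: (@nearW _ (nbhs x)) => y; rewrite !mevalXU.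
Qed.

Lemma near_hcoord_neq0 n (x : proj_space k n) j : hcoord x j != 0 ->
  \forall y \near x, hcoord y j != 0.
Proof.
move=> xj; have h : ('X_j : {mpoly k[n.+1]}) \is 1.-homog by rewrite dhomogX /= mdeg1.
have := @proj_near_neq0 _ _ _ _ x h; rewrite mevalXU => /(_ xj).
by apply: filterS => y; rewrite mevalXU.
Qed.

Lemma poly_nonroot (A : {poly k}) : A != 0 -> exists t, A.[t] != 0.
Proof.
move=> A0; have [sA|sA] := eqVneq (size A) 1%N.
  exists 0; have /size1_polyC eA := eq_leq sA; move: A0; rewrite eA hornerC.
  by rewrite polyC_eq0.
have /closed_rootP[t /rootP rt] : size (A - 1) != 1%N.
  rewrite size_polyDl ?size_polyN ?size_poly1 // ltn_neqAle eq_sym sA.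
  by rewrite size_poly_gt0.
exists t; move: rt; rewrite !hornerE => /eqP; rewrite subr_eq0 => /eqP ->.
exact: oner_neq0.
Qed.

Lemma meval_mmap n (S : comNzRingType) (f : {rmorphism k -> S})
    (e : {rmorphism S -> k}) (h : 'I_n -> S) (p : {mpoly k[n]}) :
  cancel f e -> e (mmap f h p) = p.@[fun i => e (h i)].
Proof.
move=> fK; rewrite mevalE /mmap rmorph_sum; apply: eq_bigr => m _.
rewrite rmorphM fK /mmap1 rmorph_prod; congr (_ * _).
by apply: eq_bigr => i _; rewrite rmorphXn.
Qed.

(** A form that does not vanish at some point of the line is a nonzero
    polynomial in the affine coordinate, or in its inverse when the point is
    at infinity; hence it has a nonzero value at some nonzero t. *)
Lemma dense_aff1 : dense [set l : proj_space k 1 | hcoord l 1 != 0 /\ aff1 l != 0].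
Proof.
move=> O [l Ol] [S hS eO].
move: Ol; rewrite eO => /existsNP[p /not_implyP[Sp /eqP pl]].
have [d hp] := hS p Sp.
suff [t pt] : exists t, p.@[fun i => (hvec 1 [:: t; 1]) 0 i] != 0.
  have {t pt} [t t0 pt] : exists2 t, t != 0 & p.@[fun i => (hvec 1 [:: t; 1]) 0 i] != 0.
    pose q : {poly k} := mmap polyC (fun i : 'I_2 => if i == 0 then 'X else 1) p.
    have eq u : q.[u] = p.@[fun i => (hvec 1 [:: u; 1]) 0 i].
      rewrite -[LHS]/(horner_eval u q) meval_mmap; last by move=> c; exact: hornerC.
      apply: meval_eq => i; rewrite mxE /horner_eval.
      case: eqVneq => [->|]; first by rewrite /= /horner_eval hornerX.
      by case: i => -[|[|//]] h //= _; rewrite /horner_eval -polyC1 hornerC.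
    have q0 : q != 0 by apply: contra pt => /eqP q0; rewrite -eq q0 horner0.
    have [|u] := @poly_nonroot (q * 'X); first by rewrite mulf_neq0 ?polyX_eq0.
    by rewrite hornerM hornerX mulf_eq0 negb_or eq => /andP[? ?]; exists u.
  exists (pt1 t); split; last by rewrite /= aff1K; split=> //; exact: pt1_hcoord.
  move=> /(_ p Sp); have [c c0 e] := hcoord_proj_of (hvec1_neq0 t).
  rewrite (meval_eq _ e) (dhomog_meval_scale _ _ hp) => /eqP.
  by rewrite mulf_eq0 expf_eq0 (negbTE c0) andbF (negbTE pt).
have [l1|l1] := eqVneq (hcoord l 1) 0; last first.
  exists (aff1 l); have [c c0 e] := hcoord_proj_of (hvec1_neq0 (aff1 l)).
  move: pl; rewrite -{1}(pt1K l1) (meval_eq _ e) (dhomog_meval_scale _ _ hp).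
  by rewrite mulf_eq0 negb_or => /andP[].
pose q : {poly k} := mmap polyC (fun i : 'I_2 => if i == 0 then (hcoord l 0)%:P else 'X) p.
have eq t : q.[t] = p.@[fun i : 'I_2 => if i == 0 then hcoord l 0 else t].
  rewrite -[LHS]/(horner_eval t q) meval_mmap; last by move=> c; exact: hornerC.
  by apply: meval_eq => i /=; case: ifP => _; rewrite /horner_eval ?hornerC ?hornerX.
have q0 : q != 0.
  apply: contra pl => /eqP q0; have := eq 0; rewrite q0 horner0 => e0.
  rewrite e0; apply/eqP; apply: meval_eq => i.
  by case: i => -[|[|//]] h'; rewrite -?l1; congr hcoord; exact: val_inj.
have [|t] := @poly_nonroot (q * 'X); first by rewrite mulf_neq0 ?polyX_eq0.
rewrite hornerM hornerX mulf_eq0 negb_or => /andP[qt t0].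
exists (hcoord l 0 / t).
apply: contra qt => /eqP e; rewrite eq.
have -> : p.@[fun i : 'I_2 => if i == 0 then hcoord l 0 else t] =
  t ^+ d * p.@[fun i => (hvec 1 [:: hcoord l 0 / t; 1]) 0 i].
  rewrite -(dhomog_meval_scale _ _ hp); apply: meval_eq => i; rewrite mxE.
  case: i => -[|[|//]] h' /=; rewrite ?mulr1 //.
  by rewrite mulrC divfK.
by rewrite e mulr0.
Qed.

End AffineLine.

(** * The short Weierstrass model of an elliptic curve *)

Section WeierstrassModel.
Variables (k : closedFieldType).
Hypothesis hk : [pchar k] =i pred0.
Variable E : elliptic_curve k.
Local Notation a1 := (ell_a1 E).
Local Notation a2 := (ell_a2 E).
Local Notation a3 := (ell_a3 E).
Local Notation a4 := (ell_a4 E).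
Local Notation a6 := (ell_a6 E).

(** Completing the square and the cube: x' = x + a2'/3 and
    y' = y + (a1 x + a3)/2, with a2' = a2 + a1^2/4. *)
Definition wshift : k := (a2 + a1 ^+ 2 / 4) / 3.
Definition wa : k := a4 + a1 * a3 / 2 - 3 * wshift ^+ 2.
Definition wb : k := 2 * wshift ^+ 3 - (a4 + a1 * a3 / 2) * wshift + (a6 + a3 ^+ 2 / 4).

Let n2 : (2 : k) != 0 := pchar0_natr hk 1.
Let n3 : (3 : k) != 0 := pchar0_natr hk 2.
Let n4 : (4 : k) != 0 := pchar0_natr hk 3.

Lemma ell_polyE (v : 'I_3 -> k) : (ell_poly E).@[v] =
  v 1 ^+ 2 * v 2 + a1 * (v 0 * v 1 * v 2) + a3 * (v 1 * v 2 ^+ 2) -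
  (v 0 ^+ 3 + a2 * (v 0 ^+ 2 * v 2) + a4 * (v 0 * v 2 ^+ 2) + a6 * v 2 ^+ 3).
Proof.
rewrite /ell_poly /weierstrass.
by rewrite !(mevalB, mevalD, mevalZ, mevalM, rmorphXn, mevalXU).
Qed.

Definition affine_coord (p : k * k) : seq k :=
  [:: p.1 - wshift; p.2 - (a1 * (p.1 - wshift) + a3) / 2; 1].
Definition affine_vec p : 'rV[k]_3 := hvec 2 (affine_coord p).

Lemma affine_vec_neq0 p : affine_vec p != 0.
Proof.
by apply/eqP => /matrixP/(_ 0 2)/eqP; rewrite !mxE /= oner_eq0.
Qed.

Lemma ell_poly_affine p : (ell_poly E).@[fun i => affine_vec p 0 i] =
  p.2 ^+ 2 - (p.1 ^+ 3 + wa * p.1 + wb).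
Proof.
rewrite ell_polyE !mxE /= /wa /wb /wshift; field.
by rewrite n2 n3 n4.
Qed.

Lemma ell_poly_homog : ell_poly E \is 3.-homog.
Proof.
rewrite /ell_poly /weierstrass.
have h1 (i : 'I_3) : ('X_i : {mpoly k[3]}) \is 1.-homog by rewrite dhomogX /= mdeg1.
have h2 (i j : 'I_3) : ('X_i * 'X_j : {mpoly k[3]}) \is 2.-homog.
  exact: (@dhomogM _ _ _ 1 _ 1).
have h3 (i j l : 'I_3) : ('X_i * 'X_j * 'X_l : {mpoly k[3]}) \is 3.-homog.
  exact: (@dhomogM _ _ _ 2 _ 1).
rewrite !exprS !expr0 !mulr1 !mulrA.
by rewrite rpredB ?rpredD ?rpredZ ?h3.
Qed.

Definition affine_pt p : proj_space k 2 := proj_of (affine_vec p).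

Lemma hcoord_affine_pt p : exists2 c, c != 0 &
  forall i, hcoord (affine_pt p) i = c * affine_vec p 0 i.
Proof. exact/hcoord_proj_of/affine_vec_neq0. Qed.

Lemma affine_pt_curve p : on_curve wa wb p -> ell_points E (affine_pt p).
Proof.
move=> op; have [c c0 e] := hcoord_affine_pt p; rewrite /ell_points /=.
rewrite (meval_eq _ e) (dhomog_meval_scale _ _ ell_poly_homog) ell_poly_affine.
by rewrite op subrr mulr0.
Qed.

Definition chart (x : proj_space k 2) : k * k :=
  let X := hcoord x 0 / hcoord x 2 in let Y := hcoord x 1 / hcoord x 2 in
  (X + wshift, Y + (a1 * X + a3) / 2).

Lemma affine_vec_chart x i : hcoord x 2 != 0 ->
  affine_vec (chart x) 0 i = hcoord x i / hcoord x 2.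
Proof.
move=> x2; rewrite mxE /= /chart /=.
case: i => -[|[|[|//]]] h /=; rewrite ?addrK.
- by congr (hcoord _ _ / _); exact: val_inj.
- by congr (hcoord _ _ / _); exact: val_inj.
- by rewrite -(divff x2); congr (hcoord _ _ / _); exact: val_inj.
Qed.

Lemma chart_on_curve x : hcoord x 2 != 0 -> ell_points E x ->
  on_curve wa wb (chart x).
Proof.
move=> x2; rewrite /ell_points /= => h.
apply/eqP; rewrite /on_curve -subr_eq0 -ell_poly_affine.
rewrite (meval_eq (v2 := fun i => (hcoord x 2)^-1 * hcoord x i)); last first.
  by move=> i; rewrite affine_vec_chart // mulrC.
by rewrite (dhomog_meval_scale _ _ ell_poly_homog) h mulr0.
Qed.

Lemma chartK x : hcoord x 2 != 0 -> affine_pt (chart x) = x.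
Proof.
move=> x2; have [c c0 e] := hcoord_affine_pt (chart x).
apply: (@proj_eq _ _ _ _ (c / hcoord x 2)); first by rewrite mulf_neq0 ?invr_eq0.
by move=> i; rewrite e affine_vec_chart // mulrA mulrAC.
Qed.

Lemma affine_pt_hcoord2 p : hcoord (affine_pt p) 2 != 0.
Proof.
by have [c c0 e] := hcoord_affine_pt p; rewrite e mxE /= mulr1.
Qed.

Lemma affine_ptK p : chart (affine_pt p) = p.
Proof.
have [c c0 e] := hcoord_affine_pt p; rewrite /chart !e !mxE /= mulr1.
rewrite -!mulrA ![c * (_ / c)]mulrC !divfK // addrNK subrK.
by rewrite -surjective_pairing.
Qed.

Lemma mderivXU n (i j : 'I_n) : ('X_j : {mpoly k[n]})^`M(i) = (j == i)%:R.
Proof.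
rewrite mderivX mnm1E; case: eqVneq => [->|_]; last by rewrite scale0r.
by rewrite scale1r -mpolyX0; congr 'X_[_]; apply/mnmP => l; rewrite mnmBE mnm0E subnn.
Qed.

(** A multiple root of the cubic would be the abscissa of a singular point. *)
Lemma weierstrass_nonsing X : X ^+ 3 + wa * X + wb = 0 -> 3 * X ^+ 2 + wa != 0.
Proof.
move=> rX; apply/eqP => dX.
have oX : on_curve wa wb (X, 0) by rewrite /on_curve rX expr0n.
have [i] := ell_nonsingular (affine_pt_curve oX).
have [c c0 e] := hcoord_affine_pt (X, 0).
move/negP; apply; apply/eqP; rewrite (meval_eq _ e) /ell_poly /weierstrass.
rewrite !(mderivB, mderivD, mderivZ, mderivM, exprS, expr0, mulr1, mderivXU).
rewrite !(mevalB, mevalD, mevalZ, mevalM, mevalXU, rmorph_nat) !mxE /=.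
case: i => -[|[|[|//]]] h /=.
- transitivity (- c ^+ 2 * (3 * X ^+ 2 + wa)); last by rewrite dX mulr0.
  by rewrite /wa /wshift; field; rewrite n2 n3 n4.
- by rewrite /wshift; field; rewrite n2 n3 n4.
- transitivity (c ^+ 2 * ((X - wshift) * (3 * X ^+ 2 + wa) -
                          3 * (X ^+ 3 + wa * X + wb))).
    by rewrite /wb /wa /wshift; field; rewrite n2 n3 n4.
  by rewrite rX dX !mulr0 subrr mulr0.
Qed.

(** The other roots are those of the quotient of the cubic by x - e1; if e1
    were one of them, it would be a multiple root. *)
Lemma weierstrass_two_roots : exists e1 e2, [/\ e1 ^+ 3 + wa * e1 + wb = 0,
  e2 ^+ 3 + wa * e2 + wb = 0 & e1 != e2].
Proof.
have /closed_rootP[e1 /rootP] : size (cubic wa wb) != 1%N by rewrite size_cubic.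
rewrite cubicE => r1.
have [e2] := @solve_monicpoly k 2%N
  (fun i => if i == 0%N then - (e1 ^+ 2 + wa) else - e1) isT.
rewrite !big_ord_recl big_ord0 /= /bump /= expr0 expr1 mulr1 addr0 => r2.
exists e1, e2; split=> //.
  apply/eqP; rewrite -r1 -subr_eq0; apply/eqP.
  transitivity ((e2 - e1) * (e2 ^+ 2 + e1 * e2 + (e1 ^+ 2 + wa))); first by ring.
  by rewrite r2; ring.
apply/eqP => e12; have := weierstrass_nonsing r1; rewrite -e12 in r2.
move/negP; apply; apply/eqP.
transitivity (e1 ^+ 2 + e1 * e1 + (e1 ^+ 2 + wa)); first by ring.
by rewrite {1}r2; ring.
Qed.

Local Notation R := (coord_ring wa wb).

Lemma ev_rmorphism p : on_curve wa wb p ->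
  exists e : {rmorphism R -> k}, e =1 ev p.
Proof.
move=> op.
have eB : zmod_morphism (ev p : R -> k) by move=> u v; exact: evB.
have eM : monoid_morphism (ev p : R -> k).
  by split=> [|u v]; [exact: ev1 | exact: evM].
pose m1 := GRing.isZmodMorphism.Build _ _ (ev p : R -> k) eB.
pose m2 := GRing.isMonoidMorphism.Build _ _ (ev p : R -> k) eM.
pose e : {rmorphism R -> k} := HB.pack (ev p : R -> k) m1 m2.
by exists e.
Qed.

Definition coord_cst : {rmorphism k -> R} := (emb wa wb \o polyC)%FUN.

Definition coord_X : R := emb wa wb ('X - wshift%:P).
Definition coord_Y : R :=
  (- ((a1 / 2)%:P * ('X - wshift%:P) + (a3 / 2)%:P), 1).

(** A form on the projective plane, restricted to the affine curve; [coord_X]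
    and [coord_Y] are the original coordinates in terms of the new ones. *)
Definition dehomog (q : {mpoly k[3]}) : R :=
  mmap coord_cst (fun i : 'I_3 => [:: coord_X; coord_Y; 1]`_i) q.

Lemma ev_dehomog p q : on_curve wa wb p ->
  ev p (dehomog q) = q.@[fun i => affine_vec p 0 i].
Proof.
move=> op; have [e ee] := ev_rmorphism op; rewrite -ee meval_mmap; last first.
  by move=> c; rewrite ee /ev /= hornerC horner0 mul0r addr0.
apply: meval_eq => i; rewrite ee mxE.
case: i => -[|[|[|//]]] h /=.
- by rewrite /ev /= hornerXsubC hornerC mul0r addr0.
- rewrite /ev /= hornerN hornerD hornerM hornerXsubC !hornerC; field.
  exact: n2.
- exact: ev1.
Qed.

Lemma size_norm_X : size (coord_norm coord_X) = 3%N.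
Proof.
by rewrite /coord_norm /= expr0n mulr0 subr0 size_poly_sqr size_XsubC.
Qed.

Lemma size_norm_Y : size (coord_norm coord_Y) = 4%N.
Proof.
rewrite size_coord_norm size_cubic_sqr oner_eq0 size_poly1 size_poly_sqr /=.
apply/maxn_idPr; rewrite size_polyN.
set A := (_ + _); suff: (size A <= 2)%N by case: (size A) => [|[|[|]]].
rewrite (leq_trans (size_polyD _ _)) // geq_max.
rewrite (leq_trans (size_polyC_leq1 _)) // andbT mul_polyC.
by rewrite (leq_trans (size_scale_leq _ _)) // size_XsubC.
Qed.

(** One less than the size of the norm is the order of the pole at the origin
    of the curve, which is bounded by the larger order in a sum. *)
Lemma size_norm_add N (u v : R) : (size (coord_norm u) <= N)%N ->
  (size (coord_norm v) <= N)%N -> (size (coord_norm (u + v)%R) <= N)%N.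
Proof.
rewrite !size_coord_norm !geq_max !size_poly_sqr !size_cubic_sqr.
rewrite -[(u + v).1]/(u.1 + v.1) -[(u + v).2]/(u.2 + v.2).
move=> /andP[u1 u2] /andP[v1 v2]; apply/andP; split.
  have := size_polyD u.1 v.1; rewrite leq_max => /orP[] h.
    by apply: leq_trans u1; rewrite -!subn1 leq_sub2r // leq_double.
  by apply: leq_trans v1; rewrite -!subn1 leq_sub2r // leq_double.
case: eqVneq => // uv0.
have := size_polyD u.2 v.2; rewrite leq_max => /orP[] h.
  case: eqVneq u2 h => [/eqP|_ u2 h].
    by rewrite -size_poly_eq0 => /eqP -> _; rewrite leqn0 size_poly_eq0 (negbTE uv0).
  by apply: leq_trans u2; rewrite !ltnS leq_double.
case: eqVneq v2 h => [/eqP|_ v2 h].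
  by rewrite -size_poly_eq0 => /eqP -> _; rewrite leqn0 size_poly_eq0 (negbTE uv0).
by apply: leq_trans v2; rewrite !ltnS leq_double.
Qed.

Lemma size_norm_sum N (I : eqType) (r : seq I) (P : pred I) (F : I -> R) :
  {in r, forall i, P i -> (size (coord_norm (F i)) <= N)%N} ->
  (size (coord_norm (\sum_(i <- r | P i) F i)%R) <= N)%N.
Proof.
move=> h; rewrite big_seq_cond; elim/big_rec: _ => [|i u /andP[ir Pi] IH].
  have /eqP -> : coord_norm (0 : R) == 0 by rewrite coord_norm_eq0.
  by rewrite size_poly0.
by apply: size_norm_add => //; apply: h.
Qed.

Lemma coord_norm1 : coord_norm (1 : R) = 1.
Proof.
rewrite /coord_norm -[(1 : R).1]/(1 : {poly k}) -[(1 : R).2]/(0 : {poly k}).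
by rewrite expr0n mulr0 subr0 expr1n.
Qed.

Lemma coord_normX (u : R) n : coord_norm (u ^+ n) = coord_norm u ^+ n.
Proof.
elim: n => [|n IHn]; first by rewrite !expr0 coord_norm1.
by rewrite !exprS coord_normM IHn.
Qed.

Lemma size_norm_monomial c i j : c != 0 ->
  size (coord_norm (coord_cst c * (coord_X ^+ i * coord_Y ^+ j))) =
  (2 * i + 3 * j).+1.
Proof.
move=> c0; rewrite !coord_normM !coord_normX.
have -> : coord_norm (coord_cst c) = (c ^+ 2)%:P.
  by rewrite /coord_norm /= expr0n mulr0 subr0 rmorphXn.
have X0 : coord_norm coord_X != 0 by rewrite -size_poly_eq0 size_norm_X.
have Y0 : coord_norm coord_Y != 0 by rewrite -size_poly_eq0 size_norm_Y.
rewrite mul_polyC size_scale ?expf_neq0 // size_mul ?expf_neq0 //.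
have sX n (p : {poly k}) : p != 0 -> size (p ^+ n) = ((size p).-1 * n).+1.
  by move=> p0; rewrite -(ltn_predK (_ : 0 < size (p ^+ n))%N) ?size_exp //
    size_poly_gt0 expf_neq0.
by rewrite !sX // size_norm_X size_norm_Y addSn addnS.
Qed.

Lemma dehomogE q : dehomog q =
  \sum_(m <- msupp q) coord_cst q@_m * (coord_X ^+ m 0 * coord_Y ^+ m 1).
Proof.
rewrite /dehomog /mmap; apply: eq_bigr => m _; congr (_ * _).
rewrite /mmap1 !big_ord_recl big_ord0 /= expr1n !mulr1.
by congr (_ ^+ m _ * _ ^+ m _); exact: val_inj.
Qed.

(** A form of degree d that does not vanish at [0 : 1 : 0] contains the
    monomial Y^d, which has a pole of order 3d on the curve.  The orders
    2i + 3j of the others X^i Y^j Z^l are smaller, so that no cancellation is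
    possible and the form does not vanish identically on the curve.  Thus the
    origin is not an isolated point. *)
Lemma dehomog_neq0 d (q : {mpoly k[3]}) Y : q \is d.-homog ->
  q.@[fun i => [:: 0; Y; 0]`_i] != 0 -> dehomog q != 0.
Proof.
move=> /dhomogP hq qY.
pose m0 : 'X_{1..3} := (U_(1) *+ d)%MM.
have hm m : m \in msupp q -> (m 0%R + m 1%R + m 2%R = d)%N.
  by move=> /hq /= <-; rewrite mdegE !big_ord_recl big_ord0 /= addn0 addnA;
    congr (m _ + m _ + m _)%N; exact: val_inj.
have m0P m : m \in msupp q -> m 0 = 0%N -> m 2 = 0%N -> m = m0.
  move=> /hm + e0 e2; rewrite e0 e2 addn0 add0n => e1.
  apply/mnmP => i; rewrite mulmnE mnm1E.
  case: i => -[|[|[|//]]] h /=.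
  - by rewrite mul0n -[RHS]e0; congr (m _); exact: val_inj.
  - by rewrite mul1n -e1; congr (m _); exact: val_inj.
  - by rewrite mul0n -[RHS]e2; congr (m _); exact: val_inj.
have m0q : m0 \in msupp q.
  apply: contraNT qY => m0q; rewrite mevalE big_seq big1 // => m mq.
  have m0' : m 0 != 0%N \/ m 2 != 0%N.
    have [e0|] := eqVneq (m 0) 0%N; last by left.
    have [e2|] := eqVneq (m 2) 0%N; last by right.
    by move: m0q; rewrite -(m0P m mq e0 e2) mq.
  case: m0' => mi.
    by rewrite (bigD1 0) //= expr0n (negbTE mi) mul0r mulr0.
  by rewrite (bigD1 2) //= expr0n (negbTE mi) mul0r mulr0.
rewrite dehomogE; apply/eqP => e.
have := size_norm_monomial 0 d (_ : q@_m0 != 0); rewrite -mcoeff_msupp => /(_ m0q).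
have m00 : m0 0 = 0%N by rewrite mulmnE mnm1E.
have m01 : m0 1 = d by rewrite mulmnE mnm1E mul1n.
move: e; rewrite (bigD1_seq m0) //= m00 m01 => /eqP; rewrite addr_eq0 => /eqP ->.
rewrite muln0 add0n => sz; suff : ((3 * d).+1 <= 3 * d)%N by rewrite ltnn.
rewrite -[X in (X <= _)%N]sz.
have -> (u : R) : coord_norm (- u) = coord_norm u.
  by rewrite /coord_norm -[(- u).1]/(- u.1) -[(- u).2]/(- u.2) !sqrrN.
apply: size_norm_sum => m mq mm0.
rewrite size_norm_monomial -?mcoeff_msupp //.
have := hm m mq; case e0 : (m 0) => [|i]; last by lia.
case e2 : (m 2) => [|i]; last by lia.
by move: mm0; rewrite (m0P m mq e0 e2) eqxx.
Qed.

End WeierstrassModel.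

(** * Monomial birational maps *)

Section NearProduct.
Variables (k : fieldType) (X Y : funSpaceType k).

Lemma near_fst (P : X -> Prop) (z : prod_variety X Y) :
  (\forall x \near z.1, P x) -> \forall z' \near z, P z'.1.
Proof.
move=> nP; have : nbhs z.1 P by []; rewrite nbhsE => -[W [oW Wz] WP].
exists [set z' : prod_variety X Y | W z'.1]; split=> //; last by move=> z' /WP.
move=> y Wy; exists W, setT, (tensor_cst X Y 1).
rewrite tensor_cstE oner_neq0; split=> //; first by split; first exact: openT.
by move=> z' Wz' _; split=> //; exact: tensor_cst_regular.
Qed.

Lemma near_snd (P : Y -> Prop) (z : prod_variety X Y) :
  (\forall y \near z.2, P y) -> \forall z' \near z, P z'.2.
Proof.
move=> nP; have : nbhs z.2 P by []; rewrite nbhsE => -[W [oW Wz] WP].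
exists [set z' : prod_variety X Y | W z'.2]; split=> //; last by move=> z' /WP.
move=> y Wy; exists setT, W, (tensor_cst X Y 1).
rewrite tensor_cstE oner_neq0; split=> //; first by split; first exact: openT.
by move=> z' _ Wz'; split=> //; exact: tensor_cst_regular.
Qed.

End NearProduct.

Section BirationalMaps.
Variables (k : closedFieldType).
Hypothesis hk : [pchar k] =i pred0.
Variable E : elliptic_curve k.
Local Notation R := (coord_ring (wa E) (wb E)).
Variable K : fraction_field R.
Local Notation C := (set_type (ell_points E)).
Local Notation L := (proj_space k 1).
Local Notation XY := (prod_variety C L).
Local Notation on := (on_curve (wa E) (wb E)).
Local Notation chart e := (chart E (set_val e)).
Local Notation generic := (@generic k (wa E) (wb E)).
Implicit Types (e : C) (l : L) (z : XY).

Lemma chart_on e : hcoord (set_val e) 2 != 0 -> on (chart e).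
Proof. by move=> e2; apply: (chart_on_curve hk) => //; exact: set_valP. Qed.

(** A nonempty open subset is the nonvanishing locus of forms.  One of them
    does not vanish at some given point; whether this point is affine or the
    origin, the form is nonzero as a function on the affine curve. *)
Lemma open_generic (O : set C) : open O -> O !=set0 ->
  generic (fun p => forall e, set_val e = affine_pt E p -> O e).
Proof.
move=> [B [S hS eB] eO] [e0 Oe0].
have : B (set_val e0) by move: Oe0; rewrite -eO.
rewrite eB => /existsNP[h /not_implyP[Sh /eqP he0]].
have [d hh] := hS h Sh.
exists (dehomog E h); split; last first.
  move=> p op; rewrite (ev_dehomog hk) // => hp e ee.
  rewrite -eO /= eB => /(_ h Sh); have [c c0 eh] := hcoord_affine_pt E p.
  rewrite ee (meval_eq _ eh) (dhomog_meval_scale _ _ hh) => /eqP.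
  by rewrite mulf_eq0 expf_eq0 (negbTE c0) andbF (negbTE hp).
have [e2|e2] := eqVneq (hcoord (set_val e0) 2) 0; last first.
  apply: contra he0 => /eqP w0; have := ev_dehomog hk h (chart_on e2).
  rewrite w0 /ev !horner0 mul0r addr0 => /esym/eqP.
  rewrite (meval_eq (v2 := fun i => (hcoord (set_val e0) 2)^-1 * hcoord (set_val e0) i)).
    by rewrite (dhomog_meval_scale _ _ hh) mulf_eq0 expf_eq0 invr_eq0 (negbTE e2) andbF.
  by move=> i; rewrite affine_vec_chart // mulrC.
have e0' : hcoord (set_val e0) 0 = 0.
  have : ell_points E (set_val e0) by exact: set_valP.
  rewrite /ell_points /= ell_polyE e2 => /eqP.
  rewrite !expr0n /= !mulr0 !addr0 sub0r oppr_eq0 expf_eq0 /=.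
  by move/eqP.
apply: (@dehomog_neq0 _ hk E d _ (hcoord (set_val e0) 1)) => //.
congr (_ != 0) : he0; apply: meval_eq => i.
case: i => -[|[|[|//]]] hi /=.
- by rewrite -[RHS]e0'; congr hcoord; exact: val_inj.
- by congr hcoord; exact: val_inj.
- by rewrite -[RHS]e2; congr hcoord; exact: val_inj.
Qed.

(** A point whose abscissa is not a root of the norm of v. *)
Lemma generic_nonempty Q : generic Q -> exists2 p, on p & Q p.
Proof.
move=> [v [v0 hv]]; have := v0; rewrite -coord_norm_eq0 => /poly_nonroot[t].
have [s es] := closed_nth_root (t ^+ 3 + wa E * t + wb E) (isT : (0 < 2)%N).
have op : on (t, s) by [].
rewrite (norm_ev v op) mulf_eq0 negb_or => /andP[pv _].
by exists (t, s) => //; exact: hv.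
Qed.

Definition lift_pt p (op : on p) : C :=
  SigSub (mem_set (affine_pt_curve hk op)).

Lemma dense_generic Q : generic Q ->
  dense [set e : C | hcoord (set_val e) 2 != 0 /\ Q (chart e)].
Proof.
move=> gQ O O0 oO.
have [p op [Op Qp]] := generic_nonempty (genericI (open_generic oO O0) gQ).
exists (lift_pt op); split; first exact: Op.
by split=> /=; [exact: affine_pt_hcoord2 | rewrite affine_ptK].
Qed.

Definition good (Q : k * k -> Prop) : set XY :=
  [set z | (hcoord (set_val z.1) 2 != 0 /\ Q (chart z.1)) /\
           (hcoord z.2 1 != 0 /\ aff1 z.2 != 0)].

Lemma dense_good Q : generic Q -> dense (good Q).
Proof. by move=> gQ; exact: (dense_prod (dense_generic gQ) (@dense_aff1 k)). Qed.

Lemma dense_sub (T : topologicalType) (A B : set T) : A `<=` B -> dense A -> dense B.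
Proof. by move=> AB dA O O0 oO; have [x [Ox /AB]] := dA O O0 oO; exists x. Qed.

Lemma regular_ev e (u : R) : hcoord (set_val e) 2 != 0 ->
  regular_at (fun e' : C => ev (chart e') u) e.
Proof.
move=> e2; have rc i := regular_at_val (regular_at_hcoord_div i e2).
have r1 : regular_at (fun e' : C => (chart e').1) e.
  exact: (regular_atD _ _ _ (rc 0) (regular_at_cst _ _)).
have r2 : regular_at (fun e' : C => (chart e').2) e.
  apply: (regular_atD _ _ _ (rc 1)).
  apply: (regular_atM _ (fun=> 2^-1) _ _ (regular_at_cst _ _)).
  apply: (regular_atD _ _ _ _ (regular_at_cst _ _)).
  exact: (regular_atM _ _ _ (regular_at_cst _ _) (rc 0)).
apply: (regular_atD _ _ _ (regular_at_horner u.1 r1)).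
exact: (regular_atM _ _ _ (regular_at_horner u.2 r1) r2).
Qed.

Lemma regular_fev e (f : K) : hcoord (set_val e) 2 != 0 ->
  ev (chart e) (den f) != 0 -> regular_at (fun e' : C => fev (chart e') f) e.
Proof. by move=> e2 ef; apply: regular_at_div => //; exact: regular_ev. Qed.

(** The map (p, t) |-> (rmap phi p, g(p) t).  Outside its domain the first
    component may fail to lie on the curve, and [insubd] fills in a default. *)
Definition fiber_map (phi : {rmorphism K -> K}) (g : K) z : XY :=
  (insubd z.1 (affine_pt E (rmap phi (chart z.1))),
   pt1 (fev (chart z.1) g * aff1 z.2)).

(** A single function v whose zeros contain all the points where the maps
    defined by (phi, g) and (phi', g') are undefined or not inverse to each
    other. *)
Definition inverse_data (phi phi' : {rmorphism K -> K}) (g g' : K) (v : R) :=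
  forall p, on p -> ev p v != 0 ->
  [/\ on (rmap phi p), ev p (den (phi (fx K))) != 0,
      ev p (den (phi (fy K))) != 0, ev p (den g) != 0 &
      rmap phi' (rmap phi p) = p /\ fev (rmap phi p) g' * fev p g = 1].

(** The condition on the image makes this domain symmetric, so that the two
    maps exchange the domains attached to (v, v') and (v', v). *)
Definition fiber_dom (phi : {rmorphism K -> K}) (v v' : R) : set XY :=
  [set z | [/\ hcoord (set_val z.1) 2 != 0, hcoord z.2 1 != 0,
               ev (chart z.1) v != 0 & ev (rmap phi (chart z.1)) v' != 0]].

Section FiberMap.
Variables (phi phi' : {rmorphism K -> K}) (g g' : K) (v v' : R).
Hypothesis hv : inverse_data phi phi' g g' v.

Lemma fiber_map1 z : hcoord (set_val z.1) 2 != 0 -> on (rmap phi (chart z.1)) ->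
  set_val (fiber_map phi g z).1 = affine_pt E (rmap phi (chart z.1)).
Proof. by move=> z2 oz; apply: insubdK; apply/mem_set/(affine_pt_curve hk). Qed.

Lemma fiber_map_dom z : fiber_dom phi v v' z -> fiber_dom phi' v' v (fiber_map phi g z).
Proof.
move=> [z2 l1 zv zv']; have [op _ _ _ [pK _]] := hv (chart_on z2) zv.
rewrite /fiber_dom /= fiber_map1 // affine_ptK pK.
by split=> //; [exact: affine_pt_hcoord2 | exact: pt1_hcoord].
Qed.

Lemma fiber_mapK z : fiber_dom phi v v' z ->
  fiber_map phi' g' (fiber_map phi g z) = z.
Proof.
move=> [z2 l1 zv zv']; have [op _ _ _ [pK gK]] := hv (chart_on z2) zv.
rewrite [LHS]/fiber_map fiber_map1 // affine_ptK pK chartK //= aff1K mulrA gK.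
rewrite mul1r pt1K //.
by case: z {z2 l1 zv zv' op pK gK} => e l /=; congr (_, _); rewrite valKd.
Qed.

Lemma regular_rmap e (u : R) : hcoord (set_val e) 2 != 0 ->
  ev (chart e) v != 0 -> regular_at (fun e' : C => ev (rmap phi (chart e')) u) e.
Proof.
move=> e2 ev0; have [_ dx dy _ _] := hv (chart_on e2) ev0.
have r1 := regular_fev e2 dx; have r2 := regular_fev e2 dy.
apply: (regular_atD _ _ _ (regular_at_horner u.1 r1)).
exact: (regular_atM _ _ _ (regular_at_horner u.2 r1) r2).
Qed.

Lemma near_chart e : hcoord (set_val e) 2 != 0 ->
  \forall e' \near e, hcoord (set_val e') 2 != 0.
Proof.
move=> e2.
exact: (near_set_val (P := fun x => hcoord x 2 != 0) (near_hcoord_neq0 e2)).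
Qed.

Lemma open_fiber_dom : open (fiber_dom phi v v').
Proof.
apply: open_near => z [z2 l1 zv zv'].
have n1 : \forall y \near z, hcoord (set_val y.1) 2 != 0.
  exact: (near_fst (P := fun e => hcoord (set_val e) 2 != 0) (near_chart z2)).
have n2 : \forall y \near z, hcoord y.2 1 != 0.
  exact: (near_snd (P := fun l => hcoord l 1 != 0) (near_hcoord_neq0 l1)).
have n3 : \forall y \near z, ev (chart y.1) v != 0.
  exact: (near_fst (P := fun e => ev (chart e) v != 0)
    (regular_at_neq0 _ _ (regular_ev v z2) zv)).
have n4 : \forall y \near z, ev (rmap phi (chart y.1)) v' != 0.
  exact: (near_fst (P := fun e => ev (rmap phi (chart e)) v' != 0)
    (regular_at_neq0 _ _ (regular_rmap v' z2 zv) zv')).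
by apply: filterS2 (filterI n1 n2) (filterI n3 n4) => y [? ?] [? ?].
Qed.

Lemma dense_fiber_dom : (forall c, phi (fcst K c) = fcst K c) ->
  v != 0 -> v' != 0 -> dense (fiber_dom phi v v').
Proof.
move=> pC v0 v'0; have gv := @generic_ev_neq0 _ _ _ v v0.
have gv' := generic_rmap pC (@generic_ev_neq0 _ _ _ v' v'0).
apply: dense_sub (dense_good (genericI gv gv')).
by move=> z [[z2 [zv zv']] [l1 _]].
Qed.

Lemma fiber_map_morphism : morphism_on (fiber_dom phi v v') (fiber_map phi g).
Proof.
move=> z [z2 l1 zv zv']; have [op dx dy dg _] := hv (chart_on z2) zv.
have near_dom : \forall y \near z, fiber_dom phi v v' y.
  by apply: open_nbhs_nbhs; split; [exact: open_fiber_dom | split].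
have rfst (h : C -> k) : regular_at h z.1 -> regular_at (fun y : XY => h y.1) z.
  exact: regular_at_fst.
have rx := rfst _ (regular_fev z2 dx); have ry := rfst _ (regular_fev z2 dy).
have rg := rfst _ (regular_fev z2 dg).
have rt : regular_at (fun y : XY => aff1 y.2) z.
  by apply: regular_at_snd; exact: regular_at_hcoord_div.
have [] // : morphism_at (X := XY) (Y := XY) (fiber_map phi g) z.
apply: prod_morphism_at.
  apply: sub_morphism_at.
  apply: (@proj_morphism_at _ _ _ _
    (fun i (y : XY) => affine_vec E (rmap phi (chart y.1)) 0 i)).
    have rX := regular_atD _ _ _ rx (regular_at_cst (- wshift E) _).
    have rY := regular_atD _ _ _ ry (regular_atN (regular_atM _ _ _
      (regular_atD _ _ _ (regular_atM _ _ _ (regular_at_cst (ell_a1 E) _) rX)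
        (regular_at_cst (ell_a3 E) _)) (regular_at_cst 2^-1 _))).
    move=> i; under eq_fun do rewrite mxE.
    case: i => -[|[|[|//]]] hi; [exact: rX | exact: rY | exact: regular_at_cst].
  apply: filterS near_dom => y [y2 _ yv _] /=.
  have [opy _ _ _ _] := hv (chart_on y2) yv.
  have := fiber_map1 y2 opy; rewrite /fiber_map /= => ->.
  have [c c0 ec] := hcoord_affine_pt E (rmap phi (chart y.1)).
  by exists c^-1 => [|i]; rewrite ?invr_eq0 // ec mulKf.
apply: (@proj_morphism_at _ _ _ _
    (fun i (y : XY) => (hvec 1 [:: fev (chart y.1) g * aff1 y.2; 1]) 0 i)).
  move=> i; under eq_fun do rewrite mxE.
  case: i => -[|[|//]] hi; last exact: regular_at_cst.
  exact: (regular_atM _ _ _ rg rt).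
apply: (@nearW _ (nbhs z)) => y.
have [c c0 ec] := hcoord_proj_of (hvec1_neq0 (fev (chart y.1) g * aff1 y.2)).
by exists c^-1 => [|i]; rewrite ?invr_eq0 // ec mulKf.
Qed.

End FiberMap.

(** The points (p, t) with p generic and t in the affine line are dense, so
    that this determines the class of the representative. *)
Definition acts_as (f : birational_rep XY) (phi : {rmorphism K -> K}) (g : K) :=
  generic (fun p => forall e t, set_val e = affine_pt E p ->
    [/\ bdom f (e, pt1 t),
       set_val (bfun f (e, pt1 t)).1 = affine_pt E (rmap phi p) &
       (bfun f (e, pt1 t)).2 = pt1 (fev p g * t)]).

Lemma inverse_data_exists (phi phi' : {rmorphism K -> K}) (g g' : K) :
  (forall c, phi (fcst K c) = fcst K c) -> (forall c, phi' (fcst K c) = fcst K c) ->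
  cancel phi' phi -> phi g' * g = 1 ->
  exists2 v, v != 0 & inverse_data phi phi' g g' v.
Proof.
move=> pC pC' pK eg.
have gid := rmap_comp pC' pC.
have gid' : generic (fun p => rmap (phi \o phi') p = p) by apply: rmap_id.
have gg := genericI (fev_hom pC g') (genericI (fevM (phi g') g) (fev_cst K 1)).
have gd := genericI (generic_ev_neq0 (den_neq0 (phi (fx K))))
  (genericI (generic_ev_neq0 (den_neq0 (phi (fy K)))) (generic_ev_neq0 (den_neq0 g))).
have := genericI (genericI (rmap_on_curve pC) gd) (genericI (genericI gid gid') gg).
move=> [v [v0 hv]]; exists v => // p op pv.
have [[op' [d1 [d2 d3]]] [[i1 i2] [g1 [g2 g3]]]] := hv p op pv.
split=> //; split; first by rewrite i1 i2.
by rewrite -g1 -g2 eg -(rmorph1 (fcst K)) g3.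
Qed.

Lemma acts_as_exists (phi phi' : {rmorphism K -> K}) (g : K) :
  (forall c, phi (fcst K c) = fcst K c) -> (forall c, phi' (fcst K c) = fcst K c) ->
  cancel phi phi' -> cancel phi' phi -> g != 0 ->
  exists f : birational_rep XY, acts_as f phi g.
Proof.
move=> pC pC' pK pK' g0; pose g' := (phi' g)^-1.
have e1 : phi g' * g = 1 by rewrite fmorphV pK' mulVf.
have e2 : phi' g * g' = 1 by rewrite divff ?fmorph_eq0.
have [v v0 hv] := inverse_data_exists pC pC' pK' e1.
have [v' v'0 hv'] := inverse_data_exists pC' pC pK e2.
pose o := @open_fiber_dom _ _ _ _ _ v' hv; pose o' := @open_fiber_dom _ _ _ _ _ v hv'.
exists (BirationalRep o (dense_fiber_dom pC v0 v'0) o' (dense_fiber_dom pC' v'0 v0)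
  (@fiber_map_morphism _ _ _ _ _ v' hv) (@fiber_map_morphism _ _ _ _ _ v hv')
  (fun z => @fiber_map_dom _ _ _ _ _ v' hv z) (fun z => @fiber_map_dom _ _ _ _ _ v hv' z)
  (fun z => @fiber_mapK _ _ _ _ _ v' hv z) (fun z => @fiber_mapK _ _ _ _ _ v hv' z)).
have gd := genericI (generic_ev_neq0 v0) (genericI (rmap_on_curve pC)
  (generic_rmap pC (generic_ev_neq0 v'0))).
apply: generic_mono gd => p op [pv [op' pv']] e t ee /=.
have ec : chart e = p by rewrite ee affine_ptK.
have e2' : hcoord (set_val e) 2 != 0 by rewrite ee affine_pt_hcoord2.
split.
- by rewrite /fiber_dom /= ec; split=> //; exact: pt1_hcoord.
- rewrite -[RHS]/(affine_pt E (rmap phi p)) -ec.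
  by apply: (@fiber_map1 phi g (e, pt1 t)); rewrite /= ?ec.
- by rewrite ec aff1K.
Qed.

(** Composition is contravariant on functions: f after f' multiplies t by h(p)
    and then by the value of g at the image of p. *)
Lemma acts_as_mul f f' (phi psi : {rmorphism K -> K}) g h :
  (forall c, phi (fcst K c) = fcst K c) -> (forall c, psi (fcst K c) = fcst K c) ->
  acts_as f phi g -> acts_as f' psi h ->
  acts_as (birational_repM f f') (psi \o phi) (h * psi g).
Proof.
move=> pC qC af af'.
have gp := genericI (generic_rmap qC af) (genericI af' (rmap_comp pC qC)).
apply: generic_mono (genericI gp (genericI (fev_hom qC g) (fevM h (psi g)))).
move=> p op [[h1 [h2 ec]] [e1 e2]] e t ee.
have [d2 v2 t2] := h2 e t ee.
have [d1 v1 t1] := h1 _ (fev p h * t) v2.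
rewrite /= [bfun f' _]surjective_pairing t2; split.
- split; first exact: d2.
  by rewrite /preimage /= [bfun f' _]surjective_pairing t2; exact: d1.
- by rewrite -ec; exact: v1.
- by apply: etrans t1 _; rewrite e2 e1 mulrA [fev p h * _]mulrC.
Qed.

Lemma open_generic_locus (w : R) :
  open [set z : XY | [/\ hcoord (set_val z.1) 2 != 0, hcoord z.2 1 != 0 &
                         ev (chart z.1) w != 0]].
Proof.
apply: open_near => z [z2 l1 zw].
have n1 : \forall y \near z, hcoord (set_val y.1) 2 != 0.
  exact: (near_fst (P := fun e => hcoord (set_val e) 2 != 0) (near_chart z2)).
have n2 : \forall y \near z, hcoord y.2 1 != 0.
  exact: (near_snd (P := fun l => hcoord l 1 != 0) (near_hcoord_neq0 l1)).
have n3 : \forall y \near z, ev (chart y.1) w != 0.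
  exact: (near_fst (P := fun e => ev (chart e) w != 0)
    (regular_at_neq0 _ _ (regular_ev w z2) zw)).
by apply: filterS3 n1 n2 n3 => y.
Qed.

Lemma acts_as_eq f f' (phi phi' : {rmorphism K -> K}) g :
  phi =1 phi' -> acts_as f phi g -> acts_as f' phi' g -> same_rational_map f f'.
Proof.
move=> ephi af af'; have [w [w0 hw]] := genericI af af'.
exists [set z : XY | [/\ hcoord (set_val z.1) 2 != 0, hcoord z.2 1 != 0 &
                         ev (chart z.1) w != 0]].
have key e l : hcoord (set_val e) 2 != 0 -> hcoord l 1 != 0 ->
    ev (chart e) w != 0 ->
    [/\ bdom f (e, l), bdom f' (e, l) & bfun f (e, l) = bfun f' (e, l)].
  move=> e2 l1 ew; have [h1 h2] := hw _ (chart_on e2) ew.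
  have ee : set_val e = affine_pt E (chart e) by rewrite chartK.
  have [d1 v1 t1] := h1 e (aff1 l) ee; have [d2 v2 t2] := h2 e (aff1 l) ee.
  rewrite pt1K // in d1 v1 t1 d2 v2 t2; split=> //.
  rewrite [LHS]surjective_pairing [RHS]surjective_pairing t1 t2; congr (_, _).
  by apply: val_inj; rewrite [LHS]v1 [RHS]v2 /rmap !ephi.
split.
- exact: open_generic_locus.
- apply: dense_sub (dense_good (generic_ev_neq0 w0)).
  by move=> z [[z2 zw] [l1 _]].
- by move=> [e l] [e2 l1 ew]; have [d1 d2 _] := key e l e2 l1 ew.
- by move=> [e l] /set_mem[e2 l1 ew]; have [_ _] := key e l e2 l1 ew.
Qed.

Lemma acts_as1 : acts_as (birational_rep1 XY) idfun 1.
Proof.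
have gi : generic (fun p => rmap (idfun : {rmorphism K -> K}) p = p) by apply: rmap_id.
have := genericI gi (fev_cst K 1); apply: generic_mono => p op.
by rewrite rmorph1 => -[-> ->] e t ee; rewrite mul1r.
Qed.

(** Compare the action at one point of the fibre other than 0 and infinity. *)
Lemma acts_as_scalar f c : acts_as f idfun (fcst K c) ->
  same_rational_map f (birational_rep1 XY) -> c = 1.
Proof.
move=> af [W [oW dW sW eW]].
have gi : generic (fun p => rmap (idfun : {rmorphism K -> K}) p = p) by apply: rmap_id.
have gQ := genericI af (genericI gi (fev_cst K c)).
have [p op _] := generic_nonempty gQ.
have [z1 [_ Wz1]] := dW setT (ex_intro _ (lift_pt op, pt1 0) I) openT.
have [[e l] [Wz [[/= e2 [az [ec eg]]] [l1 l0]]]] := dense_good gQ (ex_intro _ z1 Wz1) oW.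
have ee : set_val e = affine_pt E (chart e) by rewrite chartK.
have [_ _] := az e (aff1 l) ee; rewrite pt1K // eg => et.
have eid : bfun f (e, l) = (e, l) by exact: (eW _ (mem_set Wz)).
have /(congr1 (@aff1 k)) := etrans (esym (congr1 snd eid)) et.
rewrite aff1K /= => h; apply: (mulIf l0).
by rewrite mul1r.
Qed.

End BirationalMaps.

(** * Heisenberg groups of unbounded order *)

Section Heisenberg.
Variable G : groupType.
Local Open Scope group_scope.

Definition heisenberg_triple n (A B Z : G) :=
  [/\ [/\ A ^+ n = 1, B ^+ n = 1 & Z ^+ n = 1],
      commute Z A, commute Z B, B * A = Z * (A * B) &
      forall l, Z ^+ l = 1 -> (n %| l)%N].

Lemma expg_modn (x : G) n i : x ^+ n = 1 -> x ^+ (i %% n) = x ^+ i.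
Proof.
by move=> xn; rewrite [in RHS](divn_eq i n) expgnDr mulnC expgnA xn expg1n mul1g.
Qed.

Lemma expg_inv (x : G) n i : (0 < n)%N -> x ^+ n = 1 -> (x ^+ i)^-1 = x ^+ (i * n.-1).
Proof.
move=> n0 xn; apply: (@mulgI _ (x ^+ i)); rewrite mulgV -expgnDr -mulnS prednK //.
by rewrite mulnC expgnA xn expg1n.
Qed.

Section Triple.
Variables (n : nat) (A B Z : G).
Hypothesis n_gt0 : (0 < n)%N.
Hypothesis ABZ : heisenberg_triple n A B Z.

Let An : A ^+ n = 1. Proof. by case: ABZ => [[]]. Qed.
Let Bn : B ^+ n = 1. Proof. by case: ABZ => [[]]. Qed.
Let Zn : Z ^+ n = 1. Proof. by case: ABZ => [[]]. Qed.
Let ZA : commute Z A. Proof. by case: ABZ. Qed.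
Let ZB : commute Z B. Proof. by case: ABZ. Qed.
Let BA : B * A = Z * (A * B). Proof. by case: ABZ. Qed.

Lemma heisenberg_swap i j : B ^+ j * A ^+ i = Z ^+ (j * i) * (A ^+ i * B ^+ j).
Proof.
have swap1 : B * A ^+ i = Z ^+ i * (A ^+ i * B).
  elim: i => [|i IHi]; first by rewrite !expg0 !mul1g mulg1.
  rewrite [in LHS]expgSr mulgA IHi -!mulgA BA (mulgA _ Z) -(commuteX i ZA).
  by rewrite expgSr [in RHS]expgSr -!mulgA.
elim: j => [|j IHj]; first by rewrite mul0n !expg0 !mul1g mulg1.
rewrite [in LHS]expgS -mulgA IHj (mulgA B).
have -> : B * Z ^+ (j * i) = Z ^+ (j * i) * B by apply: commuteX; apply: commute_sym.
rewrite -!mulgA (mulgA B) swap1 mulSn addnC expgnDr expgS -!mulgA.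
by [].
Qed.

(** By the commutation relation this is the group generated by A, B and Z; it
    is finite since the exponents only matter modulo n. *)
Definition heisenberg_set : set G :=
  [set x | exists i j l, x = A ^+ i * B ^+ j * Z ^+ l].

Lemma finite_heisenberg_set : finite_set heisenberg_set.
Proof.
have fI := finite_II n.
apply: (@sub_finite_set _ _ ((fun t : nat * nat * nat =>
    A ^+ t.1.1 * B ^+ t.1.2 * Z ^+ t.2) @` (`I_n `*` `I_n `*` `I_n))).
  move=> _ [i [j [l ->]]]; exists (i %% n, j %% n, l %% n)%N => /=.
    by rewrite !ltn_mod.
  by rewrite !expg_modn.
by apply: finite_image; do 2?apply: finite_setX.
Qed.

Lemma heisenberg_central i j l :
  Z ^+ l * (A ^+ i * B ^+ j) = A ^+ i * B ^+ j * Z ^+ l.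
Proof.
apply: commute_sym; apply: commuteX; apply: commute_sym.
by apply: commuteM; apply: commuteX.
Qed.

Lemma heisenberg_mul i j l i' j' l' :
  A ^+ i * B ^+ j * Z ^+ l * (A ^+ i' * B ^+ j' * Z ^+ l') =
  A ^+ (i + i') * B ^+ (j + j') * Z ^+ (l + l' + j * i').
Proof.
rewrite -!mulgA (mulgA (A ^+ i')) (mulgA (Z ^+ l)) heisenberg_central.
rewrite -!mulgA -expgnDr (mulgA (B ^+ j) (A ^+ i')) heisenberg_swap.
rewrite -(mulgA (Z ^+ _)) -(mulgA (A ^+ i') (B ^+ j)) (mulgA (B ^+ j) (B ^+ j')) -expgnDr.
rewrite (mulgA (A ^+ i') (B ^+ _)) (mulgA (Z ^+ (j * i'))) heisenberg_central.
by rewrite -!mulgA -expgnDr (mulgA (A ^+ i)) -expgnDr (addnC (j * i')%N).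
Qed.

Lemma heisenberg_inv i j l : exists i' j' l',
  (A ^+ i * B ^+ j * Z ^+ l)^-1 = A ^+ i' * B ^+ j' * Z ^+ l'.
Proof.
rewrite !invgM !(expg_inv _ n_gt0) // heisenberg_swap mulgA -expgnDr.
by rewrite heisenberg_central; do 3!eexists.
Qed.

Lemma group_closed_heisenberg_set : group_closed (mem heisenberg_set).
Proof.
split; first by apply/mem_set; exists 0%N, 0%N, 0%N; rewrite !expg0 !mulg1.
move=> _ _ /set_mem[i [j [l ->]]] /set_mem[i' [j' [l' ->]]]; apply/mem_set.
have [i1 [j1 [l1 ->]]] := heisenberg_inv i' j' l'.
by rewrite heisenberg_mul; do 3!eexists.
Qed.

(** The commutator of A^i and B^j is Z^(ij), up to the sign of the exponent. *)
Lemma heisenberg_commute i j : commute (A ^+ i) (B ^+ j) -> (n %| j * i)%N.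
Proof.
move=> cAB; case: ABZ => _ _ _ _; apply.
by apply: (@mulIg _ (A ^+ i * B ^+ j)); rewrite -heisenberg_swap mul1g cAB.
Qed.

End Triple.

(** Two of the J + 1 elements 1, x, ..., x^J lie in the same coset. *)
Lemma coset_pigeonhole (S B : set G) J (x : G) : group_closed (mem S) ->
  ([set [set (y * a) | a in S] | y in B] #<= `I_J)%card ->
  (forall i, B (x ^+ i)) -> exists2 i, (0 < i <= J)%N & S (x ^+ i).
Proof.
move=> gS cJ Bx.
pose f i : set G := [set (x ^+ i * a) | a in S].
have [i [j [ij jJ eij]]] : exists i j, [/\ (i < j)%N, (j <= J)%N & f i = f j].
  apply/not_existsP => h.
  have inj : {in `I_J.+1 &, injective f}.
    move=> i j /set_mem iJ /set_mem jJ e; case: (ltngtP i j) => // ij.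
      by case: (h i); exists j.
    by case: (h j); exists i.
  have sub : f @` `I_J.+1 `<=` [set [set (y * a) | a in S] | y in B].
    by move=> _ [i _ <-]; exists (x ^+ i); [exact: Bx |].
  have := card_le_trans (subset_card_le sub) cJ.
  by rewrite (card_le_eql (inj_card_eq inj)) card_le_II ltnn.
exists (j - i)%N; first by rewrite subn_gt0 ij (leq_trans (leq_subr _ _)).
have S1 : S 1 by apply/set_mem; case: gS.
have : f j (x ^+ j) by exists 1; rewrite ?mulg1.
rewrite -eij => -[a Sa e].
suff -> : x ^+ (j - i) = a by [].
by apply: (@mulgI _ (x ^+ i)); rewrite e -expgnDr subnKC // ltnW.
Qed.

(** A commutative subgroup of index at most J contains A^a and B^b with
    0 < a, b <= J; these commute, so that n divides a b <= J^2. *)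
Lemma heisenberg_not_jordan :
  (forall N, exists n A B Z, (N < n)%N /\ heisenberg_triple n A B Z) ->
  ~ jordan_group G.
Proof.
move=> h [J J0 hJ]; have [n [A [B [Z [Nn hABZ]]]]] := h (J * J)%N.
have n0 : (0 < n)%N by apply: leq_ltn_trans Nn.
have [S [SB gS cS cardS]] := hJ _ (finite_heisenberg_set n0 hABZ)
  (group_closed_heisenberg_set n0 hABZ).
have [|a /andP[a0 aJ] Sa] := coset_pigeonhole gS cardS (x := A).
  by move=> i; exists i, 0%N, 0%N; rewrite !expg0 !mulg1.
have [|b /andP[b0 bJ] Sb] := coset_pigeonhole gS cardS (x := B).
  by move=> i; exists 0%N, i, 0%N; rewrite !expg0 mul1g mulg1.
have := heisenberg_commute hABZ (cS _ _ (mem_set Sa) (mem_set Sb)).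
move=> /dvdn_leq; rewrite muln_gt0 a0 b0 => /(_ isT).
by rewrite leqNgt (leq_ltn_trans _ Nn) // leq_mul.
Qed.

End Heisenberg.

(** * The Heisenberg group of the elliptic curve *)

Section MonomialAutomorphisms.
Variables (k : closedFieldType).
Hypothesis hk : [pchar k] =i pred0.
Variable E : elliptic_curve k.
Variable K : fraction_field (coord_ring (wa E) (wb E)).
Local Notation XY := (prod_variety (set_type (ell_points E)) (proj_space k 1)).
Implicit Types (phi psi : {rmorphism K -> K}) (x y : Bir XY).

(** The classes in the group of the maps (p, t) |-> (rmap phi p, g(p) t).
    Everything about them is decided by the pair (phi, g). *)
Definition monomial x phi g := exists2 f, x = \pi_(Bir XY)%qT f & acts_as f phi g.

Lemma monomialM x y phi psi g h :
  (forall c, phi (fcst K c) = fcst K c) -> (forall c, psi (fcst K c) = fcst K c) ->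
  monomial x phi g -> monomial y psi h -> monomial (x * y)%g (psi \o phi) (h * psi g).
Proof.
move=> pC qC [f -> af] [f' -> af']; exists (birational_repM f f').
  exact: Bir_mulE.
exact: acts_as_mul.
Qed.

Lemma monomial1 : monomial 1%g idfun 1.
Proof. exists (birational_rep1 XY); [reflexivity | exact: acts_as1]. Qed.

Lemma monomial_eq x y phi psi g : phi =1 psi ->
  monomial x phi g -> monomial y psi g -> x = y.
Proof.
move=> e [f -> af] [f' -> af']; apply/Bir_piP.
exact: (acts_as_eq hk e af af').
Qed.

Lemma monomial_cst c : monomial 1%g idfun (fcst K c) -> c = 1.
Proof.
move=> [f e af]; apply: (acts_as_scalar hk af).
by apply/Bir_piP; rewrite -e.
Qed.

Lemma monomial_exists phi phi' g :
  (forall c, phi (fcst K c) = fcst K c) -> (forall c, phi' (fcst K c) = fcst K c) ->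
  cancel phi phi' -> cancel phi' phi -> g != 0 -> exists x, monomial x phi g.
Proof.
move=> pC pC' pK pK' g0; have [f af] := acts_as_exists hk pC pC' pK pK' g0.
by exists (\pi_(Bir XY)%qT f), f.
Qed.

Lemma hpow_cst phi n : (forall c, phi (fcst K c) = fcst K c) ->
  forall c, hpow phi n (fcst K c) = fcst K c.
Proof. by move=> pC c; elim: n => [|n IHn] /=; rewrite ?IHn ?pC. Qed.

Lemma monomialX x phi g n : (forall c, phi (fcst K c) = fcst K c) ->
  monomial x phi g -> monomial (x ^+ n)%g (hpow phi n) (nrm phi n g).
Proof.
move=> pC mx; elim: n => [|n IHn].
  by rewrite expg0 /nrm big_ord0; exact: monomial1.
rewrite expgSr.
have -> : nrm phi n.+1 g = g * phi (nrm phi n g).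
  by rewrite /nrm big_ord_recl rmorph_prod; congr (_ * _); apply: eq_bigr.
by apply: monomialM => //; exact: hpow_cst.
Qed.

Lemma monomial_ext x phi psi g : phi =1 psi -> monomial x phi g -> monomial x psi g.
Proof.
move=> ephi [f -> af]; exists f => //; apply: generic_mono af => p op h e t ee.
by rewrite /rmap -!ephi; exact: h.
Qed.

End MonomialAutomorphisms.

Theorem theorem1p2 (k : closedFieldType) (hk : [pchar k] =i pred0)
    (E : elliptic_curve k) :
  ~ jordan_group (Bir (prod_variety (set_type (ell_points E)) (proj_space k 1))).
Proof.
have [K] := fraction_field_exists (coord_ring (wa E) (wb E)).
have [e1 [e2 [r1 r2 e12]]] := weierstrass_two_roots hk E.
apply: heisenberg_not_jordan => N.
have [phi [psi [g [h [c /= [[pC qC pn qn pq] [g0 h0 Ng Nh] ec c2]]]]]] :=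
  heisenberg_exists hk K (@weierstrass_nonsing _ hk E) r1 r2 e12 N.
set n := (2 ^ N.+2)%N in pn qn Ng Nh.
have n_gt0 : (0 < n)%N by rewrite expn_gt0.
have idC c' : (idfun : {rmorphism K -> K}) (fcst K c') = fcst K c' by [].
have c0 : c != 0.
  apply/eqP => c0; move/eqP: c2; rewrite c0 expr0n expn_eq0 /= eq_sym oppr_eq0.
  by rewrite oner_eq0.
have inverse (theta : {rmorphism K -> K}) : hpow theta n =1 id ->
    cancel theta (hpow theta n.-1) /\ cancel (hpow theta n.-1) theta.
  move=> tn; split=> u; first by rewrite -hpowSr prednK ?tn.
  by rewrite -[LHS]/(hpow theta n.-1.+1 u) prednK ?tn.
have [A mA] : exists A, monomial A phi g.
  have [pK pK'] := inverse phi pn.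
  by apply: (monomial_exists hk pC _ pK pK' g0); exact: hpow_cst.
have [B mB] : exists B, monomial B psi h.
  have [qK qK'] := inverse psi qn.
  by apply: (monomial_exists hk qC _ qK qK' h0); exact: hpow_cst.
have [Z mZ] : exists Z, monomial Z (idfun : {rmorphism K -> K}) (fcst K c).
  by apply: (@monomial_exists _ hk _ _ _ idfun) => //; rewrite fmorph_eq0.
have hid i : hpow (idfun : {rmorphism K -> K}) i =1 id by move=> u; elim: i => //= i ->.
have mZX i : monomial (Z ^+ i)%g (idfun : {rmorphism K -> K}) (fcst K (c ^+ i)).
  have -> : fcst K (c ^+ i) = nrm (idfun : {rmorphism K -> K}) i (fcst K c).
    rewrite rmorphXn /nrm -[in LHS](card_ord i) -prodr_const.
    by apply: eq_bigr => j _; rewrite hid.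
  by apply: monomial_ext (monomialX i idC mZ) => u; rewrite hid.
have m1 := monomial1 K.
have cn : c ^+ n = 1 by rewrite /n expnS mulnC exprM c2 sqrrN expr1n.
exists n, A, B, Z; split.
  by rewrite (leq_trans _ (ltnW (ltn_expl N.+2 (isT : 1 < 2)%N))).
split.
- split.
  + have := monomialX n pC mA; rewrite Ng => mAn.
    by apply: (monomial_eq hk _ mAn m1); exact: pn.
  + have := monomialX n qC mB; rewrite Nh => mBn.
    by apply: (monomial_eq hk _ mBn m1); exact: qn.
  + have := mZX n; rewrite cn rmorph1 => mn.
    exact: (monomial_eq hk (frefl _) mn m1).
- have mZA := monomialM idC pC mZ mA; have mAZ := monomialM pC idC mA mZ.
  rewrite pC mulrC in mZA.
  by apply: (monomial_eq hk _ mZA mAZ).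
- have mZB := monomialM idC qC mZ mB; have mBZ := monomialM qC idC mB mZ.
  rewrite qC mulrC in mZB.
  by apply: (monomial_eq hk _ mZB mBZ).
- have mBA := monomialM qC pC mB mA; have mAB := monomialM pC qC mA mB.
  have pqC c' : (psi \o phi) (fcst K c') = fcst K c' by rewrite /= pC qC.
  have ec' : g * phi h = h * psi g * psi (phi (fcst K c)) by rewrite pC qC [RHS]mulrC.
  have mZAB := monomialM idC pqC mZ mAB; rewrite -[_ * _]ec' in mZAB.
  by apply: (monomial_eq hk _ mBA mZAB) => u; apply: pq.
- move=> l Zl; have := mZX l; rewrite Zl => /(monomial_cst hk) cl.
  (* The order of c divides the power n of 2, but not n / 2. *)
  have [m pm mn] := prim_order_exists n_gt0 cn.
  have {cl} : (m %| l)%N by rewrite (prim_order_dvd pm) cl.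
  have [i iN em] := (@dvdn_pfactor 2 m N.+2 isT mn).
  have [eiN|niN] := eqVneq i N.+2; first by rewrite /n -eiN -em.
  have : c ^+ (2 ^ N.+1) = 1.
    apply/eqP; rewrite -(prim_order_dvd pm) em dvdn_exp2l //.
    by rewrite -ltnS ltn_neqAle niN.
  rewrite c2 => /eqP; rewrite eq_sym -addr_eq0 -[1 + 1]/(2%:R).
  by rewrite (negbTE (pchar0_natr hk 1)).
Qed.
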